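(* Let $I\subset\Delta_\sigma$ and $c>0$. There exist $\varepsilon_0>0$ and $\ell>1$ such that for every $0<\varepsilon<\varepsilon_0$ and every $a\in A_I^+(c)$, $$G_\varepsilon\cdot a\subset K_{\ell\varepsilon}\cdot Z_{I,\ell\varepsilon}\cdot a\cdot H_{\ell\varepsilon}.$$
   Context: Setting: $G$ connected noncompact semisimple real Lie group with finite center, $\sigma$ an involution, $H$ a closed subgroup whose identity component is that of $\{\sigma(g)=g\}$, $\theta$ a Cartan involution commuting with $\sigma$, $K$ its fixed points, $\mathfrak p,\mathfrak q$ the $(-1)$-eigenspaces of $\theta,\sigma$; $\mathfrak a$ maximal abelian in $\mathfrak p\cap\mathfrak q$, $A=\exp\mathfrak a$, $\Sigma_\sigma$ the roots of $\mathfrak a$ on $\mathfrak g$ with root spaces $\mathfrak g_\beta$, $A^+$ a closed positive Weyl chamber, positive roots $\Sigma_\sigma^+$, simple roots $\Delta_\sigma$. $d$ is the right-invariant Riemannian metric on $G$ induced by $B(X,Y)=-\operatorname{Tr}(\operatorname{ad}X\circ\operatorname{ad}\theta(Y))$, and for $S\subset G$, $S_\varepsilon=\{s\in S:d(s,e)<\varepsilon\}$. $A_I=\exp\mathfrak a_I$ with $\mathfrak a_I=\{X\in\mathfrak a:\alpha(X)=0\,\forall\alpha\in I\}$; $Z_I$ is the centralizer of $A_I$ in $G$ (Lie algebra $\mathfrak z_I=\bigoplus_{\beta\in\Sigma_\sigma\cup\{0\},\,\beta|_{\mathfrak a_I}=0}\mathfrak g_\beta$), and $Z_{I,\varepsilon}=(Z_I)_\varepsilon$.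 $A_I^+(c)=\{a\in A^+:\beta(\log a)\ge c\text{ for }\beta\in\Delta_\sigma\setminus I,\ \beta(\log a)<c\text{ for }\beta\in I\}$. *)

(* Defs.v *)
From HB Require Import structures.
From mathcomp Require Import all_boot all_order all_algebra.
From mathcomp Require Import all_classical all_reals all_analysis.

Set Implicit Arguments.
Unset Strict Implicit.
Unset Printing Implicit Defensive.

Import Order.TTheory GRing.Theory Num.Theory.
Import numFieldNormedType.Exports.

Local Open Scope classical_set_scope.
Local Open Scope ring_scope.

(* Intended for [U] open and [V] finite-dimensional, where continuity of all the
   directional derivatives amounts to continuity of the differential. *)
Fixpoint Ck (R : realType) (V W : normedModType R) (k : nat) (U : set V)
    (f : V -> W) : Prop :=
  match k with
  | 0%N => {in U, continuous f}
  | k'.+1 => {in U, forall x, differentiable f x} /\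
             forall v, Ck k' U ('D_v f)
  end.

Definition smooth_on (R : realType) (V W : normedModType R) (U : set V)
  (f : V -> W) : Prop := forall k, Ck k U f.

(* [cfun] and [cinv] are total functions; their values outside [cdom] and
   outside [cfun @` cdom] are irrelevant. *)
Record chart (R : realType) (n : nat) (M : Type) := Chart {
  cdom : set M;
  cfun : M -> 'rV[R]_n;
  cinv : 'rV[R]_n -> M }.

Record is_chart (R : realType) (n : nat) (M : topologicalType)
    (phi : chart R n M) : Prop := IsChart {
  cdom_open : open (cdom phi);
  cimg_open : open (cfun phi @` cdom phi);
  cfunK : {in cdom phi, cancel (cfun phi) (cinv phi)};
  cfun_continuous : {in cdom phi, continuous (cfun phi)};
  cinv_continuous : {in cfun phi @` cdom phi, continuous (cinv phi)} }.

(* The atlas is indexed by the points of the manifold, which loses no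
   generality: one chart around each point already determines the smooth
   structure. *)
HB.mixin Record Topological_isManifold (R : realType) (n : nat) M
    of Topological M := {
  chart_at : M -> chart R n M;
  chart_atP : forall x, is_chart (chart_at x);
  mem_chart_at : forall x, cdom (chart_at x) x;
  chart_compatible : forall x y,
    smooth_on (cfun (chart_at x) @` (cdom (chart_at x) `&` cdom (chart_at y)))
              (cfun (chart_at y) \o cinv (chart_at x));
  manifold_hausdorff : hausdorff_space M;
  manifold_second_countable : @second_countable M }.

#[short(type="manifoldType")]
HB.structure Definition Manifold (R : realType) (n : nat) :=
  { M of Topological_isManifold R n M & Topological M }.

(* [f] is smooth when it is so in the charts; the domains of its coordinate
   expressions are open because [f] is continuous. *)
Definition smooth_map (R : realType) (m n : nat) (M : manifoldType R m)
    (N : manifoldType R n) (f : M -> N) : Prop :=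
  continuous f /\
  forall (x : M) (y : N),
    smooth_on (cfun (chart_at x) @`
                 (cdom (chart_at x) `&` f @^-1` cdom (chart_at y)))
              (cfun (chart_at y) \o f \o cinv (chart_at x)).

HB.mixin Record Manifold_isLieGroup (R : realType) (n : nat) G
    of Manifold R n G & Group G := {
  lie_mulg_continuous : continuous (fun gh : G * G => (gh.1 * gh.2)%g);
  lie_mulg_smooth : forall x y z : G,
    smooth_on
      [set uv : 'rV[R]_n * 'rV[R]_n |
        [/\ (cfun (chart_at x) @` cdom (chart_at x)) uv.1,
            (cfun (chart_at y) @` cdom (chart_at y)) uv.2 &
            cdom (chart_at z)
              (cinv (chart_at x) uv.1 * cinv (chart_at y) uv.2)%g]]
      (fun uv => cfun (chart_at z)
              (cinv (chart_at x) uv.1 * cinv (chart_at y) uv.2)%g);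
  lie_invg_smooth : smooth_map (fun g : G => (g^-1)%g) }.

#[short(type="lieGroupType")]
HB.structure Definition LieGroup (R : realType) (n : nat) :=
  { G of Manifold_isLieGroup R n G & Manifold R n G & Group G }.

(* The tangent space of [G] at the identity, written in the coordinates of the
   chart [chart_at 1]; it carries the bracket [ad] below. *)
Notation tangent1 R n := 'rV[R]_n (only parsing).

(* The differential at the identity of a map [f : G -> G] fixing it. *)
Definition dif1 (R : realType) (n : nat) (G : lieGroupType R n) (f : G -> G)
    (X : tangent1 R n) : tangent1 R n :=
  'D_X (cfun (chart_at 1%g) \o f \o cinv (chart_at (1%g : G)))
       (cfun (chart_at (1%g : G)) 1%g).

Definition Ad (R : realType) (n : nat) (G : lieGroupType R n) (g : G) :
    tangent1 R n -> tangent1 R n :=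
  dif1 (fun h : G => (g * h * g^-1)%g).

(* [ad G X Y] is the Lie bracket [X, Y]: the differential of [g |-> Ad g Y] at
   the identity in the direction [X]. *)
Definition ad (R : realType) (n : nat) (G : lieGroupType R n)
    (X Y : tangent1 R n) : tangent1 R n :=
  'D_X (fun u => Ad (cinv (chart_at (1%g : G)) u) Y)
       (cfun (chart_at (1%g : G)) 1%g).

Definition one_param (R : realType) (n : nat) (G : lieGroupType R n)
    (X : tangent1 R n) (gam : R -> G) : Prop :=
  [/\ continuous gam,
      forall s t, gam (s + t) = (gam s * gam t)%g &
      is_derive (0 : R) (1 : R) (cfun (chart_at (1%g : G)) \o gam) X].

Definition lexp (R : realType) (n : nat) (G : lieGroupType R n)
    (X : tangent1 R n) : G :=
  xget 1%g [set gam 1 | gam in one_param X].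

Definition lie_ideal (R : realType) (n : nat) (G : lieGroupType R n)
    (J : {vspace tangent1 R n}) : Prop :=
  forall X Y : tangent1 R n, Y \in J -> ad G X Y \in J.

Definition derived_alg (R : realType) (n : nat) (G : lieGroupType R n)
    (U : {vspace tangent1 R n}) : {vspace tangent1 R n} :=
  <<[seq ad G X Y | X <- vbasis U, Y <- vbasis U]>>%VS.

Definition lie_solvable (R : realType) (n : nat) (G : lieGroupType R n)
    (U : {vspace tangent1 R n}) : Prop :=
  exists k, iter k (derived_alg G) U = 0%VS.

Definition semisimple (R : realType) (n : nat) (G : lieGroupType R n) : Prop :=
  forall J : {vspace tangent1 R n},
    lie_ideal G J -> lie_solvable G J -> J = 0%VS.

Definition lie_center (R : realType) (n : nat) (G : lieGroupType R n) : set G :=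
  [set z | forall g : G, (z * g = g * z)%g].
Arguments lie_center {R n} G.

Definition is_subgroup (R : realType) (n : nat) (G : lieGroupType R n)
    (H : set G) : Prop :=
  [/\ H 1%g, forall x y, H x -> H y -> H (x * y)%g &
      forall x, H x -> H (x^-1)%g].

Definition lie_involution (R : realType) (n : nat) (G : lieGroupType R n)
    (sigma : G -> G) : Prop :=
  [/\ smooth_map sigma, {morph sigma : x y / (x * y)%g} & involutive sigma].

Definition fixed_set (T : Type) (f : T -> T) : set T := [set x | f x = x].

Definition Bform (R : realType) (n : nat) (G : lieGroupType R n)
    (theta : G -> G) (X Y : tangent1 R n) : R :=
  - \tr (lin1_mx (ad G X \o ad G (dif1 theta Y))).

Definition cartan_involution (R : realType) (n : nat) (G : lieGroupType R n)
    (theta : G -> G) : Prop :=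
  lie_involution theta /\
  forall X : tangent1 R n, X != 0 -> 0 < Bform theta X X.

Definition C1_curve (R : realType) (n : nat) (G : lieGroupType R n)
    (gam : R -> G) : Prop :=
  continuous gam /\
  forall x : G, Ck (V := R^o) 1 (gam @^-1` cdom (chart_at x))
                   (cfun (chart_at x) \o gam).

(* [gam] restricted to [0, 1]; being C^1 on a closed subinterval means extending
   to a C^1 curve on the line. *)
Definition piecewise_C1 (R : realType) (n : nat) (G : lieGroupType R n)
    (gam : R -> G) : Prop :=
  exists (N : nat) (t : nat -> R),
    [/\ t 0%N = 0, t N = 1 &
        forall i, (i < N)%N -> t i < t i.+1 /\
          exists2 del : R -> G, C1_curve del &
            {in `[t i, t i.+1], gam =1 del}].

(* The velocity of [gam] at time [t], translated on the right from [gam t] to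
   the identity. *)
Definition right_velocity (R : realType) (n : nat) (G : lieGroupType R n)
    (gam : R -> G) (t : R) : tangent1 R n :=
  derive1 (fun s => cfun (chart_at (1%g : G)) (gam s * (gam t)^-1)%g) t.

Definition curve_length (R : realType) (n : nat) (G : lieGroupType R n)
    (theta : G -> G) (gam : R -> G) : \bar R :=
  (\int[lebesgue_measure]_(t in `[0%R, 1%R])
    (Num.sqrt (Bform theta (right_velocity gam t)
                           (right_velocity gam t)))%:E)%E.

Definition rdist (R : realType) (n : nat) (G : lieGroupType R n)
    (theta : G -> G) (g h : G) : \bar R :=
  ereal_inf [set curve_length theta gam | gam in
    [set gam : R -> G | [/\ piecewise_C1 gam, gam 0 = g & gam 1 = h]]].

Definition near1 (R : realType) (n : nat) (G : lieGroupType R n)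
    (theta : G -> G) (S : set G) (eps : R) : set G :=
  [set s | S s /\ (rdist theta s 1%g < eps%:E)%E].

Definition setmulg (G : groupType) (S T : set G) : set G :=
  [set (s * t)%g | s in S & t in T].

Notation linform R fa := ('Hom(subvs_of fa, R^o)).

Definition abelian_in_pq (R : realType) (n : nat) (G : lieGroupType R n)
    (sigma theta : G -> G) (fb : {vspace tangent1 R n}) : Prop :=
  (forall X : tangent1 R n, X \in fb ->
    dif1 theta X = - X /\ dif1 sigma X = - X) /\
  (forall X Y : tangent1 R n, X \in fb -> Y \in fb -> ad G X Y = 0).

Definition maximal_abelian_in_pq (R : realType) (n : nat)
    (G : lieGroupType R n) (sigma theta : G -> G)
    (fa : {vspace tangent1 R n}) : Prop :=
  abelian_in_pq sigma theta fa /\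
  forall fb : {vspace tangent1 R n},
    abelian_in_pq sigma theta fb -> (fa <= fb)%VS -> fb = fa.

Definition root_space (R : realType) (n : nat) (G : lieGroupType R n)
    (fa : {vspace tangent1 R n}) (beta : linform R fa) : set (tangent1 R n) :=
  [set Y | forall X : subvs_of fa, ad G (vsval X) Y = (beta X : R) *: Y].

Definition roots_of (R : realType) (n : nat) (G : lieGroupType R n)
    (fa : {vspace tangent1 R n}) : set (linform R fa) :=
  [set beta | beta != 0 /\
    exists2 Y : tangent1 R n, Y != 0 & root_space G beta Y].

(* The choice of a Weyl chamber is that of its set of positive roots: the roots
   that are positive at some regular element [X0]. *)
Definition positive_roots (R : realType) (n : nat) (G : lieGroupType R n)
    (fa : {vspace tangent1 R n}) (P : set (linform R fa)) : Prop :=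
  exists X0 : subvs_of fa,
    (forall beta, roots_of G beta -> (beta X0 : R) != 0) /\
    P = [set beta | roots_of G beta /\ 0 < (beta X0 : R)].

Definition simple_roots (R : realType) (n : nat) (fa : {vspace tangent1 R n})
    (P : set (linform R fa)) : set (linform R fa) :=
  [set alpha | P alpha /\
    ~ exists beta gamma, [/\ P beta, P gamma & alpha = beta + gamma]].

Definition expA (R : realType) (n : nat) (G : lieGroupType R n)
    (fa : {vspace tangent1 R n}) : set G :=
  [set lexp G (vsval X) | X in [set: subvs_of fa]].

(* On [expA fa], the inverse of the (injective) exponential map of [fa]. *)
Definition logA (R : realType) (n : nat) (G : lieGroupType R n)
    (fa : {vspace tangent1 R n}) (a : G) : subvs_of fa :=
  xget 0 [set X : subvs_of fa | lexp G (vsval X) = a].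

Definition chamber (R : realType) (n : nat) (G : lieGroupType R n)
    (fa : {vspace tangent1 R n}) (P : set (linform R fa)) : set G :=
  [set a | expA fa a /\ forall beta, P beta -> 0 <= (beta (logA fa a) : R)].

Definition chamber_part (R : realType) (n : nat) (G : lieGroupType R n)
    (fa : {vspace tangent1 R n}) (P I : set (linform R fa)) (c : R) : set G :=
  [set a | [/\ chamber P a,
    forall beta, (simple_roots P `\` I) beta -> c <= (beta (logA fa a) : R) &
    forall beta, I beta -> (beta (logA fa a) : R) < c]].

Definition sub_torus (R : realType) (n : nat) (G : lieGroupType R n)
    (fa : {vspace tangent1 R n}) (I : set (linform R fa)) : set G :=
  [set lexp G (vsval X) | X in
    [set X : subvs_of fa | forall alpha, I alpha -> (alpha X : R) = 0]].

Definition centralizer (G : groupType) (S : set G) : set G :=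
  [set g | forall s, S s -> (g * s = s * g)%g].

(* Main.v *)
Require Import Defs.
From HB Require Import structures.
From mathcomp Require Import all_boot all_order all_algebra.
From mathcomp Require Import all_classical all_reals all_analysis.
From mathcomp Require Import measurable_realfun.
From mathcomp Require Import ring lra.
From mathcomp.real_closed Require Import complex.

Set Implicit Arguments.
Unset Strict Implicit.
Unset Printing Implicit Defensive.

Import Order.TTheory GRing.Theory Num.Theory.
Import numFieldNormedType.Exports.

Local Open Scope classical_set_scope.
Local Open Scope ring_scope.

(* The metric is only used through a two-sided comparison with coordinates near
   the identity: [rdist theta (gexp X) 1 <= K |X|], and conversely [g] has
   coordinates of size [O(eps)] as soon as [rdist theta g 1 < eps]. It is then
   enough to factor such a [g] as [exp u * exp w * (a * exp v * a^-1)] with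
   [u] fixed by [theta], [v] fixed by [sigma], [w] centralizing [a_I], and all
   of [u], [w], [v], [Ad a v] of norm [O(eps)] uniformly in [a]: then
   [g * a = exp u * exp w * a * exp v].

   The infinitesimal version [Y = u + w + Ad a v] is solved on a basis of weight
   vectors of [fa]. A weight vanishing on [a_I] goes into [w]. Any other nonzero
   weight is, up to sign, a positive root [beta] in which some simple root
   outside [I] occurs, so that [beta (log a) >= c] on the chamber part; as
   [theta] and [sigma] exchange the root spaces of [beta] and [- beta], one can
   take [w = 0] and solve for [u] and [v], at the price of a factor
   [1 / (1 - exp (- 4 beta (log a)))] which [c > 0] keeps bounded. The exponential
   and the multiplication being strictly differentiable at the identity, a
   contraction argument uniform in [a] passes from this linear decomposition to
   the group.

   The exponential is built without differential equations: in coordinates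
   squaring is [x |-> 2 x + O(|x|^2)], and its [k]-th iterate at [X / 2^k]
   converges as [k] grows. *)

(** * Strict differentiability *)

(** The obstacle is that [a] ranges over a set that may be unbounded and on which [Ad a] has no
    uniform bound: an inverse function theorem with [a] as parameter could give a neighbourhood that
    shrinks with [a]. But [a * exp v * a^-1 = exp (Ad a v)], so the product map involves [a] only
    through the three linear maps [u], [w] and [Ad a \o v] of the unknown, all bounded by one
    constant; the nonlinear ingredients do not see [a]. The contraction needs strict
    differentiability: on the ball of radius [s] the error is Lipschitz with constant [O(s)]. Weight
    vectors exist because, for [X] in [fa], the operator [ad X] is self-adjoint for the positive
    form [Bform theta]. In the metric comparison there is a circularity: the speed of a curve can be
    compared with its coordinates only while the curve stays near the identity, which is what has to
    be shown. It is resolved by following the curve backwards from its endpoint [1]. *)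

Lemma subrACA (V : zmodType) (x y z t : V) : x - y - (z - t) = x - z - (y - t).
Proof. by rewrite !opprB addrACA [RHS]addrACA [- y - z]addrC. Qed.

Lemma cvg_near_ext T (S : topologicalType) (F : set_system T) {FF : Filter F} (f g : T -> S) (l : S) :
  (\forall t \near F, f t = g t) -> f @ F --> l -> g @ F --> l.
Proof.
move=> fg fl; apply: cvg_trans fl; apply: near_eq_cvg.
by apply: filterS fg => t ->.
Qed.

Lemma near_norm_lt_bound (R : realType) (V : normedModType R) (X : V) (s : R) :
  `|X| < s -> \forall Y \near X, `|Y| < s.
Proof.
move=> Xs; have idX : id x @[x --> X] --> X by exact: cvg_id.
exact: (cvgr_norm_lt _ idX).
Qed.

Lemma near_lipschitz_continuous (R : realType) (V W : normedModType R) (f : V -> W) (x : V) (K : R) :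
  (\forall y \near x, `|f x - f y| <= K * `|x - y|) -> {for x, continuous f}.
Proof.
move=> fK; have idx : id y @[y --> x] --> x by exact: cvg_id.
apply/cvgrPdist_le => e e0; pose L := Num.max K 0 + 1.
have L0 : 0 < L by rewrite ltr_wpDl// le_max lexx orbT.
have d : \forall y \near x, `|x - y| <= e / L.
  by move/cvgrPdist_le : idx; apply; rewrite divr_gt0.
near=> y; have fy : `|f x - f y| <= K * `|x - y| by near: y.
rewrite (le_trans fy)// (@le_trans _ _ (L * `|x - y|))//.
  by rewrite ler_wpM2r// ler_wpDr// le_max lexx.
by rewrite mulrC -ler_pdivlMr//; near: y.
Unshelve. all: by end_near. Qed.

Lemma lipschitz_continuous_at (R : realType) (V W : normedModType R) (f : V -> W) (x : V) (K : R) :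
  (forall y, `|f x - f y| <= K * `|x - y|) -> {for x, continuous f}.
Proof. by move=> fK; apply: (near_lipschitz_continuous (K := K)); exact: nearW. Qed.

Section Calculus.
Context {R : realType}.

Lemma mx_coord_le n (x : 'rV[R]_n) i : `|x 0 i| <= `|x|.
Proof. by rewrite [leRHS]mx_normrE; exact: (le_bigmax _ _ (0, i)). Qed.

Lemma rV_norm_le n (x : 'rV[R]_n) (c : R) : 0 <= c ->
  (forall i, `|x 0 i| <= c) -> `|x| <= c.
Proof.
by move=> c0 xc; rewrite [leLHS]mx_normrE bigmax_le// => -[i j] _; rewrite ord1.
Qed.

(** The scalar mean value theorem is applied to each coordinate along the segment from [y] to [x];
    the norm on row vectors is the maximum norm, so no constant is lost. *)
Lemma mean_value_le (V : normedModType R) m (f : V -> 'rV[R]_m) (z : V) (r L : R) :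
  0 <= L ->
  (forall x, `|x - z| < r -> differentiable f x) ->
  (forall x v, `|x - z| < r -> `|'D_v f x| <= L * `|v|) ->
  forall x y, `|x - z| < r -> `|y - z| < r -> `|f x - f y| <= L * `|x - y|.
Proof.
move=> L0 fd fL x y xr yr; apply: rV_norm_le => [|i].
  by rewrite mulr_ge0.
pose p (t : R) := y + t *: (x - y).
have pr (t : R) : 0 <= t <= 1 -> `|p t - z| < r.
  move=> /andP[t0 t1]; rewrite /p.
  have -> : y + t *: (x - y) - z = t *: (x - z) + (1 - t) *: (y - z).
    rewrite scalerBl scale1r addrCA -scalerBr.
    have -> : x - z - (y - z) = x - y by rewrite opprB addrA subrK.
    by rewrite addrAC.
  apply: (le_lt_trans (ler_normD _ _)); rewrite !normrZ ger0_norm// ger0_norm ?subr_ge0//.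
  have [->|tn0] := eqVneq t 0; first by rewrite mul0r add0r subr0 mul1r.
  rewrite (@lt_le_trans _ _ (t * r + (1 - t) * r))//; last first.
    by rewrite -mulrDl addrC subrK mul1r.
  rewrite ltr_leD//; first by rewrite ltr_pM2l// lt_neqAle eq_sym tn0.
  by rewrite ler_wpM2l ?subr_ge0// ltW.
have pd t : is_diff t p (fun h => h *: (x - y)).
  have := is_diffD (is_diff_cst y t) (is_diff_scalel t (x - y)).
  by rewrite add0r.
have gd (t : R) : 0 <= t <= 1 -> is_derive t 1 (fun s => f (p s) 0 i) ('D_(x - y) f (p t) 0 i).
  move=> /pr/fd fdt.
  have fpd : differentiable (f \o p) t by exact: differentiable_comp.
  have fpd1 : derivable (f \o p) t 1 by exact: diff_derivable.
  split; first by move/derivable_mxP : fpd1 => /(_ 0 i).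
  transitivity ('D_1 (f \o p) t 0 i); first by rewrite derive_mx// mxE.
  by rewrite deriveE// diff_comp//= diff_val scale1r -deriveE.
have /= [||c cin] := @MVT_segment R (fun s => f (p s) 0 i) (fun t => 'D_(x - y) f (p t) 0 i) 0 1 ler01.
- by move=> t; rewrite in_itv/= => /andP[t0 t1]; apply: gd; rewrite !ltW.
- apply: derivable_within_continuous => t; rewrite in_itv/= => t01.
  by have [] := gd _ t01.
rewrite /p scale1r scale0r addr0 (addrC y) subrK subr0 mulr1 => E.
move: cin; rewrite in_itv/= => cin.
rewrite !mxE E (le_trans (mx_coord_le _ _))// fL//.
exact: pr.
Qed.

(** A frame bounds a differential by finitely many directional derivatives. The notion covers row
    vectors and pairs of them alike, pairs being the source of the group multiplication. *)
Definition frame (V : normedModType R) m (b : 'I_m -> V) :=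
  exists c : V -> 'I_m -> R,
    forall v, v = \sum_i c v i *: b i /\ forall i, `|c v i| <= `|v|.

Lemma frame_rV n : frame (fun i : 'I_n => 'e_i : 'rV[R]_n).
Proof.
exists (fun (v : 'rV[R]_n) i => v 0 i) => v; split; first exact: row_sum_delta.
exact: mx_coord_le.
Qed.

Lemma frame_prod (V W : normedModType R) m p (b : 'I_m -> V) (b' : 'I_p -> W) :
  frame b -> frame b' ->
  frame (fun i : 'I_(m + p) => match fintype.split i with
          inl j => (b j, 0) | inr j => (0, b' j) end : V * W).
Proof.
move=> [c cP] [c' c'P].
exists (fun v i => match fintype.split i with inl j => c v.1 j | inr j => c' v.2 j end).
move=> [v w]; split.
  rewrite big_split_ord/=.
  under eq_bigr do rewrite (unsplitK (inl _)).
  under [X in _ + X]eq_bigr do rewrite (unsplitK (inr _)).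
  have [vE _] := cP v; have [wE _] := c'P w.
  rewrite (_ : \sum_i _ = (v, 0)); last first.
    rewrite [in RHS]vE; elim/big_rec2 : _ => // i y [] _ _ _ ->.
    by congr (_, _); rewrite /= scaler0 addr0.
  rewrite (_ : \sum_i _ = (0, w)); last first.
    rewrite [in RHS]wE; elim/big_rec2 : _ => // i y [] _ _ _ ->.
    by congr (_, _); rewrite /= scaler0 addr0.
  by congr pair; rewrite /= ?addr0 ?add0r.
move=> i; rewrite prod_normE/= le_max; case: fintype.split => j.
  by rewrite (cP v).2.
by rewrite (c'P w).2 orbT.
Qed.

Lemma deriv_frame (V W : normedModType R) m (b : 'I_m -> V) (c : V -> 'I_m -> R)
    (f : V -> W) x v :
  v = \sum_i c v i *: b i -> differentiable f x ->
  'D_v f x = \sum_i c v i *: 'D_(b i) f x.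
Proof.
move=> vE fx; rewrite deriveE// {1}vE linear_sum; apply: eq_bigr => i _.
by rewrite linearZ/= deriveE.
Qed.

Lemma frame_derive_le (V W : normedModType R) m (b : 'I_m -> V) (f : V -> W) x M :
  frame b -> differentiable f x -> (forall i, `|'D_(b i) f x| <= M) ->
  forall v, `|'D_v f x| <= m%:R * M * `|v|.
Proof.
move=> [c cP] fx fM v; have [vE cv] := cP v.
rewrite (deriv_frame vE fx) (le_trans (ler_norm_sum _ _ _))//.
rewrite (@le_trans _ _ (\sum_(i < m) M * `|v|))//; last first.
  by rewrite sumr_const card_ord -mulrA mulr_natl.
by apply: ler_sum => i _; rewrite normrZ mulrC ler_pM.
Qed.

Lemma continuous_norm_bounded (V W : normedModType R) (f : V -> W) x :
  {for x, continuous f} -> \forall y \near x, `|f y| <= `|f x| + 1.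
Proof.
move=> /cvgrPdist_le/(_ 1 ltr01); apply: filterS => y fy.
rewrite -lerBlDl (le_trans _ fy)// distrC.
by rewrite (le_trans _ (ler_dist_dist _ _))// ler_norm.
Qed.

Lemma near_norm_lt (V : normedModType R) (z : V) (Q : set V) :
  (\forall x \near z, Q x) -> exists2 r : R, 0 < r & forall x, `|x - z| < r -> Q x.
Proof.
move=> /nbhs_normP[r r0 rQ]; exists r => // x xr; apply: rQ.
by rewrite /= distrC.
Qed.

(** The derivative of [f] minus its differential at [z] vanishes at [z] and is Lipschitz, the second
    derivatives being bounded near [z]. It is thus [O(s)] on the ball of radius [s], and a second
    use of the mean value bound concludes. *)
Lemma C2_strict_differentiable (V : normedModType R) k m (b : 'I_m -> V)
    (f : V -> 'rV[R]_k) (z : V) : frame b ->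
  (\forall x \near z, differentiable f x) ->
  (forall i, \forall x \near z, differentiable ('D_(b i) f) x) ->
  (forall i j, {for z, continuous ('D_(b j) ('D_(b i) f))}) ->
  exists r C : R, [/\ 0 < r, 0 < C &
    forall s x y, s <= r -> `|x - z| < s -> `|y - z| < s ->
      `|f x - f y - 'd f z (x - y)| <= C * s * `|x - y|].
Proof.
move=> fr fd Dfd DDf.
have [K0 K0P] : exists K0 : R, forall i j, `|'D_(b j) ('D_(b i) f) z| + 1 <= K0.
  exists (\sum_(ij : 'I_m * 'I_m) (`|'D_(b ij.2) ('D_(b ij.1) f) z| + 1)) => i j.
  rewrite (bigD1 (i, j))//= lerDl sumr_ge0// => ij _.
pose K := Num.max 0 K0.
have nr : \forall x \near z, [/\ differentiable f x,
    forall i, differentiable ('D_(b i) f) x &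
    forall i j, `|'D_(b j) ('D_(b i) f) x| <= K].
  have H1 : \forall x \near z, forall i, differentiable ('D_(b i) f) x.
    exact: filter_forall.
  have H2 : \forall x \near z, forall i j, `|'D_(b j) ('D_(b i) f) x| <= K.
    apply: filter_forall => i; apply: filter_forall => j.
    apply: filterS (continuous_norm_bounded (DDf i j)) => x /le_trans; apply.
    by rewrite /K le_max K0P orbT.
  by near=> x; split; near: x.
have [r r0 rP] := near_norm_lt nr.
pose C := (m%:R * (m%:R * K)).
have C0 : 0 <= C by rewrite !mulr_ge0// /K le_max lexx.
exists r, (C + 1); split => //; first by rewrite ltr_wpDl.
move=> s x y sr xs ys.
have s0 : 0 < s by rewrite (le_lt_trans _ xs).
have zs : `|z - z| < s by rewrite subrr normr0.
have r_of u : `|u - z| < s -> `|u - z| < r by move=> /lt_le_trans; apply.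
have zd : differentiable f z by have [] := rP z (r_of _ zs).
have DL i u : `|u - z| < s -> `|'D_(b i) f u - 'D_(b i) f z| <= m%:R * K * s.
  move=> us; rewrite (@le_trans _ _ (m%:R * K * `|u - z|))//; last first.
    by rewrite ler_wpM2l ?mulr_ge0// ?/K ?le_max ?lexx// ltW.
  apply: (@mean_value_le V k ('D_(b i) f) z s (m%:R * K)) => //.
  - by rewrite mulr_ge0// /K le_max lexx.
  - by move=> w /r_of/rP[_ + _]; apply.
  - move=> w v /r_of/rP[_ wd wK]; exact: (frame_derive_le fr).
pose g u := f u - 'd f z u.
pose D : V -> 'rV[R]_k := 'd f z.
have Dd u : is_diff u D D.
  by split; [exact/linear_differentiable/diff_continuous|exact/diff_lin/diff_continuous].
have gd u : `|u - z| < s -> is_diff u g (fun v => 'd f u v - D v).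
  by move=> /r_of/rP[/differentiableP ud _ _]; exact: (is_diffB ud (Dd u)).
have Dg u v : `|u - z| < s -> 'D_v g u = 'D_v f u - 'D_v f z.
  move=> us; have [ud _ _] := rP u (r_of _ us).
  by rewrite (deriveE _ (@ex_diff _ _ _ _ _ _ _ (gd _ us))) (@diff_val _ _ _ _ _ _ _ (gd _ us)) !deriveE.
have -> : f x - f y - 'd f z (x - y) = g x - g y.
  by rewrite /g linearB; exact: subrACA.
rewrite (@le_trans _ _ (C * s * `|x - y|))//; last first.
  by rewrite ler_wpM2r// ler_wpM2r ?lerDl// ltW.
apply: (@mean_value_le V k g z s (C * s) _ _ _ x y xs ys).
- by rewrite mulr_ge0// ltW.
- by move=> u us; have [] := gd _ us.
move=> u v us; rewrite /C -[m%:R * _ * s]mulrA.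
apply: (frame_derive_le fr); first by have [] := gd _ us.
by move=> i; rewrite Dg//; exact: DL.
Unshelve. all: by end_near. Qed.

End Calculus.

(** * The exponential map *)

Section Koenigs.
Context {R : realType} {n : nat}.
Local Notation V := 'rV[R]_n.

Lemma cvg_of_geometric_step (u : nat -> V) (M : R) :
  (forall k, `|u k.+1 - u k| <= M / 2 ^+ k) -> cvgn u.
Proof.
move=> uM.
have M0 : 0 <= M by have /(le_trans (normr_ge0 _)) := uM 0%N; rewrite expr0 divr1.
(* Keeping the subtracted remainder makes the bound exact for a geometric sum, so that the induction
   closes. *)
have H k m : `|u (k + m)%N - u k| <= 2 * M / 2 ^+ k - 2 * M / 2 ^+ (k + m).
  elim: m => [|m ih]; first by rewrite addn0 !subrr normr0.
  rewrite addnS -(subrKA (u (k + m)%N)) (le_trans (ler_normD _ _))//.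
  rewrite (le_trans (lerD (uM _) ih))// le_eqVlt; apply/orP; left; apply/eqP.
  by rewrite exprS invfM; set w := (2 ^+ (k + m))^-1; field.
have ge0 k : 0 <= 2 * M / 2 ^+ k :> R by rewrite divr_ge0 ?mulr_ge0 ?exprn_ge0.
apply/cauchy_cvgP/cauchy_exP => e e0.
have [N _ NP] : \forall k \near \oo, 2 * M / 2 ^+ k < e.
  have : (fun k => geometric (2 * M) 2^-1 k) @ \oo --> (0 : R).
    by apply: cvg_geometric; rewrite ger0_norm ?invr_ge0// invf_lt1// ltr1n.
  move/cvgrPdist_lt/(_ e e0); apply: filterS => k.
  by rewrite sub0r normrN /geometric/= -exprVn ger0_norm// exprVn.
exists (u N); exists N => // k /= Nk; rewrite -ball_normE/= distrC -(subnKC Nk).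
rewrite (le_lt_trans (H _ _))//.
by rewrite (le_lt_trans _ (NP N _))//= lerBlDr lerDl.
Qed.

Variables (q : V -> V) (r C : R).
Hypotheses (C0 : 0 < C) (q0 : q 0 = 0).
Hypothesis qC : forall s x y, s <= r -> `|x| < s -> `|y| < s ->
  `|q x - q y - 2 *: (x - y)| <= C * s * `|x - y|.

(** The radius is halved at each step of the induction, so the relative errors [C * s], [C * s / 2],
    ... form a geometric series of sum [2 * C * s]. *)
Lemma koenigs_iter k s x y : s <= r -> C * s <= 1 ->
  `|x| < s / 2 ^+ k -> `|y| < s / 2 ^+ k ->
  `|iter k q x - iter k q y - 2 ^+ k *: (x - y)| <= 2 * C * s * 2 ^+ k * `|x - y|.
Proof.
elim: k s x y => [|k ih] s x y sr Cs1 xs ys.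
  have := le_lt_trans (normr_ge0 x) xs; rewrite expr0 divr1 => /ltW s0.
  by rewrite /= scale1r subrr normr0 !mulr_ge0// ltW.
have s0 : 0 < s.
  by rewrite -(pmulr_lgt0 _ (_ : 0 < (2 ^+ k.+1)^-1)) ?invr_gt0 ?exprn_gt0// (le_lt_trans _ xs).
have s2 : s / 2 <= s by rewrite ler_pdivrMr// ler_peMr// ?ler1n// ltW.
have sE : s / 2 ^+ k.+1 = s / 2 / 2 ^+ k by rewrite exprS invfM mulrA.
rewrite sE in xs ys.
have Cs2 : C * (s / 2) <= 1 by rewrite (le_trans _ Cs1)// ler_wpM2l// ltW.
have small z : `|z| < s / 2 / 2 ^+ k -> `|iter k q z| < s.
  move=> zs.
  have z0 : `|0 : V| < s / 2 / 2 ^+ k by rewrite normr0 !divr_gt0// exprn_gt0.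
  have it0 : iter k q 0 = 0 by elim: (k) => //= j ->.
  have := ih (s / 2) z 0 (le_trans s2 sr) Cs2 zs z0.
  rewrite it0 !subr0 => /(le_trans (lerB_dist _ _)); rewrite lerBlDr => /le_lt_trans; apply.
  rewrite normrZ ger0_norm ?exprn_ge0//.
  have zs' : `|z| * 2 ^+ k < s / 2 by rewrite -ltr_pdivlMr ?exprn_gt0.
  have : 0 <= `|z| * 2 ^+ k by rewrite mulr_ge0 ?exprn_ge0.
  rewrite (_ : 2 * C * _ * _ * _ + _ = C * s * (`|z| * 2 ^+ k) + `|z| * 2 ^+ k).
    by nra.
  by field.
set a := iter k q x; set b := iter k q y.
have ab : `|a - b - 2 ^+ k *: (x - y)| <= C * s * 2 ^+ k * `|x - y|.
  have := ih (s / 2) x y (le_trans s2 sr) Cs2 xs ys.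
  by rewrite (_ : 2 * C * (s / 2) = C * s)//; field.
have qab := qC sr (small _ xs) (small _ ys); rewrite -/a -/b in qab.
have nab : `|a - b| <= 2 * (2 ^+ k * `|x - y|).
  have := le_trans (lerB_dist _ _) ab; rewrite lerBlDr => /le_trans; apply.
  rewrite normrZ ger0_norm ?exprn_ge0//.
  have p0 : 0 <= 2 ^+ k * `|x - y| by rewrite mulr_ge0 ?exprn_ge0.
  by rewrite -mulrA; nra.
rewrite /= -/a -/b.
have -> : q a - q b - 2 ^+ k.+1 *: (x - y) =
    q a - q b - 2 *: (a - b) + 2 *: (a - b - 2 ^+ k *: (x - y)).
  by rewrite [2 *: (a - b - _)]scalerBr scalerA -exprS addrA subrK.
rewrite (le_trans (ler_normD _ _))// normrZ ger0_norm// exprS.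
have p0 : 0 <= 2 ^+ k * `|x - y| by rewrite mulr_ge0 ?exprn_ge0.
have Csn : 0 <= C * s by rewrite mulr_ge0// ltW.
rewrite (_ : 2 * C * s * (2 * 2 ^+ k) * `|x - y| =
   C * s * (2 * (2 ^+ k * `|x - y|)) + 2 * (C * s * 2 ^+ k * `|x - y|)); last by ring.
rewrite lerD ?ler_wpM2l//.
rewrite (le_trans qab)// ler_wpM2l//.
Qed.

Lemma koenigs_iter_le k s x y : s <= r -> C * s <= 1 ->
  `|x| < s / 2 ^+ k -> `|y| < s / 2 ^+ k ->
  `|iter k q x - iter k q y| <= 3 * (2 ^+ k * `|x - y|).
Proof.
move=> sr Cs xs ys; have := koenigs_iter sr Cs xs ys.
move=> /(le_trans (lerB_dist _ _)); rewrite lerBlDr => /le_trans; apply.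
rewrite normrZ ger0_norm ?exprn_ge0//.
have p0 : 0 <= 2 ^+ k * `|x - y| by rewrite mulr_ge0 ?exprn_ge0.
by rewrite -!mulrA mulrA; nra.
Qed.

Lemma iter_q0 k : iter k q 0 = 0.
Proof. by elim: k => //= k ->. Qed.

(** Comparing [y] with [0] in [qC] at a radius proportional to [|y|], namely [s = 2 * |y|], turns
    the Lipschitz error into a quadratic one. *)
Lemma koenigs_quadratic y : `|y| < r / 2 -> `|q y - 2 *: y| <= 2 * C * `|y| ^+ 2.
Proof.
move=> yr; have [->|y0] := eqVneq y 0.
  by rewrite q0 scaler0 subrr normr0 mulr_ge0// mulr_ge0// ltW.
have yp : 0 < `|y| by rewrite normr_gt0.
rewrite (_ : 2 * C * _ = C * (2 * `|y|) * `|y|); last by ring.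
have := @qC (2 * `|y|) y 0; rewrite q0 !subr0 normr0; apply.
- by rewrite mulrC -ler_pdivlMr// ltW.
- by rewrite ltr_pMl// ltr1n.
- by rewrite mulr_gt0.
Qed.

(* Koenigs' linearization of [q], which is conjugated to [x |-> 2 *: x]. *)
Definition koenigs x := lim ((fun k => iter k q ((2 ^+ k)^-1 *: x)) @ \oo).

Lemma scale_exp2 k (x : V) : `|(2 ^+ k)^-1 *: x| = `|x| / 2 ^+ k.
Proof. by rewrite normrZ ger0_norm ?invr_ge0 ?exprn_ge0// mulrC. Qed.

(** Consecutive terms are the [k]-th iterates at [q y] and at [2 *: y], where [y = x / 2^(k+1)].
    These points differ by [O(|x|^2 / 4^k)] and the iterate expands by at most [3 * 2^k], so the
    steps decay like [2^-k]. *)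
Lemma koenigs_cvg s x : s <= r -> C * s <= 1 -> `|x| < s / 2 ->
  (fun k => iter k q ((2 ^+ k)^-1 *: x)) @ \oo --> koenigs x.
Proof.
move=> sr Cs xs; apply: (@cvg_of_geometric_step _ (2 * C * `|x| ^+ 2)) => k.
have s0 : 0 < s by rewrite -(pmulr_lgt0 _ (_ : 0 < 2^-1))// (le_lt_trans _ xs).
have [y yD] : {y | y = (2 ^+ k.+1)^-1 *: x} by exists ((2 ^+ k.+1)^-1 *: x).
have p2 : 0 < (2 : R) ^+ k by rewrite exprn_gt0.
have ge1 : 1 <= (2 : R) ^+ k by rewrite exprn_ege1// ler1n.
have yE : `|y| = `|x| / 2 / 2 ^+ k by rewrite yD scale_exp2 exprS invfM mulrA.
have ys : `|y| <= s / 4.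
  rewrite yE ler_pdivrMr//; nra.
have qy : `|q y - 2 *: y| <= 2 * C * `|y| ^+ 2.
  apply: koenigs_quadratic; nra.
have y2 : 2 *: y = (2 ^+ k)^-1 *: x.
  by rewrite yD scalerA exprS invfM mulrA divff// mul1r.
rewrite iterSr -yD -y2.
have y2s : `|2 *: y| < s / 2 ^+ k by rewrite y2 scale_exp2 ltr_pM2r ?invr_gt0//; nra.
have qys : `|q y| < s / 2 ^+ k.
  have := le_trans (lerB_dist _ _) qy; rewrite lerBlDr => /le_lt_trans; apply.
  rewrite normrZ ger0_norm// ltr_pdivlMr// yE.
  have -> : (2 * C * (`|x| / 2 / 2 ^+ k) ^+ 2 + 2 * (`|x| / 2 / 2 ^+ k)) * 2 ^+ k =
     C * `|x| * `|x| / 2 * (2 ^+ k)^-1 + `|x|.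
    by field; rewrite gt_eqF.
  have : C * `|x| * `|x| / 2 * (2 ^+ k)^-1 <= C * `|x| * `|x| / 2.
    by rewrite ler_piMr// ?invf_le1// !mulr_ge0// ltW.
  have : C * `|x| <= 1 / 2 by have := ler_wpM2l (ltW C0) (ltW xs); lra.
  have := normr_ge0 x.
  nra.
rewrite (le_trans (koenigs_iter_le sr Cs qys y2s))//.
rewrite (@le_trans _ _ (3 * (2 ^+ k * (2 * C * `|y| ^+ 2))))//.
  by rewrite ler_wpM2l// ler_wpM2l// ltW.
rewrite yE; have -> : 3 * (2 ^+ k * (2 * C * (`|x| / 2 / 2 ^+ k) ^+ 2)) =
   3 / 2 * (C * `|x| ^+ 2 / 2 ^+ k) by field; rewrite gt_eqF.
have : 0 <= C * `|x| ^+ 2 / 2 ^+ k by rewrite divr_ge0// ?mulr_ge0 ?exprn_ge0// ltW.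
rewrite -[2 * C * _ / _]mulrA -[2 * C * _]mulrA mulrA; nra.
Qed.

(** Taken at [x / 2^k] and [y / 2^k], the bound on the iterates no longer depends on [k], hence
    passes to the limit. *)
Lemma koenigs_strict s x y : s <= r -> C * s <= 1 -> `|x| < s / 2 -> `|y| < s / 2 ->
  `|koenigs x - koenigs y - (x - y)| <= 2 * C * s * `|x - y|.
Proof.
move=> sr Cs xs ys.
have s0 : 0 < s by rewrite -(pmulr_lgt0 _ (_ : 0 < 2^-1))// (le_lt_trans _ xs).
have p2 k : 0 < (2 : R) ^+ k by rewrite exprn_gt0.
have cu : (fun k => `|iter k q ((2 ^+ k)^-1 *: x) - iter k q ((2 ^+ k)^-1 *: y) - (x - y)|) @ \oo
    --> `|koenigs x - koenigs y - (x - y)|.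
  apply: cvg_norm; apply: cvgB; last exact: cvg_cst.
  by apply: cvgB; exact: (koenigs_cvg sr Cs).
rewrite -(cvg_lim _ cu)//; apply: limr_le; first by apply/cvg_ex; eexists; exact: cu.
apply: nearW => k /=.
have lt2 (z : V) : `|z| < s / 2 -> `|(2 ^+ k)^-1 *: z| < s / 2 ^+ k.
  by rewrite scale_exp2 ltr_pM2r ?invr_gt0// => /lt_le_trans; apply; nra.
have := koenigs_iter sr Cs (lt2 _ xs) (lt2 _ ys).
rewrite -scalerBr scalerA divff ?gt_eqF// scale1r normrZ.
rewrite ger0_norm ?invr_ge0 ?(ltW (p2 _))// -mulrA (mulrA (2 ^+ k)) divff ?gt_eqF//.
by rewrite mul1r.
Qed.

(** The [k]-th iterate has Lipschitz constant [3 * 2^k], so replacing [x / 2^k] by [y k] costs at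
    most [3 * |x - 2^k y k|], which tends to [0]. *)
Lemma koenigs_tangent s (y : nat -> V) x : s <= r -> C * s <= 1 -> `|x| < s / 2 ->
  (fun k => 2 ^+ k *: y k) @ \oo --> x ->
  (fun k => iter k q (y k)) @ \oo --> koenigs x.
Proof.
move=> sr Cs xs yx.
have s0 : 0 < s by rewrite -(pmulr_lgt0 _ (_ : 0 < 2^-1))// (le_lt_trans _ xs).
have p2 k : 0 < (2 : R) ^+ k by rewrite exprn_gt0.
have kx := koenigs_cvg sr Cs xs.
apply: (cvg_sub0 _ kx); apply/cvgr0Pnorm_le => e e0.
have xss : `|x| < s by nra.
have ys : \forall k \near \oo, `|2 ^+ k *: y k| < s.
  exact: (cvgr_norm_lt _ yx).
have d : \forall k \near \oo, `|x - 2 ^+ k *: y k| <= e / 3.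
  by move/cvgrPdist_le : yx; apply; rewrite divr_gt0.
near=> k.
have yk : `|y k| < s / 2 ^+ k.
  rewrite ltr_pdivlMr// mulrC.
  by have : `|2 ^+ k *: y k| < s by [near: k]; rewrite normrZ ger0_norm// ltW.
have xk : `|(2 ^+ k)^-1 *: x| < s / 2 ^+ k.
  by rewrite scale_exp2 ltr_pM2r ?invr_gt0.
apply: (le_trans (koenigs_iter_le sr Cs yk xk)).
have dk : `|x - 2 ^+ k *: y k| <= e / 3 by near: k.
have -> : 2 ^+ k * `|y k - (2 ^+ k)^-1 *: x| = `|x - 2 ^+ k *: y k|.
  rewrite -[X in X * _](ger0_norm (ltW (p2 k))) -normrZ scalerBr scalerA.
  by rewrite divff ?gt_eqF// scale1r distrC.
by rewrite mulrC -ler_pdivlMr.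
Unshelve. all: by end_near. Qed.

End Koenigs.

(** * The group law in coordinates centred at the identity *)

Section LocalGroup.
Context {R : realType} {n : nat} {G : lieGroupType R n}.
Local Notation V := 'rV[R]_n.

(* The chart at the identity, centred so that [coor 1 = 0]. *)
Definition coor (g : G) : V :=
  cfun (chart_at (1%g : G)) g - cfun (chart_at (1%g : G)) 1%g.

Definition gpoint (x : V) : G :=
  cinv (chart_at (1%g : G)) (x + cfun (chart_at (1%g : G)) 1%g).

Definition lmul (x y : V) : V := coor (gpoint x * gpoint y)%g.

Local Notation U := (cdom (chart_at (1%g : G))).
Local Notation e0 := (cfun (chart_at (1%g : G)) 1%g).

Lemma dom1 : U 1%g. Proof. exact: mem_chart_at. Qed.

Lemma coor1 : coor 1%g = 0. Proof. exact: subrr. Qed.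

Lemma coorK g : U g -> gpoint (coor g) = g.
Proof.
by move=> Ug; rewrite /gpoint /coor subrK (cfunK (chart_atP _))// inE.
Qed.

Lemma point0 : gpoint 0 = 1%g.
Proof. by rewrite -coor1 coorK//; exact: dom1. Qed.

Lemma near_dom g : U g -> \forall h \near g, U h.
Proof. by move=> Ug; apply: open_nbhs_nbhs; split => //; exact: cdom_open (chart_atP _). Qed.

Lemma coor_continuous g : U g -> {for g, continuous coor}.
Proof.
move=> Ug; apply: continuousB; last exact: cvg_cst.
by apply: (cfun_continuous (chart_atP _)); rewrite inE.
Qed.

Lemma chart_radius : exists2 r : R, 0 < r & forall x, `|x| < r ->
  [/\ U (gpoint x), coor (gpoint x) = x & {for x, continuous gpoint}].
Proof.
have : nbhs e0 (cfun (chart_at (1%g : G)) @` U).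
  apply: open_nbhs_nbhs; split; first exact: cimg_open (chart_atP _).
  by exists 1%g => //; exact: dom1.
move=> /near_norm_lt[r r0 rP]; exists r => // x xr.
have [|g Ug gx] := rP (x + e0); first by rewrite addrK.
have cg : cinv (chart_at 1%g) (x + e0) = g.
  by rewrite -gx (cfunK (chart_atP _))// inE.
split.
- by rewrite /gpoint cg.
- by rewrite /gpoint cg /coor gx addrK.
- have cc : {for x + e0, continuous (cinv (chart_at (1%g : G)))}.
    by apply: (cinv_continuous (chart_atP _)); rewrite inE; exists g.
  have ct : (fun y : V => y + e0) @ x --> x + e0.
    exact: (cvgD cvg_id (cvg_cst _)).
  exact: (continuous_cvg _ cc ct).
Qed.

Lemma point_continuous0 : {for 0, continuous gpoint}.
Proof. by have [r r0 rP] := chart_radius; have [|_ _] := rP 0; rewrite ?normr0. Qed.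

Lemma cvg_mulg T (F : set_system T) {FF : Filter F} (f g : T -> G) a b :
  f @ F --> a -> g @ F --> b -> (fun t => f t * g t)%g @ F --> (a * b)%g.
Proof.
move=> fa gb.
exact: (@continuous2_cvg _ _ _ _ _ _ f g (fun x y : G => x * y)%g a b
  (@lie_mulg_continuous _ _ G (a, b)) fa gb).
Qed.

Lemma cvg_invg T (F : set_system T) {FF : Filter F} (f : T -> G) a :
  f @ F --> a -> (fun t => (f t)^-1)%g @ F --> (a^-1)%g.
Proof.
move=> fa; apply: continuous_cvg => //.
by have [+ _] := @lie_invg_smooth _ _ G; apply.
Qed.

Lemma cvg_expg T (F : set_system T) {FF : Filter F} (f : T -> G) a k :
  f @ F --> a -> (fun t => f t ^+ k)%g @ F --> (a ^+ k)%g.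
Proof.
move=> fa; elim: k => [|k ih].
  by under eq_fun do rewrite expg0; exact: cvg_cst.
by under eq_fun do rewrite expgS; rewrite expgS; exact: cvg_mulg.
Qed.

Lemma lmul_radius : exists2 r : R, 0 < r & forall x y, `|x| < r -> `|y| < r ->
  U (gpoint x * gpoint y)%g.
Proof.
have : \forall p \near ((0, 0) : V * V), U (gpoint p.1 * gpoint p.2)%g.
  have : (fun p : V * V => gpoint p.1 * gpoint p.2)%g @ ((0 : V), (0 : V)) --> (1 * 1 : G)%g.
    rewrite -[X in (_ * X)%g]point0 -[X in (X * _)%g]point0.
    apply: cvg_mulg; (apply: continuous_cvg; first exact: point_continuous0).
      exact: cvg_fst.
    exact: cvg_snd.
  rewrite mulg1; apply; exact: near_dom dom1.
move=> /near_norm_lt[r r0 rP]; exists r => // x y xr yr.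
by apply: (rP (x, y)); rewrite /= prod_normE/= !subr0 gt_max xr.
Qed.

Lemma cinv1 : cinv (chart_at (1%g : G)) e0 = 1%g.
Proof. by rewrite (cfunK (chart_atP _))// inE; exact: dom1. Qed.

(** Multiplication in the chart without recentring, the form in which the Lie group structure
    provides smoothness. *)
Definition cmul (p : V * V) : V :=
  cfun (chart_at (1%g : G)) (cinv (chart_at (1%g : G)) p.1 *
                             cinv (chart_at (1%g : G)) p.2)%g.

Lemma lmulE x y : lmul x y = cmul (x + e0, y + e0) - e0.
Proof. by []. Qed.

Lemma cmul_dom : \forall p \near ((e0, e0) : V * V),
  p \in [set uv : V * V |
    [/\ (cfun (chart_at (1%g : G)) @` U) uv.1,
        (cfun (chart_at (1%g : G)) @` U) uv.2 &
        U (cinv (chart_at (1%g : G)) uv.1 * cinv (chart_at (1%g : G)) uv.2)%g]].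
Proof.
have [r r0 rP] := chart_radius; have [s s0 sP] := lmul_radius.
apply/nbhs_normP; exists (Num.min r s); rewrite /= ?lt_min ?r0//.
move=> [u v] /=; rewrite prod_normE/= gt_max !lt_min distrC (distrC _ v).
move=> /andP[/andP[ur us] /andP[vr vs]]; rewrite inE/=.
have cE w : `|w - e0| < r -> (cfun (chart_at (1%g : G)) @` U) w.
  move=> /rP[Up cp _]; exists (gpoint (w - e0)) => //.
  by move: cp => /(congr1 (fun z => z + e0)); rewrite /coor !subrK.
by split; [exact: cE|exact: cE|have := sP _ _ us vs; rewrite /gpoint !subrK].
Qed.

Lemma cmul_differentiable : \forall p \near ((e0, e0) : V * V), differentiable cmul p.
Proof.
have [fd _] := @lie_mulg_smooth _ _ G 1%g 1%g 1%g 1%N.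
by apply: filterS cmul_dom => p /fd.
Qed.

Lemma cmul_derive_differentiable v :
  \forall p \near ((e0, e0) : V * V), differentiable ('D_v cmul) p.
Proof.
have [_ /(_ v)[fd _]] := @lie_mulg_smooth _ _ G 1%g 1%g 1%g 2%N.
by apply: filterS cmul_dom => p /fd.
Qed.

Lemma cmul_derive2_continuous v w : {for (e0, e0), continuous ('D_w ('D_v cmul))}.
Proof.
have [_ /(_ v)[_ /(_ w)fc]] := @lie_mulg_smooth _ _ G 1%g 1%g 1%g 2%N.
by apply: fc; exact: nbhs_singleton cmul_dom.
Qed.

Lemma cinv_near : \forall u \near e0, cfun (chart_at (1%g : G)) (cinv (chart_at (1%g : G)) u) = u.
Proof.
have [r r0 rP] := chart_radius; apply/nbhs_normP; exists r => // u /=.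
rewrite distrC => /rP[_ + _] => /(congr1 (fun z => z + e0)).
by rewrite /coor /gpoint !subrK.
Qed.

(** Restricted to either factor, the other one being the unit, [cmul] is the identity near the base
    point; both partial differentials are therefore the identity. *)
Lemma cmul_diff v w : 'd cmul ((e0, e0) : V * V) (v, w) = v + w.
Proof.
have cd : differentiable cmul ((e0, e0) : V * V) := nbhs_singleton cmul_differentiable.
have -> : (v, w) = ((v, 0) : V * V) + (0, w) by congr pair; rewrite ?addr0 ?add0r.
rewrite linearD; congr (_ + _).
  have pd : is_diff e0 (fun u : V => (u, e0)) (fun u : V => (u, 0 : V)).
    exact: is_diff_pair (is_diff_id e0) (is_diff_cst e0 e0).
  have := diff_comp (@ex_diff _ _ _ _ _ _ _ pd) cd.
  move=> /(congr1 (fun f : V -> V => f v)) /=; rewrite diff_val => <-.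
  rewrite -deriveE; last exact: differentiable_comp.
  rewrite (@near_eq_derive _ _ _ _ id) ?derive_id//.
  by near=> u; rewrite /= /cmul/= cinv1 mulg1; near: u; exact: cinv_near.
have pd : is_diff e0 (fun u : V => (e0, u)) (fun u : V => (0 : V, u)).
  exact: is_diff_pair (is_diff_cst e0 e0) (is_diff_id e0).
have := diff_comp (@ex_diff _ _ _ _ _ _ _ pd) cd.
move=> /(congr1 (fun f : V -> V => f w)) /=; rewrite diff_val => <-.
rewrite -deriveE; last exact: differentiable_comp.
rewrite (@near_eq_derive _ _ _ _ id) ?derive_id//.
by near=> u; rewrite /= /cmul/= cinv1 mul1g; near: u; exact: cinv_near.
Unshelve. all: by end_near. Qed.

Lemma lmul_strict : exists r C : R, [/\ 0 < r, 0 < C &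
  forall s x y x' y', s <= r -> `|x| < s -> `|y| < s -> `|x'| < s -> `|y'| < s ->
    `|lmul x y - lmul x' y' - (x - x') - (y - y')| <= C * s * (`|x - x'| + `|y - y'|)].
Proof.
have [r [C [r0 C0 rP]]] := C2_strict_differentiable
  (frame_prod (@frame_rV R n) (@frame_rV R n)) cmul_differentiable
  (fun i => cmul_derive_differentiable _) (fun i j => @cmul_derive2_continuous _ _).
exists r, C; split => // s x y x' y' sr xs ys xs' ys'.
have near z t : `|z| < s -> `|t| < s -> `|((z + e0, t + e0) : V * V) - (e0, e0)| < s.
  by move=> zs ts; rewrite prod_normE/= gt_max !addrK zs.
rewrite !lmulE (_ : cmul _ - _ - _ = cmul (x + e0, y + e0) - cmul (x' + e0, y' + e0)); last first.
  by rewrite subrACA subrr subr0.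
have := rP s (x + e0, y + e0) (x' + e0, y' + e0) sr (near _ _ xs ys) (near _ _ xs' ys').
rewrite (_ : (x + e0, y + e0) - (x' + e0, y' + e0) = (x - x', y - y')); last first.
  have E (a b : V) : a + e0 - (b + e0) = a - b by rewrite opprD addrACA subrr addr0.
  by congr pair; exact: E.
rewrite cmul_diff opprD addrA => /le_trans; apply.
rewrite ler_wpM2l//; first by rewrite mulr_ge0 ?(ltW C0)// ltW// (le_lt_trans _ xs).
by rewrite prod_normE/= ge_max lerDl lerDr !normr_ge0.
Qed.

End LocalGroup.

Lemma cvg_unshiftn (S : topologicalType) (f : nat -> S) m (l : S) :
  (fun k => f (k + m)%N) @ \oo --> l -> f @ \oo --> l.
Proof.
move=> fl A /fl[N _ NP]; exists (N + m)%N => // k /= Nk.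
have mk : (m <= k)%N by rewrite (leq_trans _ Nk)// leq_addl.
by have := NP (k - m)%N; rewrite /= subnK//; apply; rewrite leq_subRL// addnC.
Qed.

(** * The exponential as a limit of powers *)

Section Exponential.
Context {R : realType} {n : nat} {G : lieGroupType R n}.
Local Notation V := 'rV[R]_n.
Local Notation U := (cdom (chart_at (1%g : G))).
Local Notation coor := (@coor R n G).
Local Notation gpoint := (@gpoint R n G).
Local Notation lmul := (@lmul R n G).

(** One radius serves all local facts. They are required up to [2 * r] because the iterated squares
    met below are only bounded by [3 / 2 * r]. The condition [2 * C * r <= 1] is the smallness
    needed to linearize [sqr], whose error constant is [2 * C]. *)
Definition lie_radius (r C : R) := [/\ 0 < r, 0 < C, 2 * C * r <= 1,
  forall x, `|x| < 2 * r -> [/\ U (gpoint x), coor (gpoint x) = x & {for x, continuous gpoint}] &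
  (forall x y, `|x| < 2 * r -> `|y| < 2 * r -> U (gpoint x * gpoint y)%g) /\
  (forall s x y x' y', s <= 2 * r -> `|x| < s -> `|y| < s -> `|x'| < s -> `|y'| < s ->
    `|lmul x y - lmul x' y' - (x - x') - (y - y')| <= C * s * (`|x - x'| + `|y - y'|))].

Lemma ex_lie_radius : exists r C, lie_radius r C.
Proof.
have [r1 r10 r1P] := @chart_radius R n G.
have [r2 r20 r2P] := @lmul_radius R n G.
have [r3 [C [r30 C0 r3P]]] := @lmul_strict R n G.
pose r := Num.min (Num.min r1 r2) (Num.min r3 C^-1) / 2.
have [r_1 r_2 r_3 rC] : [/\ 2 * r <= r1, 2 * r <= r2, 2 * r <= r3 & 2 * r <= C^-1].
  by rewrite /r mulrC divfK//; split; rewrite !ge_min ?lexx ?orbT.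
exists r, C; split => //.
- by rewrite /r divr_gt0// !lt_min r10 r20 r30 invr_gt0.
- by rewrite mulrAC mulrC -ler_pdivlMl// mulr1.
- by move=> x xr; apply: r1P; exact: lt_le_trans r_1.
split.
  by move=> x y xr yr; apply: r2P; [exact: lt_le_trans xr r_2|exact: lt_le_trans yr r_2].
by move=> s x y x' y' sr; apply: r3P; exact: le_trans r_3.
Qed.

Definition sqr (x : V) := lmul x x.

(** The discrete counterpart of a curve through the identity with velocity [X], sampled at the times
    [2^-k]. Such sequences are stable under products, inverses and homomorphisms, and the powers
    [g k ^+ (2 ^ k)] tend to the exponential of [X]. *)
Definition tangent_seq (g : nat -> G) (X : V) :=
  (g @ \oo --> (1%g : G)) /\ (fun k => 2 ^+ k *: coor (g k)) @ \oo --> X.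

Lemma lim_unique (u : nat -> G) (a b : G) : u @ \oo --> a -> u @ \oo --> b -> a = b.
Proof. by move=> ua ub; exact: (cvg_unique (@manifold_hausdorff _ _ G) ua ub). Qed.

Lemma point_lmul r C x y : lie_radius r C -> `|x| < 2 * r -> `|y| < 2 * r ->
  gpoint (lmul x y) = (gpoint x * gpoint y)%g.
Proof. by case=> _ _ _ _ [+ _] xr yr => /(_ _ _ xr yr) Uxy; rewrite /lmul coorK. Qed.

Lemma sqr_strict r C : lie_radius r C ->
  forall s x y, s <= 2 * r -> `|x| < s -> `|y| < s ->
  `|sqr x - sqr y - 2 *: (x - y)| <= 2 * C * s * `|x - y|.
Proof.
move=> [_ _ _ _ [_ rP]] s x y sr xs ys.
have := rP s x x y y sr xs xs ys ys.
rewrite -addrA -opprD -mulr2n -scaler_nat (_ : _ * _ = 2 * C * s * `|x - y|)//.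
by ring.
Qed.

Lemma sqr0 : sqr 0 = 0.
Proof. by rewrite /sqr /lmul point0 mulg1 coor1. Qed.

Definition lexpc := koenigs sqr.

Section Radius.
Variables (r C : R).
Hypothesis rC : lie_radius r C.

Let r0 : 0 < r. Proof. by case: rC. Qed.
Let C0 : 0 < 2 * C. Proof. by case: rC => // _ c0 *; rewrite mulr_gt0. Qed.
Let Cr : 2 * C * r <= 1. Proof. by case: rC. Qed.
Let rr : r <= 2 * r. Proof. by rewrite ler_peMl ?ler1n// ltW. Qed.

(** Squaring in coordinates is squaring in the group as long as the iterates stay in the chart, and
    the expansion bound [3 * 2^k] keeps them below [2 * r]. *)
Lemma point_iter_sqr k x : `|x| < r / 2 ^+ k ->
  gpoint (iter k sqr x) = (gpoint x ^+ (2 ^ k))%g.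
Proof.
elim: k => [|k ih] xr; first by rewrite expg1.
have p2 : 0 < (2 : R) ^+ k by rewrite exprn_gt0.
rewrite exprS invfM mulrA in xr.
have xr' : `|x| < r / 2 ^+ k.
  by rewrite (lt_trans xr)// ltr_pM2r ?invr_gt0// ltr_pdivrMr// ltr_pMr// ltr1n.
have := koenigs_iter_le C0 sqr0 (sqr_strict rC) rr Cr xr'.
move=> /(_ 0); rewrite iter_q0 ?sqr0// !subr0 normr0 divr_gt0// => /(_ isT) H.
rewrite iterS {1}/sqr (point_lmul rC); first by rewrite ih// -expgnDr addnn -mul2n -expnS.
all: rewrite (le_lt_trans H)//; move: xr; rewrite ltr_pdivlMr// mulrC; move: (2 ^+ k * _) r0 => t r_0 tr; lra.
Qed.

Lemma lexpc_strict s x y : s <= r -> `|x| < s / 2 -> `|y| < s / 2 ->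
  `|lexpc x - lexpc y - (x - y)| <= 4 * C * s * `|x - y|.
Proof.
move=> sr xs ys; have s0 : 0 < s by have := normr_ge0 x; lra.
have Cs : 2 * C * s <= 1 by rewrite (le_trans _ Cr)// ler_wpM2l// ltW.
have := koenigs_strict C0 sqr0 (sqr_strict rC) (le_trans sr rr) Cs xs ys.
by rewrite mulrA -natrM.
Qed.

Lemma lexpc0 : lexpc 0 = 0.
Proof.
rewrite /lexpc /koenigs; apply: lim_near_cst => //; apply: nearW => k.
by rewrite scaler0 iter_q0// sqr0.
Qed.

Lemma lexpc_lt x : `|x| < r / 2 -> `|lexpc x| < 2 * r.
Proof.
move=> xr; have z : `|0 : V| < r / 2 by rewrite normr0 divr_gt0.
have := lexpc_strict (lexx r) xr z; rewrite lexpc0 !subr0.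
move=> /(le_trans (lerB_dist _ _)); rewrite lerBlDr => /le_lt_trans; apply.
have x0 := normr_ge0 x.
have : 2 * C * r * `|x| <= `|x| by rewrite ler_piMl.
lra.
Qed.

Lemma point_pow_cvg (y : nat -> V) x : `|x| < r / 2 ->
  (fun k => 2 ^+ k *: y k) @ \oo --> x ->
  (fun k => gpoint (y k) ^+ (2 ^ k))%g @ \oo --> gpoint (lexpc x).
Proof.
move=> xr yx.
have ec := koenigs_tangent C0 sqr0 (sqr_strict rC) rr Cr xr yx.
have pc : {for lexpc x, continuous gpoint}.
  by case: rC => _ _ _ + _ => /(_ _ (lexpc_lt xr))[].
apply: (cvg_near_ext _ (continuous_cvg _ pc ec)).
have xr' : `|x| < r by rewrite (lt_trans xr)// ltr_pdivrMr// ltr_pMr// ltr1n.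
have nr : \forall k \near \oo, `|2 ^+ k *: y k| < r by exact: (cvgr_norm_lt _ yx).
apply: filterS nr => k.
rewrite normrZ ger0_norm ?exprn_ge0// mulrC -ltr_pdivlMr ?exprn_gt0//.
by move=> /point_iter_sqr.
Qed.

End Radius.

(* The limit must not depend on the sequence [y]: this is what makes [gexp] the
   exponential of every curve tangent to [X]. *)
Definition dyadic_limit (X : V) (g : G) := forall y : nat -> V,
  (fun k => 2 ^+ k *: y k) @ \oo --> X ->
  (fun k => gpoint (y k) ^+ (2 ^ k))%g @ \oo --> g.

Definition gexp (X : V) : G := xget 1%g [set g | dyadic_limit X g].

(** The shifted sequence [y (k + m)] is tangent to [X / 2^m], and the exponent [2^(k+m)] splits as
    [2^k * 2^m]. This carries the limit from small vectors to all vectors. *)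
Lemma dyadic_limit_scale m (X : V) g :
  dyadic_limit ((2 ^+ m)^-1 *: X) g -> dyadic_limit X (g ^+ (2 ^ m))%g.
Proof.
move=> Xg y yX; apply: (@cvg_unshiftn _ _ m).
have : (fun k => 2 ^+ k *: y (k + m)%N) @ \oo --> (2 ^+ m)^-1 *: X.
  have : (fun k => 2 ^+ (k + m) *: y (k + m)%N) @ \oo --> X.
    by rewrite (cvg_shiftn m (fun k => 2 ^+ k *: y k)).
  move=> H; apply: (cvg_near_ext _ (@cvgZl_tmp _ _ _ _ _ (2 ^+ m)^-1 _ _ H)).
  apply: nearW => k /=; rewrite scalerA exprD mulrCA mulVf ?mulr1//.
move=> /(Xg (fun k => y (k + m)%N)) H.
apply: (cvg_near_ext _ (cvg_expg H)).
by apply: nearW => k /=; rewrite -expgnA -expnD.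
Qed.

Lemma ex_dyadic_limit X : exists g, dyadic_limit X g.
Proof.
have [r [C rC]] := ex_lie_radius.
have r0 : 0 < r / 2 by case: rC => r0 *; rewrite divr_gt0.
have [m mP] : exists m, `|(2 ^+ m)^-1 *: X| < r / 2.
  have : (fun k => geometric `|X| 2^-1 k) @ \oo --> (0 : R).
    by apply: cvg_geometric; rewrite ger0_norm ?invr_ge0// invf_lt1// ltr1n.
  move=> /cvgrPdist_lt/(_ _ r0)[m _ /(_ m (leqnn _))].
  rewrite sub0r normrN /geometric/= ger0_norm ?mulr_ge0//.
  by exists m; rewrite scale_exp2 -exprVn.
exists (gpoint (lexpc ((2 ^+ m)^-1 *: X)) ^+ (2 ^ m))%g.
by apply: dyadic_limit_scale => y; exact: (point_pow_cvg rC mP).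
Qed.

Lemma gexpP X : dyadic_limit X (gexp X).
Proof. by apply: xgetPex; exact: ex_dyadic_limit. Qed.

Lemma coor_cvg0 (g : nat -> G) : g @ \oo --> (1%g : G) -> coor \o g @ \oo --> (0 : V).
Proof.
by move=> g1; rewrite -[X in _ --> X](@coor1 _ _ G); apply: continuous_cvg => //;
  apply: coor_continuous; exact: dom1.
Qed.

Lemma near_point_coor (g : nat -> G) : g @ \oo --> (1%g : G) ->
  \forall k \near \oo, gpoint (coor (g k)) = g k.
Proof.
move=> g1; have : \forall k \near \oo, U (g k) by apply: g1; exact: near_dom (@dom1 _ _ G).
by apply: filterS => k; exact: coorK.
Qed.

Lemma gexp_tangent g X : tangent_seq g X ->
  (fun k => g k ^+ (2 ^ k))%g @ \oo --> gexp X.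
Proof.
move=> [g1 /gexpP gX]; apply: (cvg_near_ext _ gX).
by apply: filterS (near_point_coor g1) => k ->.
Qed.

Lemma gexp_unique g X (a : G) : tangent_seq g X ->
  (fun k => g k ^+ (2 ^ k))%g @ \oo --> a -> gexp X = a.
Proof. by move=> /gexp_tangent gX ga; exact: lim_unique gX ga. Qed.

(** In coordinates the product is the sum up to [C * s] times the norms of both terms. Multiplied by
    [2^k], these norms stay below [B], while [s] can be taken as small as wished. *)
Lemma tangent_seqM g h X Y : tangent_seq g X -> tangent_seq h Y ->
  tangent_seq (fun k => g k * h k)%g (X + Y).
Proof.
move=> [g1 gX] [h1 hY]; split.
  by rewrite -[1%g](mulg1 (1%g : G)); exact: cvg_mulg.
have [r [C [r0 C0 _ _ [_ rP]]]] := ex_lie_radius.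
apply: (cvg_sub0 _ (cvgD gX hY)); apply/cvgr0Pnorm_le => e e0.
have [B Bpos BP] : exists2 B : R, 0 < B & \forall k \near \oo,
    `|2 ^+ k *: coor (g k)| + `|2 ^+ k *: coor (h k)| <= B.
  exists (`|X| + 1 + (`|Y| + 1)); first by rewrite !ltr_wpDl ?addr_ge0.
  have X1 : `|X| < `|X| + 1 by rewrite ltrDl.
  have Y1 : `|Y| < `|Y| + 1 by rewrite ltrDl.
  have H1 : \forall k \near \oo, `|2 ^+ k *: coor (g k)| < `|X| + 1.
    exact: (cvgr_norm_lt _ gX).
  have H2 : \forall k \near \oo, `|2 ^+ k *: coor (h k)| < `|Y| + 1.
    exact: (cvgr_norm_lt _ hY).
  by near=> k; rewrite lerD// ltW//; near: k.
pose s := Num.min (2 * r) (e / (C * B)).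
have s0 : 0 < s by rewrite lt_min mulr_gt0// divr_gt0// mulr_gt0.
have n0 : `|0 : V| < s by rewrite normr0.
have gs : \forall k \near \oo, `|coor (g k)| < s by exact: (cvgr_norm_lt _ (coor_cvg0 g1)).
have hs : \forall k \near \oo, `|coor (h k)| < s by exact: (cvgr_norm_lt _ (coor_cvg0 h1)).
near=> k.
have gk : `|coor (g k)| < s by near: k.
have hk : `|coor (h k)| < s by near: k.
have p2 : 0 < (2 : R) ^+ k by rewrite exprn_gt0.
have := rP s (coor (g k)) (coor (h k)) 0 0 _ gk hk n0 n0.
rewrite !subr0 {2}/lmul point0 mulg1 coor1 subr0 ge_min lexx => /(_ isT).
have gE : gpoint (coor (g k)) = g k by near: k; exact: near_point_coor.
have hE : gpoint (coor (h k)) = h k by near: k; exact: near_point_coor.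
rewrite /lmul gE hE -(ler_pM2l p2) => H.
have Bk : `|2 ^+ k *: coor (g k)| + `|2 ^+ k *: coor (h k)| <= B by near: k.
suff : `|2 ^+ k *: (coor (g k * h k)%g - coor (g k) - coor (h k))| <= e.
  by rewrite scalerBr (scalerBr _ (coor (g k * h k)%g) (coor (g k))) -addrA -opprD => H3; exact: H3.
rewrite normrZ (ger0_norm (ltW p2)) (le_trans H)//.
rewrite (_ : 2 ^+ k * _ = C * s * (`|2 ^+ k *: coor (g k)| + `|2 ^+ k *: coor (h k)|)); last first.
  by rewrite !normrZ (ger0_norm (ltW p2)); ring.
rewrite (@le_trans _ _ (C * s * B))//; first by rewrite ler_wpM2l// mulr_ge0 ?ltW.
by rewrite mulrAC -ler_pdivlMl ?mulr_gt0// mulrC ge_min lexx orbT.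
Unshelve. all: by end_near. Qed.

End Exponential.

Lemma additive_of_ge0 (R : realDomainType) (T : groupType) (f : R -> T) :
  (forall s t, 0 <= s -> 0 <= t -> f (s + t) = (f s * f t)%g) ->
  (forall t, f (- t) = (f t)^-1%g) -> forall s t, f (s + t) = (f s * f t)%g.
Proof.
move=> fD fN.
have half s t : 0 <= s -> f (s + t) = (f s * f t)%g.
  move=> s0; have [t0|t0] := leP 0 t; first exact: fD.
  have [st0|st0] := leP 0 (s + t).
    have := fD (s + t) (- t) st0; rewrite oppr_ge0 => /(_ (ltW t0)).
    by rewrite addrK fN => ->; rewrite mulgVK.
  have := fD (- (s + t)) s; rewrite oppr_ge0 => /(_ (ltW st0) s0).
  rewrite opprD addrAC addNr add0r -opprD !fN => /(congr1 (fun x => x^-1)%g).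
  by rewrite invgM !invgK => ->; rewrite mulVKg.
move=> s t; have [s0|s0] := leP 0 s; first exact: half.
have ns0 : 0 <= - s by rewrite oppr_ge0 ltW.
have := half (- s) (s + t) ns0; rewrite addKr fN => ->.
by rewrite mulVKg.
Qed.

(** * The exponential and one-parameter subgroups *)

Section OneParameter.
Context {R : realType} {n : nat} {G : lieGroupType R n}.
Local Notation V := 'rV[R]_n.
Local Notation U := (cdom (chart_at (1%g : G))).
Local Notation coor := (@coor R n G).
Local Notation gpoint := (@gpoint R n G).
Local Notation gexp := (@gexp R n G).
Local Notation lexpc := (@lexpc R n G).

Lemma cvg_exp2V (X : V) : (fun k => (2 ^+ k)^-1 *: X) @ \oo --> (0 : V).
Proof.
have c0 : (fun k => geometric 1 2^-1 k) @ \oo --> (0 : R).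
  by apply: cvg_geometric; rewrite ger0_norm ?invr_ge0// invf_lt1// ltr1n.
rewrite -(scale0r X); apply: (cvg_near_ext _ (cvgZr_tmp c0)).
by apply: nearW => k; rewrite /geometric/= mul1r exprVn.
Qed.

Lemma gexpE r C X : @lie_radius _ _ G r C -> `|X| < r / 2 -> gexp X = gpoint (lexpc X).
Proof.
move=> rC Xr; have cX : (fun k => 2 ^+ k *: ((2 ^+ k)^-1 *: X)) @ \oo --> X.
  apply: (cvg_near_ext _ (cvg_cst X)); apply: nearW => k.
  by rewrite scalerA divff ?scale1r// expf_neq0.
exact: lim_unique (gexpP cX) (point_pow_cvg rC Xr cX).
Qed.

Lemma coor_gexp r C X : @lie_radius _ _ G r C -> `|X| < r / 2 ->
  [/\ U (gexp X), coor (gexp X) = lexpc X & {for coor (gexp X), continuous gpoint}].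
Proof.
move=> rC Xr; rewrite (gexpE rC Xr); have := lexpc_lt rC Xr.
by case: rC => _ _ _ rP _ /rP[Up pK pc]; rewrite pK.
Qed.

Lemma gexp_strict : exists r C : R, [/\ 0 < r, 0 < C,
  forall X, `|X| < r -> U (gexp X) &
  forall s X Y, s <= r -> `|X| < s -> `|Y| < s ->
   `|coor (gexp X) - coor (gexp Y) - (X - Y)| <= C * s * `|X - Y|].
Proof.
have [r [C rC]] := @ex_lie_radius R n G.
have [r0 C0 _ _ _] := rC.
exists (r / 2), (8 * C); split; rewrite ?divr_gt0 ?mulr_gt0//.
  by move=> X /(coor_gexp rC)[].
move=> s X Y sr Xs Ys.
have [_ -> _] := coor_gexp rC (lt_le_trans Xs sr).
have [_ -> _] := coor_gexp rC (lt_le_trans Ys sr).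
have s2 (z : V) : `|z| < s -> `|z| < 2 * s / 2 by move=> ?; rewrite mulrAC divff ?mul1r.
have sr' : 2 * s <= r by rewrite mulrC -ler_pdivlMr.
have := lexpc_strict rC sr' (s2 _ Xs) (s2 _ Ys).
by rewrite (_ : 8 * C * s = 4 * C * (2 * s))//; ring.
Qed.

Lemma gexp0 : gexp 0 = 1%g.
Proof.
have [r [C rC]] := @ex_lie_radius R n G.
rewrite (gexpE rC) ?lexpc0 ?gpoint0// ?normr0 ?divr_gt0//; first by rewrite point0.
by case: rC.
Qed.

Lemma gexp_near r C (X : V) : @lie_radius _ _ G r C -> `|X| < r / 2 ->
  {for X, continuous gexp}.
Proof.
move=> rC Xr.
have cl : {for X, continuous lexpc}.
  apply: (near_lipschitz_continuous (K := 4 * C * r + 1)).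
  apply: filterS (near_norm_lt_bound Xr) => Y Yr.
  have := lexpc_strict rC (lexx r) Xr Yr.
  move=> /(le_trans (lerB_dist _ _)); rewrite lerBlDr => /le_trans; apply.
  by rewrite [leRHS]mulrDl mul1r; exact: lexx.
have [_ cE pc] := coor_gexp rC Xr.
rewrite cE in pc; rewrite /prop_for /continuous_at (gexpE rC Xr).
apply: (cvg_near_ext _ (continuous_cvg _ pc cl)).
by apply: filterS (near_norm_lt_bound Xr) => Y Yr; rewrite (gexpE rC Yr).
Unshelve. all: by end_near. Qed.

Lemma cvg_gexp0 T (F : set_system T) {FF : Filter F} (f : T -> V) :
  f @ F --> (0 : V) -> (fun t => gexp (f t)) @ F --> (1%g : G).
Proof.
move=> f0; rewrite -gexp0; have [r [C rC]] := @ex_lie_radius R n G.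
apply: continuous_cvg f0; apply: (gexp_near rC).
by rewrite normr0 divr_gt0//; case: rC.
Qed.

Lemma tangent_gexp X : tangent_seq (fun k => gexp ((2 ^+ k)^-1 *: X)) X.
Proof.
split; first exact: cvg_gexp0 (cvg_exp2V X).
have [r [C [r0 C0 rU rP]]] := gexp_strict.
apply/cvgrPdist_le => e e0.
pose s := Num.min r (e / (C * (`|X| + 1))).
have X1 : 0 < `|X| + 1 by rewrite ltr_wpDl.
have s0 : 0 < s by rewrite lt_min r0 divr_gt0// mulr_gt0.
have n0 : `|0 : V| < s by rewrite normr0.
have xs : \forall k \near \oo, `|(2 ^+ k)^-1 *: X| < s.
  exact: (cvgr_norm_lt _ (cvg_exp2V X)).
near=> k.
have xk : `|(2 ^+ k)^-1 *: X| < s by near: k.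
have p2 : 0 < (2 : R) ^+ k by rewrite exprn_gt0.
have sr : s <= r by rewrite ge_min lexx.
have := rP s ((2 ^+ k)^-1 *: X) 0 sr xk n0.
rewrite gexp0 coor1 !subr0 -(ler_pM2l p2).
set c := coor _.
have -> : 2 ^+ k * `|c - (2 ^+ k)^-1 *: X| = `|X - 2 ^+ k *: c|.
  rewrite -[X in X * _](ger0_norm (ltW p2)) -normrZ scalerBr scalerA.
  by rewrite divff ?gt_eqF// scale1r distrC.
rewrite scale_exp2 => /le_trans; apply.
have -> : 2 ^+ k * (C * s * (`|X| / 2 ^+ k)) = C * s * `|X|.
  by field; rewrite gt_eqF.
rewrite (@le_trans _ _ (C * s * (`|X| + 1)))//.
  by rewrite ler_wpM2l ?lerDl// mulr_ge0 ?ltW.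
by rewrite mulrAC mulrC -ler_pdivlMr ?mulr_gt0// ge_min lexx orbT.
Unshelve. all: by end_near. Qed.

(** The estimate of multiplication is applied to [g k * (g k)^-1 = 1]: the two coordinate vectors
    cancel up to a small multiple of their norms. *)
Lemma tangent_seqV (g : nat -> G) X : tangent_seq g X -> tangent_seq (fun k => (g k)^-1)%g (- X : V).
Proof.
move=> [g1 gX]; have h1 : (fun k => (g k)^-1)%g @ \oo --> (1%g : G).
  by rewrite -[1%g](invg1 G); exact: cvg_invg.
split => //.
have [r [C [r0 C0 _ _ [_ rP]]]] := @ex_lie_radius R n G.
apply: (cvg_sub0 _ (cvgN gX)); apply/cvgr0Pnorm_le => e e0.
have Bpos : 0 < 4 * C * (`|X| + 1) by rewrite mulr_gt0 ?mulr_gt0// ltr_wpDl.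
have X1 : `|X| < `|X| + 1 by rewrite ltrDl.
have Bn : \forall k \near \oo, `|2 ^+ k *: coor (g k)| < `|X| + 1.
  exact: (cvgr_norm_lt _ gX).
pose s := Num.min (Num.min (2 * r) ((2 * C)^-1)) (e / (4 * C * (`|X| + 1))).
have s0 : 0 < s by rewrite !lt_min mulr_gt0// invr_gt0 mulr_gt0// divr_gt0.
have n0 : `|0 : V| < s by rewrite normr0.
have gs : \forall k \near \oo, `|coor (g k)| < s.
  exact: (cvgr_norm_lt _ (coor_cvg0 g1)).
have hs : \forall k \near \oo, `|coor (g k)^-1%g| < s.
  exact: (cvgr_norm_lt _ (coor_cvg0 h1)).
near=> k.
have gk : `|coor (g k)| < s by near: k.
have hk : `|coor (g k)^-1%g| < s by near: k.
have p2 : 0 < (2 : R) ^+ k by rewrite exprn_gt0.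
have := rP s (coor (g k)) (coor (g k)^-1%g) 0 0 _ gk hk n0 n0.
rewrite !subr0 {2}/lmul point0 mulg1 coor1 subr0 !ge_min lexx => /(_ isT).
have gE : gpoint (coor (g k)) = g k by near: k; exact: near_point_coor.
have hE : gpoint (coor (g k)^-1%g) = (g k)^-1%g by near: k; exact: near_point_coor.
rewrite /lmul gE hE mulgV coor1 sub0r -opprD normrN => H.
have Bk : `|2 ^+ k *: coor (g k)| < `|X| + 1 by near: k.
suff : `|2 ^+ k *: (coor (g k)^-1%g + coor (g k))| <= e.
  by rewrite scalerDr -[X in _ + X]opprK => H3; exact: H3.
have Cs : C * s <= 1 / 2.
  have : s <= (2 * C)^-1 by rewrite !ge_min lexx orbT.
  move=> /(ler_wpM2l (ltW C0))/le_trans; apply.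
  by rewrite invfM mulrCA divff ?mulr1 ?gt_eqF// mul1r.
have xy : `|coor (g k)^-1%g| <= `|coor (g k) + coor (g k)^-1%g| + `|coor (g k)|.
  rewrite -{1}[coor (g k)^-1%g](addrK (coor (g k))) [X in `|X - _|]addrC.
  by rewrite (le_trans (ler_normB _ _)).
have := normr_ge0 (coor (g k)); have := normr_ge0 (coor (g k)^-1%g).
rewrite addrC normrZ (ger0_norm (ltW p2)).
move: H xy Bk; rewrite normrZ (ger0_norm (ltW p2)).
move: `|coor (g k) + _| `|coor (g k)| `|coor (g k)^-1%g| => w x y H xy Bk y0 x0.
(* Absorption: as [C * s <= 1 / 2], the inequalities [y <= w + x] and [w <= C * s * (x + y)] give
   [y <= 3 * x], after which [w] is controlled by [x] alone. *)
have yx : y <= 3 * x by nra.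
have wx : w <= 4 * (C * s) * x.
  have Cs0 : 0 <= C * s by rewrite mulr_ge0 ?ltW.
  by rewrite (le_trans H)//; nra.
have : s * (4 * C * (`|X| + 1)) <= e by rewrite -ler_pdivlMr// ge_min lexx orbT.
apply: le_trans.
rewrite (@le_trans _ _ (4 * (C * s) * (2 ^+ k * x)))//.
  by rewrite [leRHS]mulrCA ler_wpM2l// ltW.
rewrite (_ : s * _ = 4 * (C * s) * (`|X| + 1)); last by ring.
by rewrite ler_wpM2l ?ltW// !mulr_gt0.
Unshelve. all: by end_near. Qed.

Lemma gexpN X : gexp (- X) = (gexp X)^-1%g.
Proof.
apply: gexp_unique (tangent_seqV (tangent_gexp X)) _.
apply: (cvg_near_ext _ (cvg_invg (gexp_tangent (tangent_gexp X)))).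
by apply: nearW => k; rewrite expVgn.
Qed.

Lemma tangent_seqX (g : nat -> G) X j : tangent_seq g X -> tangent_seq (fun k => g k ^+ j)%g (X *+ j : V).
Proof.
move=> gX; elim: j => [|j ih].
  split; first exact: cvg_cst.
  apply: (cvg_near_ext _ (cvg_cst (0 : V))).
  by apply: nearW => k; rewrite expg0 coor1 scaler0.
have -> : (fun k => g k ^+ j.+1)%g = (fun k => g k * g k ^+ j)%g.
  by apply/funext => k; rewrite expgS.
by rewrite mulrS; exact: tangent_seqM.
Qed.

Lemma gexpMn X j : gexp (X *+ j) = (gexp X ^+ j)%g.
Proof.
apply: gexp_unique (tangent_seqX j (tangent_gexp X)) _.
apply: (cvg_near_ext _ (cvg_expg (gexp_tangent (tangent_gexp X)))).
by apply: nearW => k; rewrite expgnAC.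
Qed.

(** Continuity near [0] spreads through [gexp Y = gexp (Y / 2^m) ^+ (2^m)], with one [m] for all [Y]
    near [X]. *)
Lemma gexp_continuous : continuous gexp.
Proof.
move=> X; have [r [C rC]] := @ex_lie_radius R n G.
have r2 : 0 < r / 2 by case: rC => *; rewrite divr_gt0.
have [m mP] : exists m, `|(2 ^+ m)^-1 *: X| < r / 2.
  have : \forall k \near \oo, `|(2 ^+ k)^-1 *: X| < r / 2.
    by apply: (cvgr_norm_lt _ (cvg_exp2V X)); rewrite normr0.
  by move=> [m _ /(_ m (leqnn _))]; exists m.
have E Y : (gexp ((2 ^+ m)^-1 *: Y) ^+ (2 ^ m))%g = gexp Y.
  by rewrite -gexpMn -scaler_nat scalerA natrX divff ?scale1r// expf_neq0.
rewrite /continuous_at -E.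
have cs : (fun Y : V => (2 ^+ m)^-1 *: Y) @ X --> (2 ^+ m)^-1 *: X.
  exact: (cvgZl_tmp cvg_id).
apply: (cvg_near_ext _ (cvg_expg (continuous_cvg _ (gexp_near rC mP) cs))).
by apply: nearW => Y; rewrite E.
Qed.

Lemma cvg_gexp T (F : set_system T) {FF : Filter F} (f : T -> V) X :
  f @ F --> X -> (fun t => gexp (f t)) @ F --> gexp X.
Proof. by move=> fX; apply: continuous_cvg => //; exact: gexp_continuous. Qed.

Lemma cvg_truncn (s : R) : 0 <= s ->
  (fun k => (Num.truncn (2 ^+ k * s))%:R / 2 ^+ k) @ \oo --> s.
Proof.
move=> s0; apply/cvgrPdist_le => e e0.
have c0 : (fun k => geometric 1 2^-1 k) @ \oo --> (0 : R).
  by apply: cvg_geometric; rewrite ger0_norm ?invr_ge0// invf_lt1// ltr1n.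
have : \forall k \near \oo, `|0 - geometric 1 2^-1 k| <= e.
  by move/cvgrPdist_le : c0; apply.
apply: filterS => k; rewrite sub0r normrN /geometric/= mul1r ger0_norm ?exprn_ge0 ?invr_ge0//.
apply: le_trans; rewrite [leRHS]exprVn.
have p2 : 0 < (2 : R) ^+ k by rewrite exprn_gt0.
have /truncn_itv/andP[tl tu] : 0 <= 2 ^+ k * s by rewrite mulr_ge0// ltW.
set i := Num.truncn _ in tl tu *.
have -> : s - i%:R / 2 ^+ k = (2 ^+ k * s - i%:R) / 2 ^+ k.
  by field; rewrite gt_eqF.
rewrite ger0_norm; last by rewrite divr_ge0 ?subr_ge0// ltW.
by rewrite -[leRHS]mul1r ler_wpM2r ?invr_ge0 ?(ltW p2)// lerBlDl natr1 ltW.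
Qed.

(** Approximate [s] and [t] by multiples of the same [2^-k]: there the identity merely adds
    exponents of [gexp (2^-k X)], and continuity passes to the limit. Truncation to natural
    multiples explains the restriction on signs. *)
Lemma gexpD_ge0 X (s t : R) : 0 <= s -> 0 <= t ->
  gexp ((s + t) *: X) = (gexp (s *: X) * gexp (t *: X))%g.
Proof.
move=> s0 t0.
pose i k := Num.truncn (2 ^+ k * s); pose j k := Num.truncn (2 ^+ k * t).
have E k (a : nat) : gexp ((a%:R / 2 ^+ k) *: X) = (gexp ((2 ^+ k)^-1 *: X) ^+ a)%g.
  by rewrite -gexpMn -[(_ *: X) *+ a]scaler_nat scalerA.
have cs : (fun k => gexp (((i k)%:R / 2 ^+ k) *: X)) @ \oo --> gexp (s *: X).
  exact: (cvg_gexp (cvgZr_tmp (cvg_truncn s0))).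
have ct : (fun k => gexp (((j k)%:R / 2 ^+ k) *: X)) @ \oo --> gexp (t *: X).
  exact: (cvg_gexp (cvgZr_tmp (cvg_truncn t0))).
have cst : (fun k => gexp (((i k)%:R / 2 ^+ k + (j k)%:R / 2 ^+ k) *: X)) @ \oo
    --> gexp ((s + t) *: X).
  exact: (cvg_gexp (cvgZr_tmp (cvgD (cvg_truncn s0) (cvg_truncn t0)))).
apply: (lim_unique cst); apply: (cvg_near_ext _ (cvg_mulg cs ct)).
by apply: nearW => k; rewrite !E -expgnDr -E natrD mulrDl.
Qed.

Lemma gexpD X (s t : R) : gexp ((s + t) *: X) = (gexp (s *: X) * gexp (t *: X))%g.
Proof.
apply: (@additive_of_ge0 _ _ (fun t => gexp (t *: X))) => [{}s {}t|{}t].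
  exact: gexpD_ge0.
by rewrite scaleNr gexpN.
Qed.

Lemma gexp_one_param X : one_param X (fun t : R => gexp (t *: X)).
Proof.
split.
- by move=> t; apply: cvg_gexp; exact: (cvgZr_tmp cvg_id).
- by move=> s t; rewrite gexpD.
have [r [C [r0 C0 _ rP]]] := gexp_strict.
have H : (fun h : R => h^-1 *: (coor (gexp (h *: X)) - coor (gexp (0 *: X)))) @ 0^' --> X.
  rewrite scale0r gexp0 coor1.
  apply/cvgrPdist_le => e e0.
  pose s := Num.min r (e / (C * (`|X| + 1))).
  have X1 : 0 < `|X| + 1 by rewrite ltr_wpDl.
  have s0 : 0 < s by rewrite lt_min r0 divr_gt0// mulr_gt0.
  have n0 : `|0 : V| < s by rewrite normr0.
  near=> h.
  have h0 : h != 0 by near: h; exact: nbhs_dnbhs_neq.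
  have hs : `|h| < s / (`|X| + 1) by near: h; apply: dnbhs0_lt; rewrite divr_gt0.
  have hX : `|h *: X| < s.
    rewrite normrZ (@le_lt_trans _ _ (`|h| * (`|X| + 1)))// ?ler_wpM2l ?lerDl//.
    by rewrite -ltr_pdivlMr.
  have sr : s <= r by rewrite ge_min lexx.
  have := rP s (h *: X) 0 sr hX n0.
  rewrite gexp0 coor1 !subr0; move: (coor (gexp (h *: X))) => c H.
  have -> : X - h^-1 *: c = - (h^-1 *: (c - h *: X)).
    by rewrite scalerBr scalerA mulVf// scale1r opprB.
  have hp : 0 < `|h| by rewrite normr_gt0.
  rewrite normrN normrZ normfV mulrC ler_pdivrMr// (le_trans H)// normrZ.
  rewrite (@le_trans _ _ (C * s * (`|h| * (`|X| + 1))))//.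
    by rewrite ler_wpM2l ?ler_wpM2l ?lerDl// mulr_ge0 ?ltW.
  rewrite (_ : C * s * _ = s * (C * (`|X| + 1)) * `|h|); last by ring.
  by rewrite ler_wpM2r// -ler_pdivlMr ?mulr_gt0// ge_min lexx orbT.
pose f := cfun (chart_at (1%g : G)) \o (fun t : R => gexp (t *: X)).
have H' : (fun h : R => h^-1 *: ((f \o shift 0) (h *: 1) - f 0)) @ 0^' --> X.
  apply: (cvg_near_ext _ H); apply: nearW => h /=.
  by rewrite /shift/= addr0 [h *: 1]mulr1 opprB addrA subrK.
by split; [apply/cvg_ex; exists X|exact/cvg_lim].
Unshelve. all: by end_near. Qed.

Lemma one_param_tangent X (gam : R -> G) t : one_param X gam ->
  tangent_seq (fun k => gam (t / 2 ^+ k)) (t *: X).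
Proof.
move=> [gc gD gX].
have g0 : gam 0 = 1%g.
  by apply: (mulgI (gam 0)); rewrite -gD addr0 mulg1.
have t0 : (fun k => t / 2 ^+ k) @ \oo --> (0 : R).
  have c0 : (fun k => geometric t 2^-1 k) @ \oo --> (0 : R).
    by apply: cvg_geometric; rewrite ger0_norm ?invr_ge0// invf_lt1// ltr1n.
  by apply: (cvg_near_ext _ c0); apply: nearW => k; rewrite /geometric/= exprVn.
split; first by rewrite -g0; apply: continuous_cvg => //; exact: gc.
have [->|tn0] := eqVneq t 0.
  apply: (cvg_near_ext _ (cvg_cst (0 *: X))); apply: nearW => k.
  by rewrite mul0r g0 coor1 scaler0 scale0r.
have [gd <-] := gX.
have td : (fun k => t / 2 ^+ k) @ \oo --> (0 : R)^'.
  move=> A [e e0 eA]; have [N _ NP] := t0 _ (nbhsx_ballx (0 : R) _ e0).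
  exists N => // k /= Nk; apply: eA; first exact: NP.
  by rewrite mulf_neq0// invr_neq0// expf_neq0.
have lc := cvg_comp _ _ td gd.
apply: (cvg_near_ext _ (cvgZl_tmp (k := t) lc)); apply: nearW => k /=.
rewrite scalerA invf_div mulrCA divff// mulr1.
by rewrite /shift/= addr0 [_ *: 1]mulr1 g0.
Qed.

(** For every [k], [gam t] is the power [gam (t / 2^k) ^+ (2^k)], and the limit of such powers
    depends only on the velocity. *)
Lemma one_param_unique X (gam : R -> G) t : one_param X gam -> gam t = gexp (t *: X).
Proof.
move=> gX; apply/esym; apply: gexp_unique (one_param_tangent t gX) _.
have [_ gD _] := gX; apply: (cvg_near_ext _ (cvg_cst (gam t))).
apply: nearW => k; have E j s : gam (s *+ j) = (gam s ^+ j)%g.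
  elim: j => [|j ih]; last by rewrite mulrS gD ih expgS.
  by apply: (mulgI (gam 0)); rewrite -gD addr0 mulg1.
by rewrite -E -[_ *+ (2 ^ k)%N]mulr_natr natrX divfK// expf_neq0.
Qed.

Lemma lexpE X : lexp G X = gexp X.
Proof.
rewrite /lexp; case: xgetP => [_ ->|/(_ (gexp X)) []].
  by case=> gam gX <-; rewrite (one_param_unique 1 gX) scale1r.
by exists (fun t : R => gexp (t *: X)); [exact: gexp_one_param|rewrite scale1r].
Qed.

End OneParameter.

(** * Homomorphisms and the adjoint representation *)

Lemma near_eq_differentiable (R : realType) (V W : normedModType R) (f g : V -> W) x :
  (\forall y \near x, f y = g y) -> differentiable f x -> differentiable g x.
Proof.
move=> fg fx; have fgx : f x = g x := nbhs_singleton fg.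
apply/diff_locallyP; have [dc dE] := (diff_locallyP x f).1 fx.
suff E : g \o shift x = cst (g x) + 'd f x +o_ 0 id.
  by have -> : 'd g x = 'd f x :> (V -> W) by apply: diff_unique.
have fg0 : \forall y \near (0 : V), (f \o shift x) y = (g \o shift x) y.
  by move: fg; rewrite (near_shift 0) subr0.
apply/eqaddoP => _/posnumP[e]; have /eqaddoP/(_ e%:num) := dE.
move=> /(_ [gt0 of e%:num]); apply: filterS2 fg0 => y fgy.
have E : (g \o shift x) y - (cst (g x) y + 'd f x y) =
         (f \o shift x) y - (cst (f x) y + 'd f x y) by rewrite -fgy /= fgx.
by move=> H; apply: le_trans H; rewrite -[leLHS]/(`|(g \o shift x) y - (cst (g x) y + 'd f x y)|) E.
Qed.

Lemma differentiable_littleo (R : realType) (V W : normedModType R) (f : V -> W) x (e : R) :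
  0 < e -> differentiable f x ->
  \forall h \near (0 : V), `|f (h + x) - f x - 'd f x h| <= e * `|h|.
Proof.
move=> e0 /(diff_locallyP x f).1[_ /eqaddoP/(_ e e0)]; apply: filterS => h.
by rewrite /shift/= opprD addrA.
Qed.

Section LieEndo.
Context {R : realType} {n : nat} {G : lieGroupType R n}.
Local Notation V := 'rV[R]_n.
Local Notation U := (cdom (chart_at (1%g : G))).
Local Notation coor := (@coor R n G).
Local Notation gpoint := (@gpoint R n G).
Local Notation gexp := (@gexp R n G).
Local Notation e0 := (cfun (chart_at (1%g : G)) 1%g).
Implicit Types (tau : G -> G) (X Y : V) (g : G).

(** Differentiability is asked only at the identity, in the chart there. Conjugations satisfy this
    by two multiplications, without any study of their coordinate expressions elsewhere. *)
Definition lie_endo tau := [/\ {for 1%g, continuous tau},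
  {morph tau : x y / (x * y)%g} &
  differentiable (cfun (chart_at 1%g) \o tau \o cinv (chart_at (1%g : G))) e0].

Lemma lie_endo1 tau : lie_endo tau -> tau 1%g = 1%g.
Proof. by case=> _ tM _; apply: (mulgI (tau 1%g)); rewrite -tM !mulg1. Qed.

Lemma lie_endoX tau g j : lie_endo tau -> tau (g ^+ j)%g = (tau g ^+ j)%g.
Proof.
move=> te; have [_ tM _] := te.
by elim: j => [|j ih]; rewrite ?expg0 ?(lie_endo1 te)// !expgS tM ih.
Qed.

Lemma dif1E tau X : lie_endo tau -> dif1 tau X =
  'd (cfun (chart_at 1%g) \o tau \o cinv (chart_at (1%g : G))) e0 X.
Proof. by case=> _ _ td; rewrite /dif1 deriveE. Qed.

Lemma dif1D tau X Y : lie_endo tau -> dif1 tau (X + Y) = dif1 tau X + dif1 tau Y.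
Proof. by move=> te; rewrite !dif1E// linearD. Qed.

Lemma dif1Z tau a X : lie_endo tau -> dif1 tau (a *: X) = a *: dif1 tau X.
Proof. by move=> te; rewrite !dif1E// linearZ. Qed.

Lemma tangent_seq_endo tau (g : nat -> G) X : lie_endo tau ->
  tangent_seq g X -> tangent_seq (tau \o g) (dif1 tau X).
Proof.
move=> te [g1 gX]; have [tc _ td] := te.
have t1 := lie_endo1 te; have tg1 : tau \o g @ \oo --> (1%g : G).
  by rewrite -t1; exact: continuous_cvg.
split => //.
set F := _ \o _ in td; pose D : V -> V := 'd F e0.
have Dc : continuous D by exact: diff_continuous.
have DX : (fun k => D (2 ^+ k *: coor (g k))) @ \oo --> D X.
  by apply: continuous_cvg gX; exact: Dc.
rewrite (dif1E _ te) -/F; apply: (cvg_sub0 _ DX); apply/cvgr0Pnorm_le => e e0'.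
have X1 : `|X| < `|X| + 1 by rewrite ltrDl.
have Xp : 0 < `|X| + 1 by rewrite ltr_wpDl.
have Bn : \forall k \near \oo, `|2 ^+ k *: coor (g k)| < `|X| + 1.
  exact: (cvgr_norm_lt _ gX).
have FD : \forall h \near (0 : V), `|F (h + e0) - F e0 - D h| <= e / (`|X| + 1) * `|h|.
  by apply: differentiable_littleo => //; rewrite divr_gt0.
have FDg : \forall k \near \oo, `|F (coor (g k) + e0) - F e0 - D (coor (g k))| <=
    e / (`|X| + 1) * `|coor (g k)|.
  have c0 : coor \o g @ \oo --> (0 : V) := coor_cvg0 g1.
  by move: FD => /c0.
have Ug : \forall k \near \oo, gpoint (coor (g k)) = g k by exact: near_point_coor.
near=> k.
have p2 : 0 < (2 : R) ^+ k by rewrite exprn_gt0.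
have gk : cinv (chart_at (1%g : G)) (coor (g k) + e0) = g k by near: k.
have Fe : F e0 = e0 by rewrite /F/= cinv1 t1.
have Fk : F (coor (g k) + e0) - F e0 = coor (tau (g k)) by rewrite Fe /F/= gk.
have Bk : `|2 ^+ k *: coor (g k)| < `|X| + 1 by near: k.
have : `|F (coor (g k) + e0) - F e0 - D (coor (g k))| <= e / (`|X| + 1) * `|coor (g k)| by near: k.
rewrite Fk -(ler_pM2l p2) => H.
have DZ : D (2 ^+ k *: coor (g k)) = 2 ^+ k *: D (coor (g k)) by exact: linearZ.
suff : `|2 ^+ k *: (coor (tau (g k)) - D (coor (g k)))| <= e.
  by rewrite (scalerBr _ (coor (tau (g k)))) -DZ => H2; exact: H2.
rewrite normrZ (ger0_norm (ltW p2)) (le_trans H)//.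
rewrite mulrCA -[X in _ * (X * _)](ger0_norm (ltW p2)) -normrZ.
by rewrite mulrAC ler_pdivrMr// ler_wpM2l// ltW.
Unshelve. all: by end_near. Qed.

Lemma endo_gexp tau X : lie_endo tau -> tau (gexp X) = gexp (dif1 tau X).
Proof.
move=> te; apply/esym; apply: gexp_unique (tangent_seq_endo te (tangent_gexp X)) _.
apply: (cvg_near_ext _ (cvg_cst (tau (gexp X)))); apply: nearW => k.
by rewrite -lie_endoX// -gexpMn -[(_ *: X) *+ _]scaler_nat scalerA natrX divff ?scale1r// expf_neq0.
Qed.

(** The two one-parameter subgroups have the same velocity at [0]. This is how identities in the
    group descend to the Lie algebra, for instance the multiplicativity of [Ad]. *)
Lemma gexp_inj X Y : (forall t : R, gexp (t *: X) = gexp (t *: Y)) -> X = Y.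
Proof.
move=> XY; have [_ _ [_ dX]] := @gexp_one_param _ _ G X.
have [_ _ [_ dY]] := @gexp_one_param _ _ G Y.
have E : (fun t : R => gexp (t *: X)) = (fun t : R => gexp (t *: Y)) by exact/funext.
by rewrite E in dX; exact: etrans (esym dX) dY.
Qed.

Lemma smooth_endo tau : smooth_map tau -> {morph tau : x y / (x * y)%g} -> lie_endo tau.
Proof.
move=> [tc ts] tM; have t1 : tau 1%g = 1%g.
  by apply: (mulgI (tau 1%g)); rewrite -tM !mulg1.
split => //; first exact: tc.
have [td _] := ts 1%g 1%g 1%N; apply: td; rewrite inE.
by exists 1%g => //; split; [exact: dom1|rewrite /= t1; exact: dom1].
Qed.

Lemma chartK (a g : G) : cdom (chart_at a) g -> cinv (chart_at a) (cfun (chart_at a) g) = g.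
Proof. by move=> ag; rewrite (cfunK (chart_atP a))// inE. Qed.

Lemma cinv1_continuous : {for e0, continuous (cinv (chart_at (1%g : G)))}.
Proof.
apply: (cinv_continuous (chart_atP _)); rewrite inE; exists 1%g => //; exact: dom1.
Qed.

Lemma conj_lie_endo g : lie_endo (fun h => g * h * g^-1)%g.
Proof.
split.
- exact: (cvg_mulg (cvg_mulg (cvg_cst g) cvg_id) (cvg_cst (g^-1)%g)).
- by move=> x y; rewrite !mulgA mulgVK.
(* Conjugation is read as left multiplication by [g] into the chart at [g], followed by right
   multiplication by [g^-1] back into the chart at the identity. *)
pose c1 := chart_at (1%g : G); pose cg := chart_at g; pose cv := chart_at (g^-1)%g.
have [d1 _] := @lie_mulg_smooth _ _ G g 1%g g 1%N.
have [d2 _] := @lie_mulg_smooth _ _ G g (g^-1)%g 1%g 1%N.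
have gE : cinv cg (cfun cg g) = g by apply: chartK; exact: mem_chart_at.
have gVE : cinv cv (cfun cv (g^-1)%g) = (g^-1)%g by apply: chartK; exact: mem_chart_at.
pose M1 (p : V * V) := cfun cg (cinv cg p.1 * cinv c1 p.2)%g.
pose M2 (p : V * V) := cfun c1 (cinv cg p.1 * cinv cv p.2)%g.
pose F1 (u : V) := cfun cg (cinv cg (cfun cg g) * cinv c1 u)%g.
pose F2 (v : V) := cfun c1 (cinv cg v * cinv cv (cfun cv (g^-1)%g))%g.
have F1d : differentiable F1 e0.
  have pd : differentiable (fun u : V => (cfun cg g, u)) e0.
    by apply: differentiable_pair; [exact: differentiable_cst|exact: ex_diff].
  apply: (@differentiable_comp _ _ _ _ _ M1 e0 pd); apply: d1; rewrite inE/=; split.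
  - by exists g => //; exact: mem_chart_at.
  - by exists 1%g => //; exact: mem_chart_at.
  - by rewrite gE /c1 cinv1 mulg1; exact: mem_chart_at.
have F1e : F1 e0 = cfun cg g by rewrite /F1 gE /c1 cinv1 mulg1.
have F2d : differentiable F2 (F1 e0).
  have pd : differentiable (fun u : V => (u, cfun cv (g^-1)%g)) (F1 e0).
    by apply: differentiable_pair; [exact: ex_diff|exact: differentiable_cst].
  apply: (@differentiable_comp _ _ _ _ _ M2 _ pd); apply: d2; rewrite inE/= F1e; split.
  - by exists g => //; exact: mem_chart_at.
  - by exists (g^-1)%g => //; exact: mem_chart_at.
  - by rewrite gE gVE mulgV; exact: mem_chart_at.
apply: near_eq_differentiable (differentiable_comp F1d F2d).
have : \forall u \near e0, cdom cg (g * cinv c1 u)%g.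
  have cc : (fun u => g * cinv c1 u)%g @ e0 --> (g * 1)%g.
    have ci : cinv c1 @ e0 --> (1%g : G).
      by have := cinv1_continuous; rewrite /prop_for /continuous_at cinv1.
    exact: (cvg_mulg (cvg_cst g) ci).
  apply: cc; rewrite mulg1; apply: open_nbhs_nbhs; split; last exact: mem_chart_at.
  exact: cdom_open (chart_atP _).
by apply: filterS => u ug; rewrite /= /F2 /F1 gE gVE chartK.
Qed.

Lemma conj_gexp g X : (g * gexp X * g^-1)%g = gexp (Ad g X).
Proof. by rewrite (endo_gexp X (conj_lie_endo g)). Qed.

Lemma AdD g X Y : Ad g (X + Y) = Ad g X + Ad g Y.
Proof. exact: dif1D (conj_lie_endo g). Qed.

Lemma AdZ g a X : Ad g (a *: X) = a *: Ad g X.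
Proof. exact: dif1Z (conj_lie_endo g). Qed.

Lemma AdM g h X : Ad (g * h)%g X = Ad g (Ad h X).
Proof.
apply: gexp_inj => t; rewrite -!AdZ -!conj_gexp.
by rewrite invgM !mulgA.
Qed.

Lemma Ad1 X : Ad (1%g : G) X = X.
Proof. by apply: gexp_inj => t; rewrite -!AdZ -!conj_gexp mul1g invg1 mulg1. Qed.

Lemma dif1_Ad tau g X : lie_endo tau ->
  dif1 tau (Ad g X) = Ad (tau g) (dif1 tau X).
Proof.
move=> te; apply: gexp_inj => t.
have L : t *: dif1 tau (Ad g X) = dif1 tau (Ad g (t *: X)) by rewrite AdZ dif1Z.
have L' : t *: Ad (tau g) (dif1 tau X) = Ad (tau g) (dif1 tau (t *: X)).
  by rewrite dif1Z// AdZ.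
rewrite L L' -(endo_gexp _ te) -(conj_gexp (tau g)) -(endo_gexp _ te) -(conj_gexp g).
have [_ tM _] := te; rewrite !tM; congr (_ * _)%g.
by apply: (mulgI (tau g)); rewrite -tM !mulgV; exact: lie_endo1.
Qed.

End LieEndo.

(** * Linear maps of row vectors and their derivatives *)

Section LinearMaps.
Context {R : realType}.

Lemma linear_mulmx n m (f : 'rV[R]_n -> 'rV[R]_m) : linear f ->
  forall x, f x = x *m lin1_mx f.
Proof.
move=> lf; pose F : {linear 'rV[R]_n -> 'rV[R]_m} := HB.pack f (GRing.isLinear.Build _ _ _ _ f lf).
by move=> x; rewrite (mul_rV_lin1 F).
Qed.

Lemma linear_bounded n m (f : 'rV[R]_n -> 'rV[R]_m) : linear f ->
  exists2 K : R, 0 < K & forall x, `|f x| <= K * `|x|.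
Proof.
move=> lf; exists (\sum_i `|f 'e_i| + 1) => [|x].
  by rewrite ltr_wpDl// sumr_ge0.
pose F : {linear 'rV[R]_n -> 'rV[R]_m} := HB.pack f (GRing.isLinear.Build _ _ _ _ f lf).
rewrite -[f x]/(F x) [in F x](row_sum_delta x) linear_sum (le_trans (ler_norm_sum _ _ _))//.
rewrite mulrDl mulr_suml ler_wpDr// ?mul1r//; apply: ler_sum => i _.
by rewrite linearZ/= normrZ mulrC ler_wpM2l// mx_coord_le.
Qed.

Lemma linearB0 n m (f : 'rV[R]_n -> 'rV[R]_m) : linear f ->
  forall x y, f (x - y) = f x - f y.
Proof.
move=> lf x y; pose F : {linear 'rV[R]_n -> 'rV[R]_m} := HB.pack f (GRing.isLinear.Build _ _ _ _ f lf).
exact: (linearB F).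
Qed.

Lemma linearZ0 n m (f : 'rV[R]_n -> 'rV[R]_m) : linear f ->
  forall a x, f (a *: x) = a *: f x.
Proof.
move=> lf a x; pose F : {linear 'rV[R]_n -> 'rV[R]_m} := HB.pack f (GRing.isLinear.Build _ _ _ _ f lf).
by rewrite -[LHS]/(F (a *: x)) linearZ.
Qed.

Lemma linear_continuous_rV n m (f : 'rV[R]_n -> 'rV[R]_m) : linear f -> continuous f.
Proof.
move=> lf x; have [K K0 fK] := linear_bounded lf.
by apply: (lipschitz_continuous_at (K := K)) => y; rewrite -linearB0.
Qed.

Lemma is_derive_linear n m (f : 'rV[R]_n -> 'rV[R]_m) (c : R -> 'rV[R]_n) (t : R) X :
  linear f -> is_derive t 1 c X -> is_derive t 1 (f \o c) (f X).
Proof.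
move=> lf [cd <-]; have fc := linear_continuous_rV lf.
have H : (fun h : R => h^-1 *: (((f \o c) \o shift t) (h *: 1) - (f \o c) t)) @ 0^' -->
    f ('D_1 c t).
  apply: (cvg_near_ext _ (continuous_cvg _ (fc _) cd)); apply: nearW => h /=.
  by rewrite (linearZ0 lf) (linearB0 lf).
by split; [apply/cvg_ex; exists (f ('D_1 c t))|exact/cvg_lim].
Qed.

Lemma is_derive_shift0 n (c : R -> 'rV[R]_n) (t : R) X :
  is_derive (0 : R) 1 (fun h => c (h + t)) X -> is_derive t 1 c X.
Proof.
move=> [cd <-].
have E : (fun h : R => h^-1 *: (((fun h => c (h + t)) \o shift 0) (h *: 1) - c (0 + t))) =
   (fun h : R => h^-1 *: ((c \o shift t) (h *: 1) - c t)).
  by apply/funext => h; rewrite /shift/= add0r addr0.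
by split; rewrite /derivable /derive -E.
Qed.

Lemma is_derive_ext n (c c' : R -> 'rV[R]_n) (t : R) X : (forall s, c s = c' s) ->
  is_derive t 1 c X -> is_derive t 1 c' X.
Proof. by move=> /funext ->. Qed.

Lemma is_derive_lincomb n (c c' : R -> 'rV[R]_n) (a t : R) X Y :
  is_derive t 1 c X -> is_derive t 1 c' Y ->
  is_derive t 1 (fun s => a *: c s + c' s) (a *: X + Y).
Proof. by move=> cX c'Y; exact: (is_deriveD (is_deriveZ a cX) c'Y). Qed.

Lemma is_derive_uniq n (c : R -> 'rV[R]_n) (t : R) X Y :
  is_derive t 1 c X -> is_derive t 1 c Y -> X = Y.
Proof. by move=> [_ <-] [_ <-]. Qed.

Lemma differentiable_scale (V : normedModType R) m (k : V -> R) (f : V -> 'rV[R]_m) x :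
  differentiable k x -> differentiable f x -> differentiable (fun u => k u *: f u) x.
Proof.
move=> kd fd.
have -> : (fun u => k u *: f u) = \sum_(j < m) (fun u => (k u * f u 0 j) *: ('e_j : 'rV[R]_m)).
  apply/funext => u; rewrite fct_sumE [in LHS](row_sum_delta (f u)) scaler_sumr.
  by apply: eq_bigr => j _; rewrite scalerA.
apply: differentiable_sum => j; apply: differentiableZl.
apply: (differentiableM kd).
exact: (@differentiable_comp _ _ _ _ f (fun y : 'rV[R]_m => y 0 j) _ fd (differentiable_coord _ _ _)).
Qed.

Lemma is_diff_comp_at (V1 V2 V3 : normedModType R) (f df : V1 -> V2) (g dg : V2 -> V3) x y :
  f x = y -> is_diff x f df -> is_diff y g dg -> is_diff x (g \o f) (dg \o df).
Proof. by move=> <- fd gd; exact: is_diff_comp. Qed.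

End LinearMaps.

Local Opaque gexp.

(** * The bracket as the derivative of the adjoint representation *)

Section Bracket.
Context {R : realType} {n : nat} {G : lieGroupType R n}.
Local Notation V := 'rV[R]_n.
Local Notation U := (cdom (chart_at (1%g : G))).
Local Notation gexp := (@gexp R n G).
Local Notation e0 := (cfun (chart_at (1%g : G)) 1%g).
Local Notation cf := (cfun (chart_at (1%g : G))).
Local Notation ci := (cinv (chart_at (1%g : G))).
Local Notation cmul := (@cmul R n G).
Implicit Types (X Y Z : V) (g : G).

Definition cinvg (u : V) : V := cf (ci u)^-1%g.

Lemma cinvg_e0 : cinvg e0 = e0.
Proof. by rewrite /cinvg cinv1 invg1. Qed.

Lemma cinvg_differentiable : differentiable cinvg e0.
Proof.
have [_ /(_ 1%g 1%g 1%N)[d _]] := @lie_invg_smooth _ _ G.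
apply: d; rewrite inE; exists 1%g => //; split; rewrite /= ?invg1; exact: dom1.
Qed.

Lemma ci_dom : \forall u \near e0, U (ci u).
Proof.
have := @cinv1_continuous _ _ G; rewrite /prop_for /continuous_at cinv1; apply.
exact: near_dom (@dom1 _ _ G).
Qed.

Lemma pair_e0_cvg : (fun u : V => (u, e0)) @ e0 --> ((e0, e0) : V * V).
Proof.
by apply: differentiable_continuous; apply: differentiable_pair;
  [exact: ex_diff|exact: differentiable_cst].
Qed.

Lemma pair_cinvg_differentiable : differentiable (fun u : V => (u, cinvg u)) e0.
Proof. by apply: differentiable_pair; [exact: ex_diff|exact: cinvg_differentiable]. Qed.

Lemma pair_cinvg_cvg : (fun u : V => (u, cinvg u)) @ e0 --> ((e0, e0) : V * V).
Proof.
by have := differentiable_continuous pair_cinvg_differentiable;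
  rewrite /prop_for /continuous_at cinvg_e0.
Qed.

(** Chain rule for left multiplication by [ci u] followed by right multiplication by its inverse.
    Only first derivatives of [cmul] occur, so one more derivative in [u] is available. *)
Lemma Ad_near Y : \forall u \near e0,
  Ad (ci u) Y = 'd cmul ((u, cinvg u) : V * V) ('D_(0, Y) cmul (u, e0), 0).
Proof.
have d1 : \forall u \near e0, differentiable cmul ((u, e0) : V * V).
  exact: (pair_e0_cvg (@cmul_differentiable R n G)).
have d2 : \forall u \near e0, differentiable cmul ((u, cinvg u) : V * V).
  exact: (pair_cinvg_cvg (@cmul_differentiable R n G)).
have iU : \forall u \near e0, U (ci u)^-1%g.
  have ic : (fun u => (ci u)^-1)%g @ e0 --> (1%g : G).
    have cc : ci @ e0 --> (1%g : G).
      by have := @cinv1_continuous _ _ G; rewrite /prop_for /continuous_at cinv1.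
    have ic0 : (fun u => (ci u)^-1)%g @ e0 --> ((1 : G)^-1)%g by exact: (cvg_invg cc).
    by rewrite invg1 in ic0.
  exact: (ic _ (near_dom (@dom1 _ _ G))).
apply: filterS (filterI d1 (filterI d2 (filterI iU (filterI ci_dom (@cinv_near _ _ G))))).
move=> u [ud1 [ud2 [iuU [uU cu]]]].
pose p1 (h : V) := (u, h); pose p2 (v : V) := (v, cinvg u).
have p1d : is_diff e0 p1 (fun h : V => (0 : V, h)).
  exact: is_diff_pair (is_diff_cst u e0) (is_diff_id e0).
have p2d : is_diff u p2 (fun h : V => (h, 0 : V)).
  exact: is_diff_pair (is_diff_id u) (is_diff_cst (cinvg u) u).
pose F1 := cmul \o p1; pose F2 := cmul \o p2.
have F1d : is_diff e0 F1 (fun h => 'd cmul ((u, e0) : V * V) (0, h)).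
  exact: (is_diff_comp_at (erefl ((u, e0) : V * V)) p1d (differentiableP ud1)).
have F2d : is_diff u F2 (fun h => 'd cmul ((u, cinvg u) : V * V) (h, 0)).
  exact: (is_diff_comp_at (erefl ((u, cinvg u) : V * V)) p2d (differentiableP ud2)).
have ue : F1 e0 = u by rewrite /F1 /p1 /cmul/= cinv1 mulg1.
have Fd := is_diff_comp_at ue F1d F2d.
have -> : Ad (ci u) Y = 'D_Y (F2 \o F1) e0.
  apply: near_eq_derive.
  have : \forall h \near e0, U (ci u * ci h)%g.
    have cc : ci @ e0 --> (1%g : G).
      by have := @cinv1_continuous _ _ G; rewrite /prop_for /continuous_at cinv1.
    have cc2 : (fun h => ci u * ci h)%g @ e0 --> (ci u * 1)%g.
      exact: (cvg_mulg (cvg_cst (ci u)) cc).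
    by apply: cc2; rewrite mulg1; exact: near_dom.
  by apply: filterS => h hU; rewrite /= /F2 /F1 /p2 /p1 /cmul/= /cinvg !chartK.
rewrite deriveE; last by have [] := Fd.
by rewrite diff_val/= (deriveE _ ud1).
Qed.

Lemma Ad_chart_differentiable Y : differentiable (fun u => Ad (ci u) Y) e0.
Proof.
(* The differential applied to the moving vector [W u] is expanded on the standard basis: its terms
   are scalar functions times derivatives of [cmul] in fixed directions, each of which is
   differentiable. *)
pose W (u : V) : V := 'D_(0, Y) cmul (u, e0).
pose Q (i : 'I_n) (u : V) : V := 'D_('e_i, 0) cmul (u, cinvg u).
have Wd : differentiable W e0.
  apply: (@differentiable_comp _ _ _ _ (fun u : V => (u, e0)) ('D_(0, Y) cmul)).
    by apply: differentiable_pair; [exact: ex_diff|exact: differentiable_cst].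
  exact: (nbhs_singleton (@cmul_derive_differentiable _ _ G _)).
have Qd i : differentiable (Q i) e0.
  apply: (@differentiable_comp _ _ _ _ (fun u : V => (u, cinvg u)) ('D_('e_i, 0) cmul)).
    exact: pair_cinvg_differentiable.
  rewrite cinvg_e0.
  exact: (nbhs_singleton (@cmul_derive_differentiable _ _ G _)).
have sd : differentiable (\sum_(i < n) (fun u => W u 0 i *: Q i u)) e0.
  apply: differentiable_sum => i; apply: differentiable_scale (Qd i).
  exact: (@differentiable_comp _ _ _ _ W (fun y : V => y 0 i) _ Wd (differentiable_coord _ _ _)).
apply: near_eq_differentiable sd.
have d2 : \forall u \near e0, differentiable cmul ((u, cinvg u) : V * V).
  exact: (pair_cinvg_cvg (@cmul_differentiable R n G)).
near=> u.
have ud2 : differentiable cmul ((u, cinvg u) : V * V) by near: u.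
have -> : Ad (ci u) Y = 'd cmul ((u, cinvg u) : V * V) (W u, 0) by near: u; exact: Ad_near.
rewrite fct_sumE.
have -> : (W u, 0) = \sum_i (W u 0 i *: ('e_i, 0)) :> V * V.
  rewrite [in LHS](row_sum_delta (W u)).
  elim/big_rec2 : _ => // i y1 y2 _ <-.
  by congr (_, _); rewrite /= scaler0 addr0.
by rewrite linear_sum; apply: eq_bigr => i _; rewrite linearZ/= /Q deriveE.
Unshelve. all: by end_near. Qed.

Local Opaque Ad dif1.

Lemma Ad_curve X Y : is_derive (0 : R) 1 (fun t : R => Ad (gexp (t *: X)) Y) (ad G X Y).
Proof.
pose A u := Ad (ci u) Y.
have Ad' : differentiable A e0 := Ad_chart_differentiable Y.
have [gc _ [gd gX]] := @gexp_one_param _ _ G X.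
pose c : R -> V := cf \o (fun t : R => gexp (t *: X)).
have c0 : c 0 = e0 by rewrite /c/= scale0r gexp0.
have cd : differentiable c 0 by apply/derivable1_diffP.
have Acd := is_diff_comp_at c0 (differentiableP cd) (differentiableP Ad').
have H : is_derive (0 : R) 1 (A \o c) (ad G X Y).
  have Acd' : differentiable (A \o c) 0 by have [] := Acd.
  split; first exact: diff_derivable.
  rewrite (deriveE _ Acd') (@diff_val _ _ _ _ _ _ _ Acd) -[RHS]/('D_X A e0).
  by rewrite (deriveE X Ad') -[in RHS]gX (deriveE _ cd).
apply: (near_eq_is_derive _ H).
have g0 : (fun t : R => gexp (t *: X)) @ (0 : R) --> (1%g : G).
  by have := gc 0; rewrite /continuous_at scale0r gexp0.
have : \forall t \near (0 : R), U (gexp (t *: X)) by exact: (g0 _ (near_dom (@dom1 _ _ G))).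
by apply: filterS => t tU; rewrite /= /A /c/= chartK.
Qed.

Lemma Ad_linear g : linear (Ad g : V -> V).
Proof. by move=> a X Y; rewrite AdD AdZ. Qed.

Lemma ad_linear_l Y : linear (ad G ^~ Y).
Proof.
have Ad' : differentiable (fun u => Ad (ci u) Y) e0 := Ad_chart_differentiable Y.
by move=> a X Z; rewrite /ad !deriveE// linearP.
Qed.

Local Opaque ad.

Lemma ad_linear_r X : linear (ad G X).
Proof.
move=> a Y Z.
have d1 := is_derive_lincomb a (Ad_curve X Y) (Ad_curve X Z).
apply: is_derive_uniq (is_derive_ext _ (Ad_curve X (a *: Y + Z))) d1 => t.
by rewrite AdD AdZ.
Qed.

Lemma dif1_linear (tau : G -> G) : lie_endo tau -> linear (dif1 tau : V -> V).
Proof. by move=> te a X Y; rewrite dif1D// dif1Z. Qed.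

Lemma dif1_ad (tau : G -> G) X Y : lie_endo tau ->
  dif1 tau (ad G X Y) = ad G (dif1 tau X) (dif1 tau Y).
Proof.
move=> te; have d1 := is_derive_linear (dif1_linear te) (Ad_curve X Y).
apply: is_derive_uniq (is_derive_ext _ d1) (Ad_curve (dif1 tau X) (dif1 tau Y)) => t.
have E : tau (gexp (t *: X)) = gexp (t *: dif1 tau X).
  exact: etrans (endo_gexp _ te) (congr1 gexp (dif1Z t X te)).
exact: etrans (dif1_Ad (gexp (t *: X)) Y te) (congr1 (fun g => Ad g (dif1 tau Y)) E).
Qed.

Lemma Ad_ad g X Y : Ad g (ad G X Y) = ad G (Ad g X) (Ad g Y).
Proof. exact: (dif1_ad X Y (conj_lie_endo g)). Qed.

Lemma Ad_curve_at X Y (t : R) :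
  is_derive t 1 (fun t : R => Ad (gexp (t *: X)) Y) (Ad (gexp (t *: X)) (ad G X Y)).
Proof.
apply: is_derive_shift0.
have d1 := is_derive_linear (Ad_linear (gexp (t *: X))) (Ad_curve X Y).
apply: (is_derive_ext _ d1) => h.
by rewrite [LHS]/= addrC gexpD AdM.
Qed.

(** The curve [Ad (gexp (s X)) Y] solves [c' = l c], so its product with [expR (- (l * s))] has zero
    derivative. *)
Lemma Ad_weight X Y (l : R) : ad G X Y = l *: Y ->
  forall t : R, Ad (gexp (t *: X)) Y = expR (l * t) *: Y.
Proof.
move=> XY t; apply/rowP => j; rewrite mxE.
pose f (s : R) := expR (- (l * s)) * Ad (gexp (s *: X)) Y 0 j.
have fd (s : R) : is_derive s (1 : R) f 0.
  have [cd cE] := Ad_curve_at X Y s.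
  have c1 : is_derive s 1 (fun s : R => Ad (gexp (s *: X)) Y 0 j) (l * Ad (gexp (s *: X)) Y 0 j).
    split; first by move/derivable_mxP : cd => /(_ 0 j).
    transitivity ('D_1 (fun s : R => Ad (gexp (s *: X)) Y) s 0 j).
      by rewrite derive_mx// mxE.
    by rewrite cE XY AdZ mxE.
  have d1 : is_derive s 1 (fun s : R => - (l * s)) (- l).
    by apply: is_derive_eq; rewrite /GRing.scale/= mulr1.
  have d2 := is_derive1_comp (is_derive_expR _) d1.
  have d3 := is_deriveM d2 c1.
  apply: (is_derive_eq d3); rewrite /GRing.scale/=; ring.
have : f t = f 0 by exact: is_derive_0_is_cst.
rewrite /f mulr0 oppr0 expR0 mul1r scale0r gexp0 Ad1 => <-.
by rewrite mulrA -expRD subrr expR0 mul1r.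
Qed.

Lemma ad0_commute X Y : ad G X Y = 0 -> (gexp X * gexp Y = gexp Y * gexp X)%g.
Proof.
move=> XY; have /Ad_weight/(_ 1) : ad G X Y = 0 *: Y by rewrite XY scale0r.
rewrite mul0r expR0 !scale1r => XY1; apply: (mulIg (gexp X)^-1%g).
by rewrite conj_gexp XY1 mulgK.
Qed.

(** This takes the place of the Jacobi identity: exponentials of commuting vectors commute, hence so
    do their adjoint actions, and this is differentiated at [0] in each of the two parameters. *)
Lemma ad_commute X Y Z : ad G X Y = 0 ->
  ad G X (ad G Y Z) = ad G Y (ad G X Z).
Proof.
move=> XY.
have E1 (s t : R) : Ad (gexp (s *: X)) (Ad (gexp (t *: Y)) Z) = Ad (gexp (t *: Y)) (Ad (gexp (s *: X)) Z).
  have C : ad G (s *: X) (t *: Y) = 0.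
    apply: etrans (linearZ0 (ad_linear_l (t *: Y)) s X) _.
    have C1 := linearZ0 (ad_linear_r X) t Y.
    apply: etrans (congr1 (fun z => s *: z) C1) _.
    by rewrite XY !scaler0.
  have C2 := ad0_commute C.
  have E3 := AdM (gexp (s *: X)) (gexp (t *: Y)) Z.
  have E4 := AdM (gexp (t *: Y)) (gexp (s *: X)) Z.
  rewrite C2 in E3.
  exact: etrans (esym E3) E4.
have E2 (s : R) : Ad (gexp (s *: X)) (ad G Y Z) = ad G Y (Ad (gexp (s *: X)) Z).
  have d1 := is_derive_linear (Ad_linear (gexp (s *: X))) (Ad_curve Y Z).
  apply: is_derive_uniq (is_derive_ext _ d1) (Ad_curve Y _) => t.
  exact: E1.
have d1 := is_derive_linear (ad_linear_r Y) (Ad_curve X Z).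
apply: is_derive_uniq (Ad_curve X _) (is_derive_ext _ d1) => t.
by rewrite [LHS]/= E2.
Qed.

End Bracket.

(** * Weight vectors *)

Section RealSpectrum.

(** Take a complex root [a + i b]. If [b] is nonzero, the remainder modulo [(X - a)^2 + b^2] is some
    [c X + d] with real coefficients that vanishes at [a + i b], so that [c = d = 0]. *)
Lemma real_poly_factor (R : rcfType) (p : {poly R}) : (1 < size p)%N ->
  (exists r, root p r) \/
  (exists a b : R, b != 0 /\ (('X - a%:P) ^+ 2 + (b ^+ 2)%:P) %| p).
Proof.
move=> p1; pose f := real_complex R; pose q := map_poly f p.
have /closed_rootP[[a b] zr] : size q != 1 by rewrite size_map_poly; case: (size p) p1 => [|[|]].
have [b0|b0] := eqVneq b 0.
  left; exists a; move: zr; rewrite b0 -[complex.Complex a 0]/(f a) /root horner_map.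
  by rewrite fmorph_eq0.
right; exists a, b; split => //.
set Q := _ + _.
have Qs : size Q = 3%N.
  by rewrite /Q size_polyDl size_exp_XsubC// (leq_ltn_trans (size_polyC_leq1 _))//.
rewrite /dvdp; set m := p %% Q.
have ms : (size m <= 2)%N.
  by rewrite -ltnS -Qs ltn_modp -size_poly_gt0 Qs.
have [c [d mE]] : exists c d : R, m = c *: 'X + d%:P.
  exists m`_1, m`_0; apply/polyP => i; rewrite coefD coefZ coefX coefC.
  case: i => [|[|i]]; rewrite ?mulr1 ?mulr0 ?add0r ?addr0//=.
  by rewrite nth_default// (leq_trans ms).
have Qz : (map_poly f Q).[complex.Complex a b] = 0.
  rewrite /Q rmorphD rmorphXn rmorphB/= map_polyX !map_polyC/= !hornerE/= /f.
  by rewrite /real_complex_def expr2; simpc; rewrite expr2 addNr.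
have mz : (map_poly f m).[complex.Complex a b] = 0.
  move: zr; rewrite /q (divp_eq p Q) rmorphD rmorphM/= rootE hornerD hornerM Qz mulr0 add0r.
  by move/eqP.
move: mz; rewrite mE rmorphD/= map_polyC/= map_polyZ/= map_polyX hornerD hornerZ hornerX hornerC /f.
rewrite /real_complex_def; simpc => /eqP; rewrite eq_complex/=.
move=> /andP[/eqP cd]; rewrite mulf_eq0 (negbTE b0) orbF => /eqP c0.
by move: cd; rewrite c0 mul0r add0r => ->; rewrite scale0r add0r.
Qed.

Section SelfAdjoint.
Context {R : rcfType} {n : nat}.
Variables (bf : 'rV[R]_n.+1 -> 'rV[R]_n.+1 -> R) (A : 'M[R]_n.+1).
Hypothesis bl : forall z a x y, bf (a *: x + y) z = a * bf x z + bf y z.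
Hypothesis bC : forall x y, bf x y = bf y x.
Hypothesis bpos : forall x, x != 0 -> 0 < bf x x.
Hypothesis bA : forall x y, bf (x *m A) y = bf x (y *m A).

Let bD x y z : bf (x + y) z = bf x z + bf y z.
Proof. by have := bl z 1 x y; rewrite scale1r mul1r. Qed.

Let b0 z : bf 0 z = 0.
Proof. by apply: (addrI (bf 0 z)); rewrite -bD !addr0. Qed.

Let bZ a x z : bf (a *: x) z = a * bf x z.
Proof. by have := bl z a x 0; rewrite !addr0 b0 addr0. Qed.

Let bge0 x : 0 <= bf x x.
Proof. by have [->|/bpos/ltW//] := eqVneq x 0; rewrite b0. Qed.

Let beq0 x : bf x x = 0 -> x = 0.
Proof. by move=> h; apply/eqP; apply: contraTT (lexx (0 : R)) => /bpos; rewrite h -ltNge. Qed.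

Let badj r x y : bf (x *m (A - r%:M)) y = bf x (y *m (A - r%:M)).
Proof.
rewrite !mulmxBr !mul_mx_scalar bD (bC x) bD -scaleNr -[- (r *: y)]scaleNr !bZ bA.
by rewrite (bC (y *m A)) (bC y).
Qed.

Let sq0 r (x : 'rV[R]_n.+1) : x *m (A - r%:M) *m (A - r%:M) = 0 -> x *m (A - r%:M) = 0.
Proof. by move=> h; apply: beq0; rewrite -badj h b0. Qed.

Let quad0 a b (x : 'rV[R]_n.+1) : b != 0 ->
  x *m (A - a%:M) *m (A - a%:M) + b ^+ 2 *: x = 0 -> x = 0.
Proof.
move=> bn0 h; apply: beq0; apply/eqP.
have := b0 x; rewrite -h bD bZ badj => /eqP.
rewrite paddr_eq0//; first by move=> /andP[_]; rewrite mulf_eq0 sqrf_eq0 (negbTE bn0).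
by rewrite mulr_ge0// sqr_ge0.
Qed.

(** One irreducible factor is stripped at a time: a quadratic one acts injectively by [quad0], and a
    linear one that is already present is redundant by [sq0]. The claim bears on single vectors so
    that it can be applied to [x *m (A - r%:M)]. *)
Lemma self_adjoint_split (p : {poly R}) : p != 0 ->
  exists2 rs : seq R, uniq rs & forall x : 'rV[R]_n.+1, x *m horner_mx A p = 0 ->
    x *m horner_mx A (\prod_(r <- rs) ('X - r%:P)) = 0.
Proof.
have [k] := ubnP (size p); elim: k p => // k ih p; rewrite ltnS => pk p0.
have [p1|p1] := leqP (size p) 1.
  exists [::] => // x; rewrite big_nil rmorph1 mulmx1 (size1_polyC p1) horner_mx_C.
  rewrite mul_mx_scalar => /eqP; rewrite scaler_eq0 => /orP[|/eqP//].
  by move=> /eqP c0; move: p0; rewrite (size1_polyC p1) c0 eqxx.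
have XaE a : horner_mx A ('X - a%:P) = A - a%:M.
  by rewrite rmorphB/= horner_mx_X horner_mx_C.
have hM p1' q1' : horner_mx A (p1' * q1') = horner_mx A p1' *m horner_mx A q1' by rewrite rmorphM.
have smaller (q d : {poly R}) : p = q * d -> (1 < size d)%N -> (size q < k)%N /\ q != 0.
  move=> pE d1; have [q0 d0] : q != 0 /\ d != 0.
    by move: p0; rewrite pE mulf_eq0 negb_or => /andP[].
  split=> //; rewrite (leq_trans _ pk)// pE size_mul// -subn1 -addnBA ?(ltnW d1)//.
  by rewrite -{1}[size q]addn0 ltn_add2l subn_gt0.
have [[r /factor_theorem[q pE]]|[a [b [bn0 /dvdpP[q pE]]]]] := real_poly_factor p1.
  have [|qk q0] := smaller _ _ pE; first by rewrite size_XsubC.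
  have [rs urs rsP] := ih q qk q0.
  have xP (x : 'rV[R]_n.+1) : x *m horner_mx A p = 0 ->
      x *m (A - r%:M) *m horner_mx A (\prod_(r <- rs) ('X - r%:P)) = 0.
    by move=> h; apply: (rsP (x *m (A - r%:M)));rewrite -mulmxA -XaE -hM mulrC -pE.
  have [rrs|rrs] := boolP (r \in rs); last first.
    exists (r :: rs); rewrite /= ?rrs// => x /xP.
    by rewrite big_cons hM XaE mulmxA.
  exists rs => // x /xP.
  rewrite (big_rem r)//= -mulmxA -XaE -hM => h.
  pose u := x *m horner_mx A (\prod_(i <- rem r rs) ('X - i%:P)).
  have uE : u *m (A - r%:M) = x *m horner_mx A (('X - r%:P) * \prod_(i <- rem r rs) ('X - i%:P)).
    by rewrite /u -mulmxA -XaE -hM mulrC.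
  rewrite -uE; apply: sq0; rewrite uE -mulmxA -XaE -hM mulrC//.
have dE : horner_mx A (('X - a%:P) ^+ 2 + (b ^+ 2)%:P) = (A - a%:M) *m (A - a%:M) + (b ^+ 2)%:M.
  by rewrite rmorphD rmorphXn/= XaE horner_mx_C expr2.
have [|qk q0] := smaller _ _ pE.
  rewrite size_polyDl size_exp_XsubC// (leq_ltn_trans (size_polyC_leq1 _))//.
have [rs urs rsP] := ih q qk q0; exists rs => // x; rewrite pE hM mulmxA dE => h.
apply: rsP; apply: (quad0 bn0 (a := a)).
by rewrite -h mulmxDr mulmxA mul_mx_scalar.
Qed.

Lemma self_adjoint_diagonalizable : diagonalizable A.
Proof.
have p0 : char_poly A != 0 by rewrite monic_neq0// char_poly_monic.
have [rs urs rsP] := self_adjoint_split p0.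
apply/diagonalizableP; exists rs => //; apply: mxminpoly_min.
apply/row_matrixP => i; rewrite row0 rowE; apply: rsP.
by rewrite (Cayley_Hamilton A) mulmx0.
Qed.

End SelfAdjoint.

End RealSpectrum.

(** Size zero is treated apart, because polynomials are evaluated at matrices of positive size. *)
Lemma self_adjoint_diagonalizable0 (R : rcfType) n (bf : 'rV[R]_n -> 'rV[R]_n -> R) (A : 'M[R]_n) :
  (forall z a x y, bf (a *: x + y) z = a * bf x z + bf y z) ->
  (forall x y, bf x y = bf y x) -> (forall x, x != 0 -> 0 < bf x x) ->
  (forall x y, bf (x *m A) y = bf x (y *m A)) -> diagonalizable A.
Proof.
case: n bf A => [|n] bf A bl bC bpos bA; last exact: (self_adjoint_diagonalizable bl bC bpos bA).
by exists 1%:M; rewrite ?unitmx1// /similar_to/=; apply/is_diag_mxP => -[].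
Qed.

Lemma lin1_mx_comp (R : realType) n m p (f : 'rV[R]_m -> 'rV[R]_p) (g : 'rV[R]_n -> 'rV[R]_m) :
  linear f -> linear g -> lin1_mx (f \o g) = lin1_mx g *m lin1_mx f.
Proof.
move=> lf lg; have lfg : linear (f \o g) by move=> a x y; rewrite /= lg lf.
apply/row_matrixP => i; rewrite !rowE -(linear_mulmx lfg) mulmxA.
by rewrite -(linear_mulmx lg) -(linear_mulmx lf).
Qed.

(** * The trace form and its self-adjoint operators *)

Section TraceForm.
Context {R : realType} {n : nat}.
Local Notation V := 'rV[R]_n.
Implicit Types X Y Z : V.

Variables (br : V -> V -> V) (th : V -> V).
Hypotheses (br_linear_l : forall Y, linear (br ^~ Y)) (br_linear_r : forall X, linear (br X)).

Let adm Y : 'M[R]_n := lin1_mx (br Y).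

Let admE Y x : br Y x = x *m adm Y.
Proof. exact: (linear_mulmx (br_linear_r Y)). Qed.

Let adm_lin c X Y : adm (c *: X + Y) = c *: adm X + adm Y.
Proof.
apply/row_matrixP => i; rewrite !rowE mulmxDr -scalemxAr -!admE.
exact: (br_linear_l (delta_mx 0 i) c X Y).
Qed.

Let adm_conj (f f' : V -> V) Y : linear f -> linear f' ->
  (forall X Z, f (br X Z) = br (f X) (f Z)) -> (forall x, f (f' x) = x) ->
  adm (f Y) = lin1_mx f' *m adm Y *m lin1_mx f.
Proof.
move=> lf lf' fbr ff'; apply/row_matrixP => i; rewrite !rowE -admE !mulmxA.
by rewrite -(linear_mulmx lf') -admE -(linear_mulmx lf) fbr ff'.
Qed.

Definition trace_form Y Z : R := - \tr (lin1_mx (br Y \o br (th Z))).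

Let trace_formE Y Z : trace_form Y Z = - \tr (adm (th Z) *m adm Y).
Proof. by rewrite /trace_form lin1_mx_comp. Qed.

Lemma trace_form_linear Z c X Y :
  trace_form (c *: X + Y) Z = c * trace_form X Z + trace_form Y Z.
Proof.
by rewrite !trace_formE adm_lin mulmxDr -scalemxAr mxtraceD mxtraceZ opprD mulrN.
Qed.

Hypotheses (th_linear : linear th) (thK : involutive th).
Hypothesis th_br : forall X Y, th (br X Y) = br (th X) (th Y).

(** The operator [br (th Y)] is the conjugate of [br Y] by the involution [th], and the trace is
    cyclic. *)
Lemma trace_form_sym Y Z : trace_form Y Z = trace_form Z Y.
Proof.
rewrite !trace_formE; congr (- _).
rewrite !(adm_conj _ th_linear th_linear th_br thK).
by rewrite [LHS]mxtrace_mulC -!mulmxA [RHS]mxtrace_mulC -!mulmxA.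
Qed.

(** Meant for [f = Ad a] with [theta a = a^-1]: then [th] intertwines [f] with its inverse, and both
    sides are the same trace up to a cyclic permutation. *)
Lemma trace_form_adjoint (f f' : V -> V) Y Z : linear f -> linear f' ->
  (forall X W, f (br X W) = br (f X) (f W)) ->
  (forall X W, f' (br X W) = br (f' X) (f' W)) ->
  (forall x, f (f' x) = x) -> (forall x, f' (f x) = x) ->
  (forall x, th (f x) = f' (th x)) ->
  trace_form (f Y) Z = trace_form Y (f Z).
Proof.
move=> lf lf' fbr f'br ff' f'f tf; rewrite !trace_formE; congr (- _).
rewrite tf (adm_conj _ lf lf' fbr ff') (adm_conj _ lf' lf f'br f'f).
by rewrite !mulmxA [LHS]mxtrace_mulC !mulmxA.
Qed.

Lemma trace_form_derive (A : R -> V -> V) X Y Z :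
  (forall W, is_derive (0 : R) 1 (fun t => A t W) (br X W)) ->
  (forall t, trace_form (A t Y) Z = trace_form Y (A t Z)) ->
  trace_form (br X Y) Z = trace_form Y (br X Z).
Proof.
move=> dA tA.
(* Scalars are placed in row vectors of length one so that the derivative of a linear map along a
   curve applies. *)
pose f (x : V) : 'rV[R]_1 := \row_(j < 1) trace_form x Z.
pose h (x : V) : 'rV[R]_1 := \row_(j < 1) trace_form Y x.
have lf : linear f by move=> c x y; apply/rowP => j; rewrite !mxE trace_form_linear.
have lh : linear h.
  by move=> c x y; apply/rowP => j; rewrite !mxE !(trace_form_sym Y) trace_form_linear.
have : f (br X Y) = h (br X Z).
  apply: is_derive_uniq (is_derive_ext _ (is_derive_linear lf (dA Y))) (is_derive_linear lh (dA Z)).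
  by move=> t; apply/rowP => j; rewrite /= !mxE tA.
by move=> /rowP/(_ 0); rewrite !mxE.
Qed.

Lemma codiagonal_basis (bf : V -> V -> R) (fa : {vspace V}) :
  (forall z a x y, bf (a *: x + y) z = a * bf x z + bf y z) ->
  (forall x y, bf x y = bf y x) -> (forall x, x != 0 -> 0 < bf x x) ->
  (forall X, X \in fa -> forall Y Z, bf (br X Y) Z = bf Y (br X Z)) ->
  (forall X Y, X \in fa -> Y \in fa -> forall Z, br X (br Y Z) = br Y (br X Z)) ->
  exists2 P : 'M[R]_n, P \in unitmx &
    forall i, exists beta : 'Hom(subvs_of fa, R^o),
      forall X : subvs_of fa, br (vsval X) (row i P) = (beta X : R) *: row i P.
Proof.
move=> bl bC bpos bA fac; pose As := [seq adm X | X <- vbasis fa].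
have [] : codiagonalizable As.
  apply/codiagonalizableP; split => [_ _ /mapP[X Xfa ->] /mapP[Y Yfa ->]|_ /mapP[X Xfa ->]].
    rewrite /comm_mx; apply/row_matrixP => i; rewrite !rowE !mulmxA -!admE.
    by apply/esym/fac; exact: vbasis_mem.
  apply: (self_adjoint_diagonalizable0 bl bC bpos) => x y.
  by rewrite -!admE bA//; exact: vbasis_mem.
move=> P Pu /allP PA; exists P => // i.
have dP (j : 'I_(\dim fa)) : exists d : R, br (vbasis fa)`_j (row i P) = d *: row i P.
  have /PA/similar_diagPex[D /(similarP Pu) PD] : adm (vbasis fa)`_j \in As.
    by apply/mapP; exists (vbasis fa)`_j => //; rewrite mem_nth// size_tuple.
  exists (D 0 i); rewrite admE rowE -mulmxA PD mulmxA.
  by rewrite -[_ *m diag_mx D]rowE row_diag_mx -scalemxAl.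
have [d dE] := choice dP.
(* The eigenvalues for the members of [vbasis fa] are extended linearly; this is the weight of the
   [i]-th common eigenvector. *)
pose b (X : subvs_of fa) : R^o := \sum_j coord (vbasis fa) j (vsval X) * d j.
have bL : linear b.
  move=> c X Y; rewrite /b scaler_sumr -big_split; apply: eq_bigr => j _.
  have cl : coord (vbasis fa) j (vsval (c *: X + Y)) =
      c * coord (vbasis fa) j (vsval X) + coord (vbasis fa) j (vsval Y).
    by exact: linearP.
  by rewrite cl mulrDl -mulrA.
pose bF : {linear subvs_of fa -> R^o} := HB.pack b (GRing.isLinear.Build _ _ _ _ b bL).
exists (linfun bF) => X; rewrite lfunE/= /b scaler_suml.
pose aL : {linear V -> V} := HB.pack (br ^~ (row i P))
   (GRing.isLinear.Build _ _ _ _ _ (br_linear_l (row i P))).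
rewrite -[LHS]/(aL (vsval X)) [in LHS](coord_vbasis (subvsP X)) linear_sum.
apply: eq_bigr => j _; rewrite linearZ/= dE.
by rewrite scalerA.
Qed.

End TraceForm.

Section WeightBasis.
Context {R : realType} {n : nat} {G : lieGroupType R n}.
Local Notation V := 'rV[R]_n.
Local Notation gexp := (@gexp R n G).
Implicit Types (X Y Z : V) (a g : G).

Variable theta : G -> G.
Hypothesis te : lie_endo theta.
Hypothesis thetaK : involutive theta.

Lemma dif1K : involutive (dif1 theta : V -> V).
Proof.
move=> X; apply: gexp_inj => t.
have E : t *: dif1 theta (dif1 theta X) = dif1 theta (dif1 theta (t *: X)).
  apply: etrans (congr1 (dif1 theta) (esym (dif1Z t X te))).
  exact: (esym (dif1Z t (dif1 theta X) te)).
apply: etrans (congr1 gexp E) _; apply: etrans (esym (endo_gexp _ te)) _.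
by apply: etrans (congr1 theta (esym (endo_gexp _ te))) _; exact: thetaK.
Qed.

Lemma theta_gexp X (t : R) : dif1 theta X = - X ->
  theta (gexp (t *: X)) = (gexp (t *: X))^-1%g.
Proof.
move=> tX; apply: etrans (endo_gexp (t *: X) te) _.
apply: etrans (congr1 gexp (dif1Z t X te)) _.
by rewrite tX scalerN; exact: gexpN.
Qed.

Lemma Bform_sym Y Z : Bform theta Y Z = Bform theta Z Y.
Proof.
exact: (@trace_form_sym R n (ad G) (dif1 theta) (@ad_linear_r _ _ G) (dif1_linear te) dif1K
  (fun X Y => dif1_ad X Y te)).
Qed.

Lemma Bform_linear Z c X Y :
  Bform theta (c *: X + Y) Z = c * Bform theta X Z + Bform theta Y Z.
Proof.
exact: (@trace_form_linear R n (ad G) (dif1 theta) (@ad_linear_l _ _ G) (@ad_linear_r _ _ G)).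
Qed.

Lemma AdVK a : cancel (Ad a : V -> V) (Ad a^-1%g).
Proof.
by move=> x; apply: etrans (esym (AdM _ _ _)) _; rewrite mulVg; exact: Ad1.
Qed.

Lemma AdKV a : cancel (Ad a^-1%g : V -> V) (Ad a).
Proof.
by move=> x; apply: etrans (esym (AdM _ _ _)) _; rewrite mulgV; exact: Ad1.
Qed.

Lemma Bform_Ad a Y Z : theta a = a^-1%g ->
  Bform theta (Ad a Y) Z = Bform theta Y (Ad a Z).
Proof.
move=> ta.
apply: (@trace_form_adjoint R n (ad G) (dif1 theta) (@ad_linear_r _ _ G) (Ad a) (Ad a^-1%g)).
- exact: Ad_linear.
- exact: Ad_linear.
- exact: Ad_ad.
- exact: Ad_ad.
- exact: AdKV.
- exact: AdVK.
- by move=> x; apply: etrans (dif1_Ad _ _ te) _; rewrite ta.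
Qed.

Lemma Bform_ad X Y Z : dif1 theta X = - X ->
  Bform theta (ad G X Y) Z = Bform theta Y (ad G X Z).
Proof.
move=> tX.
apply: (@trace_form_derive R n (ad G) (dif1 theta) (@ad_linear_l _ _ G) (@ad_linear_r _ _ G)
  (dif1_linear te) dif1K (fun X Y => dif1_ad X Y te) (fun t => Ad (gexp (t *: X))) X Y Z).
  exact: Ad_curve.
by move=> t; apply: Bform_Ad; exact: theta_gexp.
Qed.

Lemma weight_basis (fa : {vspace V}) :
  (forall X, X != 0 -> 0 < Bform theta X X) ->
  (forall X, X \in fa -> dif1 theta X = - X) ->
  (forall X Y, X \in fa -> Y \in fa -> ad G X Y = 0) ->
  exists2 P : 'M[R]_n, P \in unitmx &
    forall i, exists beta : 'Hom(subvs_of fa, R^o), root_space G beta (row i P).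
Proof.
move=> Bpos tfa afa.
apply: (@codiagonal_basis R n (ad G) (@ad_linear_l _ _ G) (@ad_linear_r _ _ G)
  (Bform theta) fa Bform_linear Bform_sym Bpos).
- by move=> X Xfa Y Z; apply: Bform_ad; exact: tfa.
- by move=> X Y Xfa Yfa Z; apply: ad_commute; exact: afa.
Qed.

End WeightBasis.

(** * Comparison of the metric with coordinates *)

Section NormEquivalence.
Context {R : realType} {n : nat}.
Local Notation V := 'rV[R]_n.
Variable bf : V -> V -> R.
Hypothesis bl : forall z a x y, bf (a *: x + y) z = a * bf x z + bf y z.
Hypothesis bC : forall x y, bf x y = bf y x.
Hypothesis bpos : forall x, x != 0 -> 0 < bf x x.

Lemma bilinear_bounded : exists2 K : R, 0 < K & forall x y, `|bf x y| <= K * (`|x| * `|y|).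
Proof.
pose f z (x : V) : 'rV[R]_1 := \row_(j < 1) bf x z.
have lf z : linear (f z) by move=> a x y; apply/rowP => j; rewrite !mxE bl.
pose h (z : V) : V := \row_i bf 'e_i z.
have lh : linear h by move=> a x y; apply/rowP => j; rewrite !mxE !(bC 'e_j) bl.
have [K K0 hK] := linear_bounded lh.
exists (n%:R * K + 1) => [|x y]; first by rewrite ltr_wpDl// mulr_ge0// ltW.
have fE : f y x = \sum_i x 0 i *: f y 'e_i.
  pose F : {linear V -> 'rV[R]_1} := HB.pack (f y) (GRing.isLinear.Build _ _ _ _ _ (lf y)).
  rewrite -[f y x]/(F x) [in LHS](row_sum_delta x) linear_sum.
  by apply: eq_bigr => i _; rewrite linearZ.
have -> : bf x y = f y x 0 0 by rewrite mxE.
rewrite (le_trans (mx_coord_le _ _))// fE (le_trans (ler_norm_sum _ _ _))//.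
rewrite (@le_trans _ _ (\sum_(i < n) `|x| * (K * `|y|)))//.
  apply: ler_sum => i _; rewrite normrZ ler_pM//; first exact: mx_coord_le.
  apply: rV_norm_le => [|j]; first by rewrite mulr_ge0// ltW.
  rewrite mxE (le_trans _ (hK y))//.
  by rewrite (le_trans _ (mx_coord_le _ i))// mxE.
rewrite sumr_const card_ord -[_ *+ n]mulr_natl.
have -> : n%:R * (`|x| * (K * `|y|)) = n%:R * K * (`|x| * `|y|) by ring.
by rewrite mulrDl mul1r lerDl mulr_ge0.
Qed.

Lemma bilinear_diag_continuous : continuous (fun x => bf x x).
Proof.
move=> x; have [K K0 bK] := bilinear_bounded.
have bD u v z : bf (u - v) z = bf u z - bf v z.
  by rewrite addrC -scaleN1r bl mulN1r addrC.
apply: (near_lipschitz_continuous (K := K * (`|x| + (`|x| + 1)))).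
have xr : `|x| < `|x| + 1 by rewrite ltrDl.
apply: filterS (near_norm_lt_bound xr) => y yr.
have -> : bf x x - bf y y = bf (x - y) x + bf (x - y) y.
  by rewrite !bD (bC x y) addrA subrK.
rewrite (le_trans (ler_normD _ _))// (le_trans (lerD (bK _ _) (bK _ _)))//.
rewrite -mulrDr -mulrDr -mulrA (mulrC _ `|x - y|) ler_wpM2l ?(ltW K0)//.
by rewrite ler_wpM2l// lerD2l ltW.
Qed.

(** The form attains a positive minimum on the unit sphere, which is compact, and both sides are
    homogeneous of degree one. *)
Lemma norm_le_sqrt_form : exists2 K : R, 0 < K & forall x, `|x| <= K * Num.sqrt (bf x x).
Proof.
have b00 : bf 0 0 = 0 by have := bl 0 (-1) 0 0; rewrite scaler0 addr0 mulN1r addNr.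
(* The zero space is set aside, its unit sphere being empty. *)
have [[x0 x0n]|nex] := pselect (exists x : V, x != 0); last first.
  exists 1 => // x; have -> : x = 0.
    by apply/eqP/negPn/negP => xn; apply: nex; exists x.
  by rewrite normr0 b00 sqrtr0 mulr0.
pose A : set V := [set x | `|x| = 1].
have A0 : A !=set0.
  exists (`|x0|^-1 *: x0); rewrite /A/= normrZ normfV normr_id mulVf//.
  by rewrite normr_eq0.
have cA : compact A.
  apply: bounded_closed_compact.
    exists 1; split => // M M1 x; rewrite /A/= => ->; exact: ltW.
  have -> : A = (fun x : V => `|x|) @^-1` [set 1] by [].
  by apply: closed_comp; [move=> x _; exact: norm_continuous|exact: closed_eq].
have cq : {within A, continuous (fun x => bf x x)}.
  by apply: continuous_subspaceT; exact: bilinear_diag_continuous.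
have [c cA' cmin] := EVT_min_rV A0 cA cq.
have c1 : `|c| = 1 by move: cA'; rewrite inE.
have cn : c != 0 by rewrite -normr_eq0 c1 oner_eq0.
have m0 : 0 < bf c c by exact: bpos.
exists (Num.sqrt (bf c c))^-1 => [|x]; first by rewrite invr_gt0 sqrtr_gt0.
have [->|xn] := eqVneq x 0; first by rewrite normr0 b00 sqrtr0 mulr0.
have xp : 0 < `|x| by rewrite normr_gt0.
rewrite mulrC ler_pdivlMr ?sqrtr_gt0// mulrC -[leLHS]ger0_norm; last first.
  by rewrite mulr_ge0 ?sqrtr_ge0.
rewrite -sqrtr_sqr ler_sqrt; last by rewrite ltW// bpos.
rewrite exprMn sqr_sqrtr ?(ltW m0)//.
have bZ a u z : bf (a *: u) z = a * bf u z.
  have b0 : bf 0 z = 0 by have := bl z (-1) 0 0; rewrite scaler0 addr0 mulN1r addNr.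
  by have := bl z a u 0; rewrite !addr0 b0 addr0.
have : bf c c <= bf (`|x|^-1 *: x) (`|x|^-1 *: x).
  by apply: cmin; rewrite inE /A/= normrZ normfV normr_id mulVf// gt_eqF.
rewrite bZ bC bZ mulrA -expr2 exprVn mulrC.
by rewrite ler_pdivlMr ?exprn_gt0.
Qed.

End NormEquivalence.

Lemma is_derive_unshift (R : realType) n (c : R -> 'rV[R]_n) (t : R) X :
  is_derive (0 : R) 1 c X -> is_derive t 1 (fun s => c (s - t)) X.
Proof.
move=> cX; apply: is_derive_shift0; apply: (is_derive_ext _ cX) => h.
by rewrite addrK.
Qed.

(** * Upper bound for the distance *)

Section UpperBound.
Context {R : realType} {n : nat} {G : lieGroupType R n}.
Local Notation V := 'rV[R]_n.
Local Notation gexp := (@gexp R n G).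
Local Notation cf := (cfun (chart_at (1%g : G))).
Local Notation ci := (cinv (chart_at (1%g : G))).
Local Notation e0 := (cfun (chart_at (1%g : G)) 1%g).

Definition chart_mul (x y : G) (p : V * V) : V :=
  cfun (chart_at x) (ci p.1 * cinv (chart_at y) p.2)%g.

Lemma chart_mul_C1 (x y h : G) : cdom (chart_at x) h -> cdom (chart_at y) h ->
  differentiable (chart_mul x y) (e0, cfun (chart_at y) h) /\
  forall v, {for (e0, cfun (chart_at y) h), continuous ('D_v (chart_mul x y))}.
Proof.
move=> xh yh; have [fd fc] := @lie_mulg_smooth _ _ G 1%g y x 1%N.
have : (e0, cfun (chart_at y) h) \in [set uv : V * V |
  [/\ (cf @` cdom (chart_at (1%g : G))) uv.1,
      (cfun (chart_at y) @` cdom (chart_at y)) uv.2 &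
       cdom (chart_at x) (ci uv.1 * cinv (chart_at y) uv.2)%g]].
  rewrite inE; split => /=; [exists 1%g => //; exact: dom1|by exists h|].
  by rewrite cinv1 mul1g chartK.
by move=> hS; split; [exact: fd|move=> v; exact: fc].
Qed.

Lemma gexp_shift (X : V) (s t : R) (g : G) :
  (gexp ((s - t) *: X) * (gexp (t *: X) * g) = gexp (s *: X) * g)%g.
Proof.
have := @gexpD _ _ G X (s - t) t; rewrite subrK.
by move: (gexp _) (gexp _) (gexp _) => u v w ->; rewrite mulgA.
Qed.

(** Near [t] the curve is [gexp ((s - t) X) * a] with its first factor close to [1], so its
    derivative is that of multiplication at [(1, a)], wherever [a] lies. The chart [y] used for [a]
    is arbitrary: it can then be kept fixed while [t] moves, to show that the derivative is
    continuous. *)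
Lemma gexp_curve_derive (X : V) (g x y a : G) (t : R) : (gexp (t *: X) * g)%g = a ->
  cdom (chart_at x) a -> cdom (chart_at y) a ->
  is_diff t (cfun (chart_at x) \o (fun t : R => gexp (t *: X) * g)%g)
    (fun h : R => h *: 'D_(X, 0) (chart_mul x y) (e0, cfun (chart_at y) a)).
Proof.
move=> aE xa ya.
have [Md _] := chart_mul_C1 xa ya.
have [gc _ [gd gX]] := @gexp_one_param _ _ G X.
pose c : R -> V := cf \o (fun t : R => gexp (t *: X)).
have cd : is_diff (0 : R) c (fun h : R => h *: X).
  have cd0 : differentiable c 0 by apply/derivable1_diffP.
  split => //; apply/funext => h.
  rewrite -[h in LHS]mulr1 [LHS]linearZ/=; congr (_ *: _).
  by rewrite -gX (deriveE _ cd0).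
have sd : is_diff t (fun s : R => s - t) id.
  have := is_diffB (is_diff_id t) (is_diff_cst t t).
  by rewrite (_ : id - 0 = id)//; apply/funext => u /=; rewrite subr0.
have t0 : t - t = 0 by rewrite subrr.
have sc : is_diff t (fun s => c (s - t)) (fun h => h *: X).
  exact: (is_diff_comp_at (f := fun s : R => s - t) t0 sd cd).
have pd := is_diff_pair sc (is_diff_cst (cfun (chart_at y) a) t).
have pe : (c (t - t), cfun (chart_at y) a) = (e0, cfun (chart_at y) a).
  by rewrite subrr /c/= scale0r gexp0.
have Fd := is_diff_comp_at pe pd (differentiableP Md).
have near_t : \forall s \near t,
    chart_mul x y (c (s - t), cfun (chart_at y) a) = cfun (chart_at x) (gexp (s *: X) * g)%g.
  have g0 : (fun s : R => gexp ((s - t) *: X)) @ t --> (1%g : G).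
    have H : (fun s : R => gexp ((s - t) *: X)) @ t --> gexp ((t - t) *: X).
      apply: cvg_gexp; apply: cvgZr_tmp; apply: cvgB; [exact: cvg_id|exact: cvg_cst].
    by rewrite subrr scale0r gexp0 in H.
  have : \forall s \near t, cdom (chart_at (1%g : G)) (gexp ((s - t) *: X)).
    exact: (g0 _ (near_dom (@dom1 _ _ G))).
  apply: filterS => s sU.
  have e1 : ci (c (s - t)) = gexp ((s - t) *: X) by exact: chartK.
  have e2 : (gexp ((s - t) *: X) * a = gexp (s *: X) * g)%g.
    by rewrite -aE; exact: gexp_shift.
  by apply: (congr1 (cfun (chart_at x))); rewrite -e2; congr (_ * _)%g; exact: chartK.
split.
  by apply: near_eq_differentiable near_t _; have [] := Fd.
have Gd : differentiable (cfun (chart_at x) \o (fun t : R => gexp (t *: X) * g)%g) t.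
  by apply: near_eq_differentiable near_t _; have [] := Fd.
apply/funext => h; rewrite -(deriveE h Gd).
rewrite -(near_eq_derive h near_t) (deriveE h (@ex_diff _ _ _ _ _ _ _ Fd)).
rewrite (@diff_val _ _ _ _ _ _ _ Fd)/= (deriveE _ Md).
have -> : (h *: X, 0) = h *: ((X, 0) : V * V) by congr pair; rewrite scaler0.
by rewrite linearZ.
Qed.

Lemma gexp_curve_C1 (X : V) (g : G) : C1_curve (fun t : R => gexp (t *: X) * g)%g.
Proof.
have gc : continuous (fun t : R => gexp (t *: X) * g)%g.
  move=> t; apply: cvg_mulg; last exact: cvg_cst.
  by apply: cvg_gexp; apply: cvgZr_tmp; exact: cvg_id.
split => // x; split => [t|v t].
  rewrite inE /= => tx.
  by have [] := gexp_curve_derive erefl tx (mem_chart_at (gexp (t *: X) * g)%g).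
move=> /set_mem tx; pose y := (gexp (t *: X) * g)%g.
have yd := mem_chart_at y.
have [_ /(_ (X, 0)) Dc] := chart_mul_C1 tx yd.
have E : \forall s \near t, 
   v *: 'D_(X, 0) (chart_mul x y) (e0, cfun (chart_at y) (gexp (s *: X) * g)%g) =
   'D_v (cfun (chart_at x) \o (fun t : R => gexp (t *: X) * g)%g) s.
  have xs : \forall s \near t, cdom (chart_at x) (gexp (s *: X) * g)%g.
    apply: gc; apply: open_nbhs_nbhs; split => //; exact: cdom_open (chart_atP _).
  have ys : \forall s \near t, cdom (chart_at y) (gexp (s *: X) * g)%g.
    apply: gc; apply: open_nbhs_nbhs; split => //; exact: cdom_open (chart_atP _).
  apply: filterS2 xs ys => s sx sy.
  have sd := gexp_curve_derive erefl sx sy.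
  by rewrite (deriveE v (@ex_diff _ _ _ _ _ _ _ sd)) (@diff_val _ _ _ _ _ _ _ sd).
have cy : (fun s : R => cfun (chart_at y) (gexp (s *: X) * g)%g) @ t --> cfun (chart_at y) y.
  apply: continuous_cvg; last exact: gc.
  by apply: (cfun_continuous (chart_atP _)); rewrite inE.
have cp : (fun s : R => (e0, cfun (chart_at y) (gexp (s *: X) * g)%g)) @ t --> (e0, cfun (chart_at y) y).
  exact: (cvg_pair (cvg_cst e0) cy).
have H := cvgZl_tmp (k := v) (continuous_cvg _ Dc cp).
have Et := nbhs_singleton E.
suff : 'D_v (cfun (chart_at x) \o (fun t : R => gexp (t *: X) * g)%g) s @[s --> t] -->
    'D_v (cfun (chart_at x) \o (fun t : R => gexp (t *: X) * g)%g) t by [].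
rewrite -Et; apply: cvg_near_ext E _; exact: H.
Qed.

Lemma gexp_curve_velocity (X : V) (g : G) (t : R) :
  right_velocity (fun t : R => gexp (t *: X) * g)%g t = X.
Proof.
rewrite /right_velocity derive1E; have [_ _ gX] := @gexp_one_param _ _ G X.
have e s : cf (gexp (s *: X) * g * (gexp (t *: X) * g)^-1)%g = cf (gexp ((s - t) *: X)).
  apply: (congr1 cf); have := @gexpD _ _ G X s (- t); rewrite scaleNr gexpN.
  by move: (gexp _) (gexp _) (gexp _) => u v w ->; rewrite invgM mulgA mulgK.
have := is_derive_unshift t gX; rewrite -(funext e) => H.
exact: (@derive_val _ _ _ _ _ _ _ H).
Qed.

(** The path [gexp (- t X) * gexp X] leads from [gexp X] to [1] with constant right velocity
    [- X]. *)
Lemma rdist_gexp (theta : G -> G) (X : V) :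
  (rdist theta (gexp X) 1%g <= (Num.sqrt (Bform theta (- X) (- X)))%:E)%E.
Proof.
pose gam (t : R) := (gexp (t *: (- X)) * gexp X)%g.
apply: ereal_inf_lbound => /=; exists gam.
  split; last 2 first.
  - by rewrite /gam scale0r gexp0 mul1g.
  - by rewrite /gam scale1r gexpN mulVg.
  exists 1%N, (fun i => i%:R); split => // -[|//] _; split; first exact: ltr01.
  by exists gam => //; exact: gexp_curve_C1.
rewrite /curve_length; under eq_integral do rewrite gexp_curve_velocity.
rewrite integral_cst//= lebesgue_measure_itv/= lte_fin ltr01 -EFinD subr0.
by rewrite -EFinM mulr1.
Qed.

End UpperBound.

(** No measurability is asked: the integral of a nonnegative function is a supremum over the simple
    functions below it. The speed of an arbitrary piecewise C1 curve can thus be compared with a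
    minorant. *)
Lemma ge0_le_lower_integral d (T : measurableType d) (R : realType)
    (mu : {measure set T -> \bar R}) (D : set T) (g f : T -> \bar R) :
  (forall x, 0 <= g x)%E -> (forall x, D x -> 0 <= f x)%E ->
  (forall x, g x <= (f \_ D) x)%E ->
  (\int[mu]_x g x <= \int[mu]_(x in D) f x)%E.
Proof.
move=> g0 f0 gf; rewrite ge0_integralTE// ge0_integralE//.
by apply: le_ereal_sup => _ [h hg <-]; exists h => // x; apply: le_trans (gf x).
Qed.

(** Otherwise the supremum of the failures has no failure above it, and the hypothesis at that point
    excludes failures at it and just below it. *)
Lemma backward_real_induction (R : realType) (a b : R) (Q : set R) :
  (forall t, a <= t <= b -> (forall s, t < s <= b -> Q s) ->
    exists2 d, 0 < d & forall s, t - d < s <= t -> a <= s -> Q s) ->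
  forall t, a <= t <= b -> Q t.
Proof.
move=> ind t tab; apply: contrapT => nQt.
pose S := [set s | a <= s <= b /\ ~ Q s].
have St : S t by [].
have supS : has_sup S by split; [exists t|exists b => s [/andP[]]].
have Sle s : S s -> s <= sup S by move=> Ss; exact: ub_le_sup supS.2 _ Ss.
have uab : a <= sup S <= b.
  rewrite (le_trans _ (Sle _ St))//=; last by case/andP: tab.
  by apply: ge_sup supS.1 _ => s [/andP[]].
have [|d d0 dQ] := ind _ uab.
  move=> s /andP[us sb]; apply: contrapT => nQs.
  have : S s by split => //; rewrite sb (le_trans _ (ltW us))//; case/andP: uab.
  by move=> /Sle; rewrite leNgt us.
have [s Ss ds] := sup_adherent d0 supS.
by have [/andP[sa _] nQs] := Ss; apply: nQs; apply: dQ => //; rewrite ds Sle.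
Qed.

Section CurveEstimate.
Context {R : realType} {n : nat}.
Local Notation mu := (@lebesgue_measure R).

Lemma curve_coord_le (y : R -> 'rV[R]_n) (a b : R) k : a < b ->
  (forall u, a <= u <= b -> derivable y u 1) ->
  (forall u, a <= u <= b -> {for u, continuous ('D_1 y)}) ->
  (`|y a 0 k|%:E <= `|y b 0 k|%:E + \int[mu]_(u in `]a, b[) `|'D_1 y u|%:E)%E.
Proof.
move=> ab yd yc.
pose yk u := y u 0 k; pose f u : R := 'D_1 y u 0 k.
have ykd u : a <= u <= b -> derivable yk u 1.
  by move=> /yd/derivable_mxP/(_ 0 k).
have fE u : a <= u <= b -> 'D_1 yk u = f u.
  by move=> uab; rewrite /f derive_mx ?mxE//; exact: yd.
have fc u : a <= u <= b -> {for u, continuous f}.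
  move=> uab; have cc := @coord_continuous R 1 n 0 k ('D_1 y u).
  exact: (cvg_comp _ _ (yc _ uab) cc).
have fw : {within `[a, b], continuous f}.
  by apply: continuous_in_subspaceT => u; rewrite inE/= in_itv/=; exact: fc.
have ykc u : a <= u <= b -> {for u, continuous yk}.
  by move=> /ykd /derivable1_diffP /differentiable_continuous.
have aab : a <= a <= b by rewrite lexx ltW.
have bab : a <= b <= b by rewrite lexx ltW.
have := @continuous_FTC2 R f yk a b ab fw.
have -> : (\int[mu]_(x in `[a, b]) (f x)%:E = \int[mu]_(x in `]a, b[) (f x)%:E)%E.
  apply: integral_itv_bndoo; apply/measurable_EFinP.
  apply: subspace_continuous_measurable_fun => //.
  by apply: continuous_subspaceW fw; exact: subset_itv_oo_cc.
have mf : measurable_fun `]a, b[ (EFin \o f).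
  apply/measurable_EFinP; apply: subspace_continuous_measurable_fun => //.
  by apply: continuous_subspaceW fw; exact: subset_itv_oo_cc.
have -> : (\int[mu]_(x in `]a, b[) (f x)%:E = \int[mu]_(x in `]a, b[) (EFin \o f) x)%E by [].
move=> FTC; have /FTC{}FTC : derivable_oo_LRcontinuous yk a b.
  split.
  - by move=> u; rewrite in_itv/= => /andP[au ub]; apply: ykd; rewrite !ltW.
  - by apply: cvg_at_right_filter; exact: ykc.
  - by apply: cvg_at_left_filter; exact: ykc.
have {}FTC : (\int[mu]_(x in `]a, b[) (EFin \o f) x = (yk b)%:E - (yk a)%:E)%E.
  apply: FTC => u; rewrite in_itv/= => /andP[au ub].
  by rewrite derive1E fE// !ltW.
have le1 := le_abse_integral mu (measurable_itv `]a, b[) mf.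
have le2 : (\int[mu]_(x in `]a, b[) `|(EFin \o f) x| <= \int[mu]_(u in `]a, b[) `|'D_1 y u|%:E)%E.
  rewrite [leLHS]integral_mkcond; apply: ge0_le_lower_integral => //.
  - by move=> u; apply: erestrict_ge0.
  - move=> u; rewrite !patchE; case: ifP => // _; rewrite lee_fin.
    exact: mx_coord_le.
rewrite (@le_trans _ _ (`|yk b|%:E + `|(yk b)%:E - (yk a)%:E|)%E)//.
  rewrite -EFinB abse_EFin -EFinD lee_fin distrC -/(yk a).
  by rewrite -lerBlDl; exact: lerB_dist.
by rewrite leeD2l// -FTC (le_trans le1).
Qed.

End CurveEstimate.

Lemma derive_subc (R : realType) (V W : normedModType R) (f : V -> W) (c : W) v :
  'D_v (fun x => f x - c) = 'D_v f.
Proof.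
apply/funext => a.
have E : (fun h : R => h^-1 *: (((fun x => f x - c) \o shift a) (h *: v) - (f a - c))) =
    (fun h : R => h^-1 *: ((f \o shift a) (h *: v) - f a)).
  by apply/funext => h /=; rewrite subrACA subrr subr0.
by rewrite /derive E.
Qed.

Lemma derivable_subc (R : realType) (V W : normedModType R) (f : V -> W) (c : W) a v :
  derivable f a v -> derivable (fun x => f x - c) a v.
Proof.
move=> fd; have cd := @derivable_cst R V W c v a.
exact: (derivableB fd cd).
Qed.

Section Velocity.
Context {R : realType} {n : nat} {G : lieGroupType R n}.
Local Notation V := 'rV[R]_n.
Local Notation coor := (@coor R n G).
Local Notation gpoint := (@gpoint R n G).
Local Notation lmul := (@lmul R n G).
Local Notation U := (cdom (chart_at (1%g : G))).
Local Notation cf := (cfun (chart_at (1%g : G))).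
Local Notation ci := (cinv (chart_at (1%g : G))).

Lemma curve_coor (del : R -> G) u : C1_curve del -> U (del u) ->
  [/\ differentiable (cf \o del) u, derivable (coor \o del) u 1 &
      {for u, continuous ('D_1 (coor \o del))}].
Proof.
move=> [dc /(_ 1%g)[dd dD]] Uu.
have uS : u \in del @^-1` U by rewrite inE.
have du := dd _ uS; split; first exact: du.
  by apply: derivable_subc; apply/derivable1_diffP.
by rewrite derive_subc; exact: (dD 1 u uS).
Qed.

Lemma right_velocity_derivable (del : R -> G) u : C1_curve del -> U (del u) ->
  derivable (fun v => cf (del v * (del u)^-1)%g) u 1.
Proof.
move=> dC Uu; have [du _ _] := curve_coor dC Uu; have [dc _] := dC.
pose p := ((del u)^-1)%g; pose fp := cfun (chart_at p); pose cp := cinv (chart_at p).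
have pd : cdom (chart_at p) p := mem_chart_at p.
have [fd _] := @lie_mulg_smooth _ _ G 1%g p 1%g 1%N.
pose F (w : V * V) : V := cf (ci w.1 * cp w.2)%g.
have Fd : differentiable F (cf (del u), fp p).
  apply: fd; rewrite inE; split => /=; [by exists (del u)|by exists p|].
  rewrite chartK// chartK// mulgV; exact: dom1.
have pdf := is_diff_pair (differentiableP du) (is_diff_cst (fp p) u).
have pe : ((cf \o del) u, fp p) = (cf (del u), fp p) by [].
have Hd := is_diff_comp_at pe pdf (differentiableP Fd).
apply/derivable1_diffP; apply: (near_eq_differentiable _ (@ex_diff _ _ _ _ _ _ _ Hd)).
have : \forall v \near u, U (del v) by exact: (dc u _ (near_dom Uu)).
apply: filterS => v Uv; apply: (congr1 cf).
by congr (_ * _)%g; exact: chartK.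
Qed.

Lemma lmul_near r C x y : @lie_radius R n G r C -> `|x| < r -> `|y| < r ->
  `|lmul x y - y| <= 2 * `|x|.
Proof.
move=> [r0 C0 Cr rP [_ lP]] xr yr.
have r2 : r < 2 * r by lra.
have l0y : lmul 0 y = y.
  rewrite /lmul point0 mul1g; have [|_ + _] := rP y; last by [].
  exact: lt_trans yr r2.
have n0 : `|0 : V| < r by rewrite normr0.
have := lP r x y 0 y (ltW r2) xr yr n0 yr.
rewrite l0y subr0 !subrr normr0 subr0 addr0 => H.
rewrite -[lmul x y - y](subrK x) (le_trans (ler_normD _ _))//.
have : C * r * `|x| <= `|x| by rewrite ler_piMl//; lra.
lra.
Qed.

(** By right translation [coor (del v) = lmul (kap v) (coor (del u))], where [kap v] gives the
    coordinates of [del v * (del u)^-1]. Left multiplication by a small element moves a point by at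
    most twice the size of that element, so the difference quotients of [coor \o del] are at most
    twice those of [kap]. *)
Lemma coor_velocity_le r C (del : R -> G) u : @lie_radius R n G r C ->
  C1_curve del -> U (del u) -> `|coor (del u)| < r ->
  `|'D_1 (coor \o del) u| <= 2 * `|right_velocity del u|.
Proof.
move=> rC dC Uu ur; have [_ yd _] := curve_coor dC Uu; have [dc _] := dC.
have kd := right_velocity_derivable dC Uu.
rewrite /right_velocity derive1E.
pose kap v := coor (del v * (del u)^-1)%g.
have kapd : derivable kap u 1 by exact: derivable_subc.
have -> : 'D_1 (fun s => cf (del s * (del u)^-1)%g) u = 'D_1 kap u.
  exact/esym/(congr1 (@^~ u) (derive_subc (fun s => cf (del s * (del u)^-1)%g) (cf 1%g) 1)).
have ku : kap u = 0 by rewrite /kap mulgV coor1.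
have kc : (fun v => del v * (del u)^-1)%g @ u --> (1%g : G).
  rewrite -[X in _ --> X](mulgV (del u)).
  exact: (cvg_mulg (dc u) (cvg_cst ((del u)^-1)%g)).
have Uk : \forall v \near u, U (del v * (del u)^-1)%g by exact: (kc _ (near_dom (@dom1 _ _ G))).
have [r0 _ _ rP [mP _]] := rC.
have ks : \forall v \near u, `|kap v| < r.
  have kap0 : kap @ u --> kap u.
    have c1 := @coor_continuous _ _ G _ (@dom1 _ _ G).
    by rewrite ku -(@coor1 _ _ G); exact: (cvg_comp _ _ kc c1).
  apply: (cvgr_norm_lt _ kap0); by rewrite ku normr0.
have yk : \forall v \near u, `|coor (del v) - coor (del u)| <= 2 * `|kap v|.
  apply: filterS2 Uk ks => v Uv kv.
  rewrite (_ : coor (del v) = lmul (kap v) (coor (del u))).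
    exact: lmul_near rC kv ur.
  by rewrite /lmul /kap !coorK// mulgVK.
have yD : (fun h : R => h^-1 *: ((coor \o del) (h *: 1 + u) - (coor \o del) u)) @ 0^' -->
   'D_1 (coor \o del) u by exact: yd.
have kD : (fun h : R => h^-1 *: (kap (h *: 1 + u) - kap u)) @ 0^' --> 'D_1 kap u by exact: kapd.
have nyD : `|h^-1 *: ((coor \o del) (h *: 1 + u) - (coor \o del) u)| @[h --> (0 : R)^'] -->
  `|'D_1 (coor \o del) u| by exact: cvg_norm yD.
have nkD : 2 * `|h^-1 *: (kap (h *: 1 + u) - kap u)| @[h --> (0 : R)^'] --> 2 * `|'D_1 kap u|.
  by apply: cvgMl_tmp; exact: cvg_norm kD.
apply: (ler_cvg_to nyD nkD).
have sh : (fun h : R => h *: 1 + u) @ 0^' --> u.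
  have sc : {for 0, continuous (fun h : R => h *: 1 + u)}.
    apply: (lipschitz_continuous_at (K := 1)) => h.
    by rewrite mul1r opprD addrACA subrr addr0 -scalerBl [_ *: _]mulr1.
  rewrite -[X in _ --> X]add0r -[X in _ --> X + _](scale0r (1 : R)).
  exact: cvg_within_filter sc.
have shk : \forall h \near (0 : R)^', `|coor (del (h *: 1 + u)) - coor (del u)| <=
  2 * `|kap (h *: 1 + u)| by exact: (sh _ yk).
apply: filterS shk => h /= hk.
rewrite !normrZ mulrCA ler_wpM2l// ku subr0; exact: hk.
Qed.

End Velocity.

(** * Lower bound for the distance *)

Section LowerBound.
Context {R : realType} {n : nat} {G : lieGroupType R n}.
Local Notation V := 'rV[R]_n.
Local Notation coor := (@coor R n G).
Local Notation gpoint := (@gpoint R n G).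
Local Notation lmul := (@lmul R n G).
Local Notation U := (cdom (chart_at (1%g : G))).
Local Notation mu := (@lebesgue_measure R).
Variables (f : R -> R) (gam : R -> G) (K0 r C : R).
Hypothesis K0p : 0 < K0.
Hypothesis rC : @lie_radius R n G r C.
Hypothesis f0 : forall u, 0 <= f u.
Hypothesis fK : forall u, `|right_velocity gam u| <= K0 * f u.

(* The speed of a piecewise C1 curve is replaced by a minorant [g], so that its
   measurability is not an issue. *)
Definition coor_controlled (t : R) := t <= 1 /\ U (gam t) /\
  exists g : R -> R, [/\ measurable_fun setT g, forall u, 0 <= g u,
    forall u, g u != 0 -> t < u <= 1 /\ g u <= f u &
    forall k, (`|coor (gam t) 0 k|%:E <= (2 * K0)%:E * \int[mu]_u (g u)%:E)%E].

Lemma coor_controlled1 : gam 1 = 1%g -> coor_controlled 1.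
Proof.
move=> g1; split=> //; split; first by rewrite g1; exact: dom1.
exists (fun=> 0); split=> //; first by move=> u; rewrite eqxx.
by move=> k; rewrite g1 coor1 mxE normr0 integral0 mule0.
Qed.

Lemma coor_controlled_le t M : 0 <= t -> coor_controlled t ->
  (\int[mu]_(u in `[0%R, 1%R]) (f u)%:E <= M%:E)%E -> `|coor (gam t)| <= 2 * K0 * M.
Proof.
move=> t0 [t1 [Ut [g [mg g0 gf gI]]]] fM.
have gM : (\int[mu]_u (g u)%:E <= M%:E)%E.
  apply: le_trans fM; apply: ge0_le_lower_integral => [u|u _|u]; rewrite ?lee_fin//.
  rewrite patchE; have [->|gn] := eqVneq (g u) 0; first by case: ifP; rewrite lee_fin.
  have [/andP[tu u1] gfu] := gf _ gn.
  by rewrite ifT ?lee_fin// inE/= in_itv/= u1 (le_trans t0 (ltW tu)).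
have K20 : 0 <= 2 * K0 by rewrite mulr_ge0// ltW.
have M0 : 0 <= M.
  by rewrite -lee_fin (le_trans _ gM)//; apply: integral_ge0 => u _; rewrite lee_fin.
apply: rV_norm_le => [|k]; first by rewrite mulr_ge0.
by rewrite -lee_fin (le_trans (gI k))// [leRHS]EFinM lee_wpmul2l// lee_fin.
Qed.

Variables (a b : R) (del : R -> G).
Hypothesis ab : a < b.
Hypothesis delC : C1_curve del.
Hypothesis gam_del : forall u, a <= u <= b -> gam u = del u.

Lemma right_velocity_piece u : a < u < b -> right_velocity gam u = right_velocity del u.
Proof.
move=> /andP[au ub]; have e : gam u = del u by apply: gam_del; rewrite !ltW.
rewrite /right_velocity e.
rewrite !derive1E; apply: near_eq_derive.
have : \forall v \near u, v \in `]a, b[.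
  by apply: near_in_itvoo; rewrite in_itv/= au.
apply: filterS => v; rewrite in_itv/= => /andP[av vb].
by rewrite gam_del ?(ltW av) ?(ltW vb).
Qed.

(** The minorant for [b] lives on []b, 1]]. On []s, b[] it is completed by the coordinate speed
    divided by [2 * K0], which is below [f] by [coor_velocity_le] and whose integral bounds the
    variation of the coordinates. *)
Lemma coor_controlled_extend s : a <= s <= b -> coor_controlled b ->
  (forall u, s <= u <= b -> U (gam u) /\ `|coor (gam u)| < r) -> coor_controlled s.
Proof.
move=> /andP[sa]; rewrite le_eqVlt => /predU1P[->//|sb].
move=> [b1 [Ub [g [mg g0 gf gI]]]] Q.
have sub u : s <= u <= b -> a <= u <= b.
  by move=> /andP[su ->]; rewrite (le_trans sa su).
split; first by rewrite (le_trans (ltW sb)).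
have ss : s <= s <= b by rewrite lexx ltW.
split; first by have [] := Q _ ss.
pose y := coor \o del.
have QU u : s <= u <= b -> U (del u) /\ `|coor (del u)| < r.
  by move=> su; rewrite -gam_del; [exact: Q|exact: sub].
have yd u : s <= u <= b -> derivable y u 1.
  by move=> /QU[Uu _]; have [] := curve_coor delC Uu.
have yc u : s <= u <= b -> {for u, continuous ('D_1 y)}.
  by move=> /QU[Uu _]; have [] := curve_coor delC Uu.
pose c := (2 * K0)^-1.
have K20 : 0 < 2 * K0 by rewrite mulr_gt0.
have c0 : 0 < c by rewrite invr_gt0.
pose h u := c * `|'D_1 y u|.
have h0 u : 0 <= h u by rewrite mulr_ge0// ltW.
have mh : measurable_fun `]s, b[ h.
  apply: subspace_continuous_measurable_fun => //.
  apply: continuous_in_subspaceT => u; rewrite inE/= in_itv/= => /andP[su ub].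
  have sub' : s <= u <= b by rewrite !ltW.
  exact: (cvgMl_tmp (cvg_norm (yc _ sub'))).
have mhr : measurable_fun setT (h \_ `]s, b[).
  exact: ((measurable_restrictT h (measurable_itv `]s, b[)).1 mh).
have hr0 u : 0 <= (h \_ `]s, b[) u by rewrite patchE; case: ifP.
have hf u : s < u < b -> h u <= f u.
  move=> /andP[su ub]; have sub' : s <= u <= b by rewrite !ltW.
  have [Uu ur] := QU _ sub'.
  rewrite /h mulrC ler_pdivrMr// (le_trans (coor_velocity_le rC delC Uu ur))//.
  rewrite -right_velocity_piece ?ub ?(le_lt_trans sa su)//.
  by rewrite [leRHS]mulrCA ler_wpM2l// mulrC.
exists (g \+ (h \_ `]s, b[)); split.
- exact: (measurable_funD mg mhr).
- by move=> u /=; rewrite addr_ge0.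
- move=> u /=; rewrite patchE; case: ifPn => [|_].
    rewrite inE/= in_itv/= => sub'; have /andP[su ub] := sub'.
    have -> : g u = 0.
      have [//|/gf[/andP[bu _] _]] := eqVneq (g u) 0.
      by have := lt_trans ub bu; rewrite ltxx.
    by rewrite add0r su (le_trans (ltW ub) b1)/= => _; split => //; exact: hf.
  rewrite addr0 => /gf[/andP[bu ->] gfu]; split => //.
  by rewrite (lt_trans sb bu).
- move=> k; have sbb : s <= b <= b by rewrite lexx ltW.
  have ys : y s = coor (gam s) by rewrite (gam_del (sub _ ss)).
  have yb : y b = coor (gam b) by rewrite (gam_del (sub _ sbb)).
  have := curve_coord_le k sb yd yc; rewrite ys yb; move/le_trans; apply.
  have -> : (\int[mu]_u ((g \+ (h \_ `]s, b[)) u)%:E =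
      \int[mu]_u (g u)%:E + \int[mu]_u ((h \_ `]s, b[) u)%:E)%E.
    under eq_integral do rewrite /= EFinD.
    by rewrite ge0_integralD//; (try exact/measurable_EFinP) => u _; rewrite lee_fin.
  rewrite ge0_muleDr; last 2 first.
    by apply: integral_ge0 => u _; rewrite lee_fin.
    by apply: integral_ge0 => u _; rewrite lee_fin.
  apply: leeD; first exact: gI.
  have -> : (\int[mu]_u ((h \_ `]s, b[) u)%:E = \int[mu]_(u in `]s, b[) (h u)%:E)%E.
    rewrite [RHS]integral_mkcond; apply: eq_integral => u _.
    by rewrite !patchE; case: ifP.
  rewrite -ge0_integralZl_EFin//; last 3 first.
    by move=> u _; rewrite lee_fin.
    exact/measurable_EFinP.
    exact: ltW.
  rewrite le_eqVlt; apply/orP; left; apply/eqP; apply: eq_integral => u _.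
  by rewrite -EFinM /h /c mulrA divff ?gt_eqF// mul1r.
Qed.

(** Bootstrap: control puts the coordinates below [r / 4], and a move back along the curve by an
    element of size below [r / 4] keeps them below [3 / 4 * r], inside the ball where speeds can be
    compared. The curve therefore never leaves this ball, and control reaches [a]. *)
Lemma coor_controlled_piece M : 0 <= a -> coor_controlled b ->
  (\int[mu]_(u in `[0%R, 1%R]) (f u)%:E <= M%:E)%E -> 2 * K0 * M < r / 4 ->
  coor_controlled a.
Proof.
move=> a0 Bb fM Mr.
have [r0 C0 Cr rP [mP _]] := rC.
suff Q t : a <= t <= b -> U (gam t) /\ `|coor (gam t)| < r.
  by apply: coor_controlled_extend => //; rewrite lexx ltW.
apply: (@backward_real_induction R a b [set t | U (gam t) /\ `|coor (gam t)| < r]) => {}t tab tQ.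
have [dc _] := delC.
pose W := [set g : G | U g /\ `|coor g| < r / 4].
have W1 : \forall g \near (1%g : G), W g.
  have c1 : coor @ (1%g : G) --> coor 1%g by exact: (@coor_continuous _ _ G _ (@dom1 _ _ G)).
  have r4 : `|coor 1%g| < r / 4 by rewrite coor1 normr0 divr_gt0.
  have c2 : \forall g \near (1%g : G), `|coor g| < r / 4 by apply: (cvgr_norm_lt _ c1).
  by apply: filterS2 (near_dom (@dom1 _ _ G)) c2 => g.
have [d d0 dP] : exists2 d : R, 0 < d & forall v w, `|v - t| < d -> `|w - t| < d ->
    W (del v * (del w)^-1)%g.
  have : (fun v : R * R => del v.1 * (del v.2)^-1)%g @ (t, t) --> (1%g : G).
    rewrite -[X in _ --> X](mulgV (del t)).
    have c1 : (fun v : R * R => del v.1) @ (t, t) --> del t.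
      have f1 : (fst : R * R -> R) @ (t, t) --> t by exact: cvg_fst.
      exact: (cvg_comp _ _ f1 (dc t)).
    have c2 : (fun v : R * R => del v.2) @ (t, t) --> del t.
      have f2 : (snd : R * R -> R) @ (t, t) --> t by exact: cvg_snd.
      exact: (cvg_comp _ _ f2 (dc t)).
    exact: (cvg_mulg c1 (cvg_invg c2)).
  move=> /(_ _ W1) /near_norm_lt[d d0 dW]; exists d => // v w vd wd.
  apply: (dW (v, w)); rewrite /= prod_normE/= gt_max.
  by rewrite vd wd.
(* Control at [t] itself is not known yet, so the move starts from a slightly later time [s0], or
   from [b] when [t = b]. *)
have [s0 [/andP[ts0 s0b] s0t s0Q]] : exists s0, [/\ t <= s0 <= b, `|s0 - t| < d &
    forall u, s0 <= u <= b -> u = b \/ t < u].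
  have /andP[_] := tab; rewrite le_eqVlt => /predU1P[->|tb].
    exists b; rewrite subrr normr0 lexx; split => // u bub.
    by left; apply/eqP; rewrite eq_le andbC.
  exists (Num.min b (t + d / 2)); split.
  - by rewrite ge_min lexx le_min ltW//= andbT lerDl divr_ge0// ltW.
  - rewrite ger0_norm; last by rewrite subr_ge0 le_min ltW//= lerDl divr_ge0// ltW.
    by rewrite ltrBlDl gt_min; apply/orP; right; rewrite ltrD2l; lra.
  - move=> u /andP[]; rewrite ge_min => /orP[bu|tu] ub.
      by left; apply/eqP; rewrite eq_le ub.
    by right; rewrite (lt_le_trans _ tu)// ltrDl divr_gt0.
have /andP[at_ tb] := tab.
have s0ab : a <= s0 <= b by rewrite s0b (le_trans at_ ts0).
have bQ : U (gam b) /\ `|coor (gam b)| < r.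
  split; first by case: Bb => _ [].
  have := coor_controlled_le (le_trans a0 (ltW ab)) Bb fM; lra.
have Bs0 : coor_controlled s0.
  apply: coor_controlled_extend => // u us0.
  have [->//|tu] := s0Q _ us0.
  by apply: tQ; rewrite tu; case/andP: us0.
have s0M := coor_controlled_le (le_trans a0 (le_trans at_ ts0)) Bs0 fM.
exists d => // s /andP[tds st] sa.
have sab : a <= s <= b by rewrite sa (le_trans st).
have sd : `|s - t| < d by rewrite distrC ger0_norm ?subr_ge0//; lra.
have [Ux xr] := dP _ _ sd s0t.
pose x := coor (del s * (del s0)^-1)%g; pose z := coor (gam s0).
have z4 : `|z| < r / 4 by exact: le_lt_trans s0M Mr.
have x4 : `|x| < r / 4 by [].
have Us0 : U (del s0) by rewrite -gam_del//; case: Bs0 => _ [].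
have sE : gam s = (gpoint x * gpoint z)%g.
  by rewrite /x /z coorK// gam_del// gam_del// coorK// mulgVK.
have xr1 : `|x| < r by lra.
have zr1 : `|z| < r by lra.
rewrite /= sE; split; first by apply: mP; lra.
have := lmul_near rC xr1 zr1; rewrite -/(lmul x z).
have := ler_normD (lmul x z - z) z; rewrite subrK; lra.
Qed.

End LowerBound.

Theorem rdist_coor_le (R : realType) (n : nat) (G : lieGroupType R n) (theta : G -> G) (K0 : R) :
  0 < K0 -> (forall X : 'rV[R]_n, `|X| <= K0 * Num.sqrt (Bform theta X X)) ->
  exists r : R, 0 < r /\ forall (g : G) M, (rdist theta g 1%g < M%:E)%E -> 2 * K0 * M < r ->
    cdom (chart_at (1%g : G)) g /\ `|coor g| <= 2 * K0 * M.
Proof.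
move=> K0p qK; have [r [C rC]] := @ex_lie_radius R n G.
have [r0 _ _ _ _] := rC.
exists (r / 4); split; first by rewrite divr_gt0.
move=> g M /ereal_inf_lt[_ [gam [[N [t [t0 tN tP]]] g0 g1] <-]] lM Mr.
pose f u := Num.sqrt (Bform theta (right_velocity gam u) (right_velocity gam u)).
have f0 u : 0 <= f u by exact: sqrtr_ge0.
have fK u : `|right_velocity gam u| <= K0 * f u by exact: qK.
have fM : (\int[@lebesgue_measure R]_(u in `[0%R, 1%R]) (f u)%:E <= M%:E)%E by exact: ltW.
have t_ge0 i : (i <= N)%N -> 0 <= t i.
  elim: i => [|i IH] iN; first by rewrite t0.
  by have [/ltW + _] := tP _ iN; apply: le_trans; apply: IH; exact: ltnW.
(* The pieces are counted from the end of the curve, where [gam 1 = 1] starts the induction. *)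
have B i : (i <= N)%N -> coor_controlled f gam K0 (t (N - i)%N).
  elim: i => [_|i IH iN]; first by rewrite subn0 tN; exact: coor_controlled1.
  have jN : (N - i.+1 < N)%N by rewrite ltn_subrL/= (leq_trans _ iN).
  have [tj [del dC gd]] := tP _ jN.
  have := IH (ltnW iN); rewrite -subnSK// => Bj.
  apply: (coor_controlled_piece K0p rC f0 fK tj dC _ _ Bj fM Mr); last first.
    by apply: t_ge0; exact: ltnW.
  by move=> u uj; apply: gd; rewrite in_itv.
have := B N (leqnn N); rewrite subnn t0 => B0.
have := coor_controlled_le K0p f0 (lexx 0) B0 fM; rewrite g0.
by case: B0 => _ []; rewrite g0.
Qed.

(** * Root spaces *)

Section RootSplitting.
Context {R : realType} {n : nat}.
Local Notation V := 'rV[R]_n.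
Variables th sg A : V -> V.
Hypothesis thL : linear th.
Hypothesis sgL : linear sg.
Hypothesis AL : linear A.
Hypothesis thK : involutive th.
Hypothesis sgK : involutive sg.
Hypothesis thsg : forall X, th (sg X) = sg (th X).

(* With [J = th \o sg], which preserves the root space of [Y], one solves
   [X' - k ^+ 2 *: J X' = Y] and takes [v = k *: (X' + sg X')] and
   [u = - k ^+ 2 *: (sg X' + th (sg X'))]. *)
Lemma split_positive_root (Y : V) (k m : R) : 0 < k -> k <= 1 -> 0 < m -> m <= 1 - k ^+ 4 ->
  A Y = k^-1 *: Y -> A (th (sg Y)) = k^-1 *: th (sg Y) ->
  A (sg Y) = k *: sg Y -> A (th Y) = k *: th Y ->
  exists u v, [/\ th u = u, sg v = v, Y = u + A v &
    [/\ `|u| <= m^-1 * (`|Y| + `|sg Y| + `|th Y| + `|th (sg Y)|),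
        `|v| <= m^-1 * (`|Y| + `|sg Y| + `|th Y| + `|th (sg Y)|) &
        `|A v| <= m^-1 * (`|Y| + `|sg Y| + `|th Y| + `|th (sg Y)|)]].
Proof.
move=> k0 k1 m0 mk AY AJ AS AT.
have d0 : 0 < 1 - k ^+ 4 by exact: lt_le_trans m0 mk.
have dm : (1 - k ^+ 4)^-1 <= m^-1 by rewrite lef_pV2 ?posrE.
pose d := (1 - k ^+ 4)^-1.
have dp : 0 < d by rewrite invr_gt0.
(* The span of [Y], [sg Y], [th Y] and [th (sg Y)] is stable under [th], [sg] and [A], so each claim
   becomes an identity between coefficients. All coefficients used are bounded by [d], hence by
   [m^-1]. *)
pose comb (c1 c2 c3 c4 : R) : V := c1 *: Y + (c2 *: sg Y + (c3 *: th Y + c4 *: th (sg Y))).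
have lZ (f : V -> V) : linear f -> forall c x, f (c *: x) = c *: f x.
  by move=> fL c x; exact: linearZ0.
have lD (f : V -> V) : linear f -> forall x y, f (x + y) = f x + f y.
  by move=> fL x y; have := fL 1 x y; rewrite !scale1r.
have lc (f : V -> V) : linear f -> forall c1 c2 c3 c4, f (comb c1 c2 c3 c4) =
    c1 *: f Y + (c2 *: f (sg Y) + (c3 *: f (th Y) + c4 *: f (th (sg Y)))).
  by move=> fL c1 c2 c3 c4; rewrite /comb !(lD _ fL) !(lZ _ fL).
have cle c1 c2 c3 c4 : `|c1| <= d -> `|c2| <= d -> `|c3| <= d -> `|c4| <= d ->
    `|comb c1 c2 c3 c4| <= m^-1 * (`|Y| + `|sg Y| + `|th Y| + `|th (sg Y)|).
  move=> h1 h2 h3 h4.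
  have st c (x : V) : `|c| <= d -> `|c *: x| <= m^-1 * `|x|.
    by move=> cd; rewrite normrZ ler_wpM2r// (le_trans cd).
  rewrite !mulrDr -!addrA (le_trans (ler_normD _ _))// lerD ?st//.
  rewrite (le_trans (ler_normD _ _))// lerD ?st//.
  by rewrite (le_trans (ler_normD _ _))// lerD ?st.
have k2 : k ^+ 2 <= 1 by rewrite exprn_ile1// ltW.
have k3 : k ^+ 3 <= 1 by rewrite exprn_ile1// ltW.
have k4 : k ^+ 4 <= 1 by rewrite exprn_ile1// ltW.
have b (c : R) : 0 <= c -> c <= 1 -> `|c * d| <= d.
  by move=> c0 c1; rewrite ger0_norm ?mulr_ge0 ?(ltW dp)// ler_piMl// ltW.
have kn j : 0 <= k ^+ j by rewrite exprn_ge0// ltW.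
have bN (c : R) : 0 <= c -> c <= 1 -> `|- (c * d)| <= d by move=> *; rewrite normrN b.
exists (comb (- (k ^+ 4 * d)) (- (k ^+ 2 * d)) (- (k ^+ 4 * d)) (- (k ^+ 2 * d))).
exists (comb (k * d) (k * d) (k ^+ 3 * d) (k ^+ 3 * d)).
have Av : A (comb (k * d) (k * d) (k ^+ 3 * d) (k ^+ 3 * d)) =
   comb (1 * d) (k ^+ 2 * d) (k ^+ 4 * d) (k ^+ 2 * d).
  rewrite lc// AY AS AT AJ /comb !scalerA; congr (_ *: _ + (_ *: _ + (_ *: _ + _ *: _)));
    rewrite /d; field; rewrite ?gt_eqF//.
split.
- rewrite lc// thK -[th (th (sg Y))]/(th (th (sg Y))) thK /comb.
  by rewrite [RHS]addrC -!addrA; apply/rowP => j; rewrite !mxE; ring.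
- rewrite lc// sgK -thsg -[sg (th (sg Y))]thsg sgK /comb.
  by apply/rowP => j; rewrite !mxE; ring.
- rewrite Av /comb; apply/rowP => j; rewrite !mxE /d; field; rewrite gt_eqF//.
- split; last rewrite Av; apply: cle; rewrite ?b ?bN// ?ltW//.
Qed.

End RootSplitting.

(** * Positive roots as sums of simple roots *)

Section SimpleRoots.
Context {R : realType} {n : nat} (fa : {vspace 'rV[R]_n}).
Local Notation lf := 'Hom(subvs_of fa, R^o).
Implicit Types (P I : set lf) (beta : lf).

(** Induction on the number of indices [i] for which [b i] is smaller than [beta] at [X0]: a
    positive root that is not simple is a sum of two positive roots, each strictly smaller at [X0].
    Repetitions in [s] stand for multiplicities. *)
Lemma simple_root_sum P (X0 : subvs_of fa) (m : nat) (b : 'I_m -> lf) :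
  (forall beta, P beta -> exists i, beta = b i) ->
  (forall beta, P beta -> 0 < (beta X0 : R)) ->
  forall beta, P beta ->
  exists s : seq lf, (forall alpha, alpha \in s -> simple_roots P alpha) /\
    forall X, beta X = \sum_(alpha <- s) (alpha X : R).
Proof.
move=> Pb P0; pose S beta : {set 'I_m} := finset (fun i => (b i X0 : R) < beta X0).
have key k beta : P beta -> (#|S beta| <= k)%N ->
  exists s : seq lf, (forall alpha, alpha \in s -> simple_roots P alpha) /\
    forall X, beta X = \sum_(alpha <- s) (alpha X : R).
  elim: k beta => [|k IH] beta Pbeta.
    move=> k0; exists [:: beta]; split; last by move=> X; rewrite big_seq1.
    move=> alpha; rewrite inE => /eqP ->; split => // -[g [d [Pg Pd E]]].
    move: k0; rewrite leqn0 cards_eq0 => /eqP/setP; have [i gi] := Pb _ Pg.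
    move=> /(_ i); rewrite !inE -gi E lfunE/= ltrDl; by rewrite P0.
  move=> kb; have [sb|nsb] := pselect (simple_roots P beta).
    exists [:: beta]; split; last by move=> X; rewrite big_seq1.
    by move=> alpha; rewrite inE => /eqP ->.
  have [g [d [Pg Pd E]]] : exists g d, [/\ P g, P d & beta = g + d].
    by apply: contrapT => h; apply: nsb.
  have lt g' d' : P g' -> P d' -> beta = g' + d' ->
      (#|S g'| <= k)%N.
    move=> Pg' Pd' E'; rewrite -ltnS (leq_trans _ kb)//; apply: proper_card.
    have gb : (g' X0 : R) < beta X0 by rewrite E' lfunE/= ltrDl P0.
    apply/properP; split.
      by apply/fintype.subsetP => i; rewrite !inE => /lt_trans; apply.
    have [i gi] := Pb _ Pg'; exists i; rewrite !inE -gi ?ltxx//.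
  have [s1 [S1 E1]] := IH _ Pg (lt _ _ Pg Pd E).
  have E' : beta = d + g by rewrite addrC.
  have [s2 [S2 E2]] := IH _ Pd (lt _ _ Pd Pg E').
  exists (s1 ++ s2); split=> [alpha|X].
    by rewrite mem_cat => /orP[/S1|/S2].
  by rewrite big_cat/= -E1 -E2 E lfunE.
by move=> beta Pbeta; exact: key Pbeta (leqnn _).
Qed.

(** Write [beta] as a sum of simple roots. Either all of them lie in [I], or one lies outside and
    contributes at least [c], the others being nonnegative on the chamber. *)
Lemma chamber_dichotomy P I (X0 : subvs_of fa) (m : nat) (b : 'I_m -> lf) (c : R) beta :
  (forall beta, P beta -> exists i, beta = b i) ->
  (forall beta, P beta -> 0 < (beta X0 : R)) -> P beta ->
  (forall X, (forall alpha : lf, I alpha -> alpha X = 0) -> beta X = 0) \/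
  (forall X, (forall alpha : lf, P alpha -> 0 <= (alpha X : R)) ->
     (forall alpha : lf, (simple_roots P `\` I) alpha -> c <= (alpha X : R)) -> c <= (beta X : R)).
Proof.
move=> Pb P0 Pbeta; have [s [sS sE]] := simple_root_sum Pb P0 Pbeta.
have [sI|] := pselect (forall alpha : lf, alpha \in s -> I alpha); [left|move=> ex; right; move: ex].
  move=> X XI; rewrite sE big_seq big1// => alpha /sI /XI; exact.
move=> /existsNP[alpha /not_implyP[as_ nI]] X Xp Xc.
rewrite sE (big_rem alpha)//= -[c]addr0 lerD//.
  by apply: Xc; split => //; exact: sS.
rewrite big_seq sumr_ge0// => g /mem_rem /sS[Pg _]; exact: Xp.
Qed.

End SimpleRoots.

(** * Factorisation near the identity *)

(** The iteration [Z |-> Z + y - F Z] from [0] contracts by [2^-1], so its steps add up to at most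
    [2 * |y|], which keeps it in the ball where the hypothesis holds. *)
Lemma near_identity_surjective (R : realType) n (F : 'rV[R]_n -> 'rV[R]_n) (s : R) y :
  F 0 = 0 ->
  (forall Z Z', `|Z| < s -> `|Z'| < s -> `|F Z - F Z' - (Z - Z')| <= 2^-1 * `|Z - Z'|) ->
  2 * `|y| < s -> exists2 Z, `|Z| <= 2 * `|y| & F Z = y.
Proof.
move=> F0 FP ys; have y0 : 0 <= `|y| by [].
pose z k := iter k (fun Z => Z + y - F Z) 0.
have zS k : z k.+1 = z k + y - F (z k) by [].
have B k : `|z k| <= 2 * `|y| - 2 * `|y| / 2 ^+ k /\ `|z k.+1 - z k| <= `|y| / 2 ^+ k.
  elim: k => [|k [zk dk]].
    by rewrite /z/= F0 !subr0 add0r normr0 expr0 !divr1 subrr.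
  have p0 : 0 <= `|y| / 2 ^+ k by rewrite divr_ge0// exprn_ge0.
  have e2 : `|y| / 2 ^+ k.+1 = `|y| / 2 ^+ k / 2 by rewrite exprSr invfM mulrA.
  have zk1 : `|z k.+1| <= 2 * `|y| - 2 * `|y| / 2 ^+ k.+1.
    rewrite -[2 * _ / _]mulrA e2 -[z k.+1](subrK (z k)) (le_trans (ler_normD _ _))//.
    move: zk; rewrite -[2 * _ / _]mulrA; lra.
  split => //; rewrite [in z k.+2]zS e2.
  have -> : z k.+1 + y - F (z k.+1) - z k.+1 = - (F (z k.+1) - F (z k) - (z k.+1 - z k)).
    rewrite [in RHS](_ : z k.+1 - z k = y - F (z k)); last first.
      by rewrite zS; apply/rowP => j; rewrite !mxE; ring.
    by rewrite opprB opprB addrA; apply/rowP => j; rewrite !mxE; ring.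
  rewrite normrN (le_trans (FP _ _ _ _))//.
  - by rewrite (le_lt_trans zk1)// (le_lt_trans _ ys)// gerBl divr_ge0 ?mulr_ge0 ?exprn_ge0.
  - by rewrite (le_lt_trans zk)// (le_lt_trans _ ys)// gerBl divr_ge0 ?mulr_ge0 ?exprn_ge0.
  - lra.
have zc : cvgn z := cvg_of_geometric_step (fun k => (B k).2).
have zle k : `|z k| <= 2 * `|y|.
  by rewrite (le_trans (B k).1)// gerBl divr_ge0 ?mulr_ge0 ?exprn_ge0.
have nzc : (fun k => `|z k|) @ \oo --> `|limn z| by exact: cvg_norm zc.
have Zle : `|limn z| <= 2 * `|y| by apply: (cvgr_to_le nzc); exact: nearW.
exists (limn z) => //; apply/eqP; rewrite -subr_eq0 -normr_le0.
have d0 : (fun k => z k.+1 - z k) @ \oo --> (0 : 'rV[R]_n).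
  by rewrite -[X in _ --> X](subrr (limn z)); apply: cvgB; [rewrite cvg_shiftS|].
have e0 : (fun k => limn z - z k) @ \oo --> (0 : 'rV[R]_n).
  by rewrite -[X in _ --> X](subrr (limn z)); apply: cvgB; [exact: cvg_cst|].
have nd0 : (fun k => `|z k.+1 - z k|) @ \oo --> (0 : R).
  by rewrite -(normr0 'rV[R]_n); exact: cvg_norm d0.
have ne0 : (fun k => 2 * `|limn z - z k|) @ \oo --> (0 : R).
  by rewrite -(mulr0 2) -(normr0 'rV[R]_n); apply: cvgMl_tmp; exact: cvg_norm e0.
have S0 : (fun k => 2 * `|limn z - z k| + `|z k.+1 - z k|) @ \oo --> (0 : R).
  by rewrite -[X in _ --> X]addr0; exact: cvgD ne0 nd0.
apply: (cvgr_to_ge S0); apply: nearW => k.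
have := FP _ _ (le_lt_trans Zle ys) (le_lt_trans (zle k) ys).
have -> : F (limn z) - y = (F (limn z) - F (z k) - (limn z - z k)) + (limn z - z k) - (z k.+1 - z k).
  by rewrite zS; apply/rowP => j; rewrite !mxE; ring.
have := ler_normB (F (limn z) - F (z k) - (limn z - z k) + (limn z - z k)) (z k.+1 - z k).
have := ler_normD (F (limn z) - F (z k) - (limn z - z k)) (limn z - z k).
have := normr_ge0 (limn z - z k); lra.
Qed.

(** Here [f] and [p] stand for the increments of the outer and the inner product: the total error is
    the sum of the errors of two multiplications and three exponentials. *)
Lemma telescope_increments (R : realFieldType) n (f p u w v du dw dv : 'rV[R]_n) :
  f - (du + dw + dv) =
    (f - p - v) + ((p - u - w) + ((u - du) + ((w - dw) + (v - dv)))).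
Proof.
by apply/rowP => j; rewrite !mxE; ring.
Qed.

(** The coefficient [88] is [8 * 10 + 2 * 4]: the outer product works at scale [8 * t] with
    increments of sum at most [10 * C0 * d], the inner one at scale [2 * t] with sum at most
    [4 * C0 * d]. The term [3 * C1] comes from the three exponentials. *)
Lemma factorisation_estimate (R : realFieldType) (C C1 C0 t d a1 a2 a3 a4 b1 b2 b3 : R) :
  0 <= C -> 0 <= C1 -> 0 <= t -> (3 * C1 + 88 * C) * C0 * t <= 2^-1 -> 0 <= d ->
  b1 <= C0 * d -> b2 <= C0 * d -> b3 <= C0 * d ->
  a2 <= 2 * b1 -> a3 <= 2 * b2 -> a4 <= 2 * b3 -> a1 <= 2 * (a2 + a3) ->
  C * (8 * t) * (a1 + a4) + (C * (2 * t) * (a2 + a3) +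
    (C1 * t * b1 + (C1 * t * b2 + C1 * t * b3))) <= 2^-1 * d.
Proof.
move=> Cp C1p t0 CCt d0 du dw dv k1 k2 k3 h3.
have q1 : a2 <= 2 * (C0 * d) by lra.
have q2 : a3 <= 2 * (C0 * d) by lra.
have q3 : a4 <= 2 * (C0 * d) by lra.
have q4 : a1 <= 8 * (C0 * d) by lra.
have Ctp : 0 <= C * t by rewrite mulr_ge0.
have C1tp : 0 <= C1 * t by rewrite mulr_ge0.
have m1 : C * t * (a1 + a4) <= C * t * (10 * (C0 * d)) by rewrite ler_wpM2l//; lra.
have m2 : C * t * (a2 + a3) <= C * t * (4 * (C0 * d)) by rewrite ler_wpM2l//; lra.
have m3 : C1 * t * (b1 + b2 + b3) <= C1 * t * (3 * (C0 * d)) by rewrite ler_wpM2l//; lra.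
have m4 : (3 * C1 + 88 * C) * C0 * t * d <= 2^-1 * d by rewrite ler_wpM2r.
apply: le_trans m4.
have -> : (3 * C1 + 88 * C) * C0 * t * d =
   8 * (C * t * (10 * (C0 * d))) + 2 * (C * t * (4 * (C0 * d))) + C1 * t * (3 * (C0 * d)) by ring.
have -> : C * (8 * t) * (a1 + a4) +
     (C * (2 * t) * (a2 + a3) + (C1 * t * b1 + (C1 * t * b2 + C1 * t * b3))) =
   8 * (C * t * (a1 + a4)) + 2 * (C * t * (a2 + a3)) + C1 * t * (b1 + b2 + b3) by ring.
lra.
Qed.

Section Factorisation.
Context {R : realType} {n : nat} {G : lieGroupType R n}.
Local Notation V := 'rV[R]_n.
Local Notation coor := (@coor R n G).
Local Notation gpoint := (@gpoint R n G).
Local Notation lmul := (@lmul R n G).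
Local Notation gexp := (@gexp R n G).
Local Notation U := (cdom (chart_at (1%g : G))).

Lemma lmul_lipschitz r C s x y x' y' : @lie_radius R n G r C -> s <= 2 * r -> C * s <= 1 ->
  `|x| < s -> `|y| < s -> `|x'| < s -> `|y'| < s ->
  `|lmul x y - lmul x' y'| <= 2 * (`|x - x'| + `|y - y'|).
Proof.
move=> [_ _ _ _ [_ lP]] sr Cs xs ys xs' ys'.
have := lP s x y x' y' sr xs ys xs' ys'.
rewrite -addrA -opprD => H.
rewrite -[lmul x y - lmul x' y'](subrK ((x - x') + (y - y'))).
rewrite (le_trans (ler_normD _ _))//.
have := ler_normD (x - x') (y - y').
have n0 : 0 <= `|x - x'| + `|y - y'| by rewrite addr_ge0.
have : C * s * (`|x - x'| + `|y - y'|) <= `|x - x'| + `|y - y'| by rewrite ler_piMl.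
lra.
Qed.

Lemma lmul00 : lmul 0 0 = 0.
Proof. by rewrite /lmul point0 mulg1 coor1. Qed.

(** The radius [s] is chosen before [u], [w] and [v], of which only the common bound [C0] enters. As
    [Z = u Z + w Z + v Z], the product map differs from the identity by a map of Lipschitz constant
    [2^-1]. *)
Lemma product_surjective (C0 : R) : 0 < C0 ->
  exists2 s : R, 0 < s & forall (u w v : V -> V), linear u -> linear w -> linear v ->
    (forall Z, [/\ `|u Z| <= C0 * `|Z|, `|w Z| <= C0 * `|Z| & `|v Z| <= C0 * `|Z|]) ->
    (forall Z, Z = u Z + w Z + v Z) ->
    forall g, U g -> 2 * `|coor g| < s ->
    exists2 Z, `|Z| <= 2 * `|coor g| & (gexp (u Z) * gexp (w Z) * gexp (v Z))%g = g.
Proof.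
move=> C00; have [r [C rC]] := @ex_lie_radius R n G.
have [r1 [C1 [r10 C10 gU eP]]] := @gexp_strict R n G.
have [r0 Cp Cr rP [mP lP]] := rC.
(* [D] adds up the coefficients that have to be small, so that [D * t <= 2^-1] yields the separate
   bounds at once. *)
pose D := 1 + C1 + 8 * C + (3 * C1 + 88 * C) * C0.
have E0 : 0 <= (3 * C1 + 88 * C) * C0 by rewrite mulr_ge0 ?(ltW C00)//; lra.
have D0 : 0 < D by rewrite /D; lra.
pose t := Num.min r1 (Num.min (r / 4) (2 * D)^-1).
have t0 : 0 < t by rewrite !lt_min r10 divr_gt0//= invr_gt0 mulr_gt0.
have [tr1 tr tD] : [/\ t <= r1, t <= r / 4 & D * t <= 2^-1].
  split; rewrite ?ge_min ?lexx ?orbT//.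
  by rewrite -ler_pdivlMl// -invfM mulrC !ge_min lexx !orbT.
have C1t : C1 * t <= 2^-1.
  rewrite (le_trans _ tD)// ler_pM2r// /D.
  lra.
have Ct : C * (8 * t) <= 2^-1.
  rewrite mulrCA mulrA (le_trans _ tD)// ler_pM2r// /D.
  lra.
have CCt : (3 * C1 + 88 * C) * C0 * t <= 2^-1.
  rewrite (le_trans _ tD)// ler_pM2r// /D; lra.
exists (t / C0); first by rewrite divr_gt0.
move=> u w v uL wL vL bd dec g Ug gs.
pose e X := coor (gexp X).
have e0 : e 0 = 0 by rewrite /e gexp0 coor1.
have eS X Y : `|X| < t -> `|Y| < t -> `|e X - e Y - (X - Y)| <= C1 * t * `|X - Y|.
  by move=> Xt Yt; exact: eP.
have eL X Y : `|X| < t -> `|Y| < t -> `|e X - e Y| <= 2 * `|X - Y|.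
  move=> Xt Yt; have := eS _ _ Xt Yt.
  have := ler_normD (e X - e Y - (X - Y)) (X - Y); rewrite subrK.
  have : C1 * t * `|X - Y| <= 2^-1 * `|X - Y| by rewrite ler_wpM2r.
  have := normr_ge0 (X - Y); lra.
have eB X : `|X| < t -> `|e X| < 2 * t.
  move=> Xt; have t00 : `|0 : V| < t by rewrite normr0.
  by have := eL _ _ Xt t00; rewrite e0 !subr0; lra.
have eU X : `|X| < t -> U (gexp X) /\ gpoint (e X) = gexp X.
  move=> Xt; have UX : U (gexp X) by apply: gU; lra.
  by split => //; rewrite /e coorK.
have small (f : V -> V) Z : `|f Z| <= C0 * `|Z| -> `|Z| < t / C0 -> `|f Z| < t.
  by move=> fZ; rewrite ltr_pdivlMr// mulrC; exact: le_lt_trans.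
pose p Z := lmul (e (u Z)) (e (w Z)).
pose F Z := lmul (p Z) (e (v Z)).
have lin0 (f : V -> V) : linear f -> f 0 = 0 by move=> fL; have := linearZ0 fL 0 0; rewrite !scale0r.
have linB (f : V -> V) : linear f -> forall x y, f (x - y) = f x - f y.
  by move=> fL x y; exact: linearB0.
have F0 : F 0 = 0 by rewrite /F /p (lin0 _ uL) (lin0 _ wL) (lin0 _ vL) e0 !lmul00.
have t8 : 8 * t <= 2 * r by lra.
have t2 : 2 * t <= 2 * r by lra.
have t28 : 2 * t <= 8 * t by lra.
have C2t : C * (2 * t) <= 1.
  have : 0 < C * t by rewrite mulr_gt0. by lra.
have pB Z : `|Z| < t / C0 -> `|p Z| < 8 * t.
  move=> Zt; have [/small us /small ws /small vs] := bd Z.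
  have n0 : `|0 : V| < 2 * t by rewrite normr0 mulr_gt0.
  have := lmul_lipschitz rC t2 C2t (eB _ (us Zt)) (eB _ (ws Zt)) n0 n0.
  rewrite lmul00 !subr0 => /le_lt_trans; apply.
  by rewrite (_ : 8 * t = 2 * (2 * t + 2 * t)) ?ltr_pM2l ?ltrD ?eB ?us ?ws//; ring.
have FP Z Z' : `|Z| < t / C0 -> `|Z'| < t / C0 -> `|F Z - F Z' - (Z - Z')| <= 2^-1 * `|Z - Z'|.
  move=> Zt Zt'; have [/small us /small ws /small vs] := bd Z.
  have [/small us' /small ws' /small vs'] := bd Z'.
  have {}us := us Zt; have {}ws := ws Zt; have {}vs := vs Zt.
  have {}us' := us' Zt'; have {}ws' := ws' Zt'; have {}vs' := vs' Zt'.
  have [] := bd (Z - Z'); rewrite (linB _ uL) (linB _ wL) (linB _ vL) => du dw dv.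
  have v8 : `|e (v Z)| < 8 * t by exact: lt_le_trans (eB _ vs) t28.
  have v8' : `|e (v Z')| < 8 * t by exact: lt_le_trans (eB _ vs') t28.
  have h1 := lP _ _ _ _ _ t8 (pB _ Zt) v8 (pB _ Zt') v8'.
  have h2 := lP _ _ _ _ _ t2 (eB _ us) (eB _ ws) (eB _ us') (eB _ ws').
  have h3 := lmul_lipschitz rC t2 C2t (eB _ us) (eB _ ws) (eB _ us') (eB _ ws').
  have k1 := eL _ _ us us'; have k2 := eL _ _ ws ws'; have k3 := eL _ _ vs vs'.
  have j1 := eS _ _ us us'; have j2 := eS _ _ ws ws'; have j3 := eS _ _ vs vs'.
  have dE : Z - Z' = (u Z - u Z') + (w Z - w Z') + (v Z - v Z').
    by rewrite -(linB _ uL) -(linB _ wL) -(linB _ vL); exact: dec.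
  rewrite [in leLHS]dE (telescope_increments (F Z - F Z') (p Z - p Z') (e (u Z) - e (u Z'))
    (e (w Z) - e (w Z')) (e (v Z) - e (v Z'))).
  have tri (x y : V) (a b : R) : `|x| <= a -> `|y| <= b -> `|x + y| <= a + b.
    by move=> xa yb; rewrite (le_trans (ler_normD _ _))// lerD.
  have := tri _ _ _ _ h1 (tri _ _ _ _ h2 (tri _ _ _ _ j1 (tri _ _ _ _ j2 j3))).
  move/le_trans; apply.
  exact: (factorisation_estimate (ltW Cp) (ltW C10) (ltW t0) CCt (normr_ge0 (Z - Z'))
    du dw dv k1 k2 k3 h3).
have [Z Zle FZ] := near_identity_surjective F0 FP gs.
exists Z => //; have Zt := le_lt_trans Zle gs.
have [/small us /small ws /small vs] := bd Z.
have {}us := us Zt; have {}ws := ws Zt; have {}vs := vs Zt.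
have eu := lt_le_trans (eB _ us) t2; have ew := lt_le_trans (eB _ ws) t2.
have ev := lt_le_trans (eB _ vs) t2; have pZ := lt_le_trans (pB _ Zt) t8.
have [_ gu] := eU _ us; have [_ gw] := eU _ ws; have [_ gv] := eU _ vs.
have p1 := point_lmul rC eu ew; have p2 := point_lmul rC pZ ev.
rewrite gu gw in p1; rewrite -/(F Z) FZ coorK// gv p1 in p2.
exact: esym p2.
Qed.

End Factorisation.

Local Opaque Ad dif1 ad.

(** * Splitting of a single weight vector *)

Section WeightSplitting.
Context {R : realType} {n : nat} {G : lieGroupType R n}.
Local Notation V := 'rV[R]_n.
Local Notation gexp := (@gexp R n G).
Variables (sigma theta : G -> G) (fa : {vspace V}).
Hypothesis se : lie_endo sigma.
Hypothesis te : lie_endo theta.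
Hypothesis sK : involutive sigma.
Hypothesis tK : involutive theta.
Hypothesis ts : forall g, theta (sigma g) = sigma (theta g).
Hypothesis tfa : forall X, X \in fa -> dif1 theta X = - X.
Hypothesis sfa : forall X, X \in fa -> dif1 sigma X = - X.
Local Notation lf := 'Hom(subvs_of fa, R^o).
Implicit Types (beta : lf) (X : subvs_of fa).

Lemma dif1_commute (Y : V) : dif1 theta (dif1 sigma Y) = dif1 sigma (dif1 theta Y).
Proof.
apply: gexp_inj => t.
have E (f g : G -> G) : lie_endo f -> lie_endo g ->
    gexp (t *: dif1 f (dif1 g Y)) = f (g (gexp (t *: Y))).
  move=> fe ge; rewrite -(dif1Z t _ fe) -(dif1Z t _ ge) -(endo_gexp _ fe).
  by rewrite -(endo_gexp _ ge).
exact: etrans (E _ _ te se) (etrans (ts _) (esym (E _ _ se te))).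
Qed.

Lemma Ad_root beta X (Y : V) : root_space G beta Y ->
  Ad (gexp (vsval X)) Y = expR (beta X) *: Y.
Proof.
move=> bY; have := Ad_weight (bY X) 1; rewrite scale1r mulr1; exact.
Qed.

Lemma root_space_opp (tau : G -> G) beta (Y : V) : lie_endo tau ->
  (forall Z : V, Z \in fa -> dif1 tau Z = - Z) ->
  root_space G beta Y -> root_space G (- beta) (dif1 tau Y).
Proof.
move=> taue tauN bY X; have := dif1_ad (vsval X) Y taue.
rewrite (tauN _ (subvsP X)) (bY X) (dif1Z _ _ taue) opp_lfunE scaleNr => ->.
have := linearZ0 (@ad_linear_l _ _ G (dif1 tau Y)) (-1) (vsval X).
by rewrite scaleN1r => ->; rewrite scaleN1r opprK.
Qed.

Definition splits (I : set lf) (a : G) (Y : V) (K : R) :=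
  exists u w v : V, [/\ dif1 theta u = u,
    forall X, (forall alpha : lf, I alpha -> alpha X = 0) -> ad G (vsval X) w = 0,
    dif1 sigma v = v, Y = u + w + Ad a v &
    [/\ `|u| <= K, `|w| <= K, `|v| <= K & `|Ad a v| <= K]].

Lemma ad_r0 (Z : V) : ad G Z 0 = 0.
Proof. by have := linearZ0 (@ad_linear_r _ _ G Z) 0 0; rewrite !scale0r. Qed.

(** With [k = expR (- beta X)], the inequality [c <= beta X] bounds [1 - k ^+ 4] from below by a
    number that depends on [c] alone; this is why [K] can be chosen before [X]. *)
Lemma splits_positive I beta (c : R) (Y : V) : 0 < c -> root_space G beta Y ->
  exists K, forall X, c <= beta X -> splits I (gexp (vsval X)) Y K.
Proof.
move=> c0 bY; pose m := 1 - expR (- c) ^+ 4.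
have e1 : expR (- c) < 1 by rewrite expR_lt1 oppr_lt0.
have m0 : 0 < m by rewrite subr_gt0 exprn_ilt1// expR_ge0.
exists (m^-1 * (`|Y| + `|dif1 sigma Y| + `|dif1 theta Y| + `|dif1 theta (dif1 sigma Y)|)).
move=> X cX; pose k := expR (- beta X).
have kc : k <= expR (- c) by rewrite ler_expR lerN2.
have k1 : k <= 1 by rewrite (le_trans kc) ?ltW.
have k0 : 0 < k by exact: expR_gt0.
have mk : m <= 1 - k ^+ 4 by rewrite lerB// lerXn2r ?nnegrE ?expR_ge0// ltW.
have sY := root_space_opp se sfa bY; have tY := root_space_opp te tfa bY.
have tsY := root_space_opp te tfa sY; rewrite opprK in tsY.
have AY := Ad_root X bY; have AS := Ad_root X sY; have AT := Ad_root X tY.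
have AJ := Ad_root X tsY.
have kV : expR (beta X) = k^-1 by rewrite /k expRN invrK.
rewrite kV in AY AJ; rewrite opp_lfunE -/k in AS AT.
have [u [v [tu sv E [ub vb Avb]]]] := split_positive_root (dif1_linear te) (dif1_linear se)
  (Ad_linear (gexp (vsval X))) (dif1K te tK) (dif1K se sK) dif1_commute
  k0 k1 m0 mk AY AJ AS AT.
exists u, 0, v; split; [exact: tu|by move=> *; exact: ad_r0|exact: sv|by rewrite addr0|].
split; [exact: ub| |exact: vb|exact: Avb].
by rewrite normr0; exact: le_trans (normr_ge0 _) ub.
Qed.

(** Write [Y] as [(Y + theta Y) + (- theta Y)]: the first term is fixed by [theta] and joins [u],
    the second has weight [- beta] and falls under the positive case. *)
Lemma splits_negative I beta (c : R) (Y : V) : 0 < c -> root_space G beta Y ->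
  exists K, forall X, c <= (- beta) X -> splits I (gexp (vsval X)) Y K.
Proof.
move=> c0 bY; have tY := root_space_opp te tfa bY.
have ntY : root_space G (- beta) (- dif1 theta Y).
  move=> X; have := linearZ0 (@ad_linear_r _ _ G (vsval X)) (-1) (dif1 theta Y).
  by rewrite scaleN1r => ->; rewrite (tY X) scaleN1r scalerN.
have [K KP] := splits_positive I c0 ntY.
exists (K + `|Y + dif1 theta Y|) => X /KP[u [w [v [tu Xw sv E [ub wb vb Avb]]]]].
have sub p q : - q = u + w + p -> Y = u + (Y + q) + w + p.
  by move=> E'; rewrite (addrAC u) (addrAC (u + w)) -E' addrC addrK.
exists (u + (Y + dif1 theta Y)), w, v; split; [|exact: Xw|exact: sv|exact: sub E|].
- apply: etrans (dif1D _ _ te) _; rewrite tu; congr (_ + _).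
  apply: etrans (dif1D _ _ te) _; rewrite (dif1K te tK); exact: addrC.
- have KY : K <= K + `|Y + dif1 theta Y| by rewrite lerDl.
  split; [exact: le_trans (ler_normD _ _) (lerD ub (lexx _))|exact: le_trans wb KY|
    exact: le_trans vb KY|exact: le_trans Avb KY].
Qed.

Lemma splits_centralizing I beta (Y : V) :
  (forall X, (forall alpha : lf, I alpha -> alpha X = 0) -> beta X = 0) ->
  root_space G beta Y -> forall X, splits I (gexp (vsval X)) Y `|Y|.
Proof.
move=> bI bY X; exists 0, Y, 0.
have A0 : Ad (gexp (vsval X)) 0 = 0.
  by have := linearZ0 (Ad_linear (gexp (vsval X))) 0 0; rewrite !scale0r.
have d0 (tau : G -> G) : lie_endo tau -> dif1 tau 0 = 0.
  by move=> taue; have := linearZ0 (dif1_linear taue) 0 0; rewrite !scale0r.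
split; [exact: d0| |exact: d0|by rewrite A0 add0r addr0|by rewrite A0 normr0; split].
by move=> X' XI; rewrite (bY X') (bI X' XI) scale0r.
Qed.

Lemma logA_exp (a : G) : expA fa a -> gexp (vsval (logA fa a)) = a.
Proof.
move=> [X _ Xa]; rewrite -lexpE.
exact: (@xgetPex _ 0 [set X : subvs_of fa | lexp G (vsval X) = a] (ex_intro _ X Xa)).
Qed.

Lemma weight_splits (P I : set lf) (c : R) (m : nat) (b : 'I_m -> lf) beta (Y : V) :
  0 < c -> positive_roots G P -> (forall beta, roots_of G beta -> exists i, beta = b i) ->
  root_space G beta Y ->
  exists K, forall a : G, chamber_part P I c a -> splits I a Y K.
Proof.
move=> c0 [X0 [Xreg PE]] rb bY.
have Pr beta' : P beta' -> roots_of G beta' by rewrite PE => -[].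
have P0 beta' : P beta' -> 0 < (beta' X0 : R) by rewrite PE => -[].
have Pb beta' : P beta' -> exists i, beta' = b i by move=> /Pr/rb.
have fin (Q : subvs_of fa -> Prop) K : (forall X, Q X -> splits I (gexp (vsval X)) Y K) ->
    (forall a : G, chamber_part P I c a -> Q (logA fa a)) ->
    exists K, forall a : G, chamber_part P I c a -> splits I a Y K.
  move=> QK aQ; exists K => a aP; have [[aA _] _ _] := aP.
  by have := QK _ (aQ _ aP); rewrite (logA_exp aA).
have central : (forall X, (forall alpha : lf, I alpha -> alpha X = 0) -> beta X = 0) ->
    exists K, forall a : G, chamber_part P I c a -> splits I a Y K.
  move=> bI; apply: (fin (fun=> True) `|Y|) => // X _; exact: splits_centralizing bI bY _.
have [b00|bn0] := eqVneq beta 0.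
  by apply: central => X _; rewrite b00 lfunE.
(* A zero [Y] is set aside, because a weight is a root only when it has a nonzero weight vector. *)
have [Y0|Yn0] := eqVneq Y 0.
  apply: (fin (fun=> True) `|Y|) => // X _.
  apply: (splits_centralizing (beta := 0)) => [X' _|X']; first by rewrite lfunE.
  by rewrite Y0 ad_r0 scaler0.
have rbeta : roots_of G beta by split => //; exists Y.
have := Xreg _ rbeta; rewrite neq_lt => /orP[bneg|bpos].
- have Pnb : P (- beta).
    rewrite PE; split; last by rewrite opp_lfunE oppr_gt0.
    split; first by rewrite oppr_eq0.
    exists (dif1 theta Y); last exact: root_space_opp.
    apply: contra_neq Yn0 => tY0; rewrite -(dif1K te tK Y) tY0.
    by have := linearZ0 (dif1_linear te) 0 0; rewrite !scale0r.
  have [bI|bc] := chamber_dichotomy I c Pb P0 Pnb.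
    by apply: central => X XI; have := bI X XI; rewrite opp_lfunE => /eqP; rewrite oppr_eq0 => /eqP.
  have [K KP] := splits_negative I c0 bY.
  by apply: fin KP _ => a [[_ aP] aS _]; exact: bc.
- have Pbeta : P beta by rewrite PE.
  have [bI|bc] := chamber_dichotomy I c Pb P0 Pbeta; first exact: central.
  have [K KP] := splits_positive I c0 bY.
  by apply: fin KP _ => a [[_ aP] aS _]; exact: bc.
Qed.

End WeightSplitting.

Section RowCombination.
Context {R : realType} {n : nat} (Q : 'M[R]_n).
Local Notation V := 'rV[R]_n.
Hypothesis Qu : Q \in unitmx.

(** For invertible [Q], this is the linear map that sends the [i]-th row of [Q] to [x i]. *)
Definition row_comb (x : 'I_n -> V) (Z : V) : V := \sum_i (Z *m invmx Q) 0 i *: x i.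

Lemma row_comb_linear x : linear (row_comb x).
Proof.
move=> a Y Z; rewrite /row_comb scaler_sumr -big_split; apply: eq_bigr => i _.
by rewrite mulmxDl -scalemxAl !mxE scalerDl scalerA.
Qed.

Lemma row_comb_fun (f : V -> V) x Z : linear f -> f (row_comb x Z) = row_comb (f \o x) Z.
Proof.
move=> fL; pose F : {linear V -> V} := HB.pack f (GRing.isLinear.Build _ _ _ _ f fL).
by rewrite -[LHS]/(F _) linear_sum; apply: eq_bigr => i _; rewrite linearZ.
Qed.

Lemma row_comb_row Z : row_comb (fun i => row i Q) Z = Z.
Proof. by rewrite /row_comb -mulmx_sum_row mulmxKV. Qed.

Lemma row_combD x y Z : row_comb (fun i => x i + y i) Z = row_comb x Z + row_comb y Z.
Proof. by rewrite /row_comb -big_split; apply: eq_bigr => i _; rewrite scalerDr. Qed.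

(** [C] is chosen before [x]: the images of the basis vectors will vary with [a], their bounds [K]
    will not. *)
Lemma row_comb_bounded (K : 'I_n -> R) : (forall i, 0 <= K i) ->
  exists2 C, 0 < C & forall x, (forall i, `|x i| <= K i) ->
    forall Z, `|row_comb x Z| <= C * `|Z|.
Proof.
move=> K0; have QL : linear (fun Z : V => Z *m invmx Q) by move=> a Y Z; rewrite mulmxDl -scalemxAl.
have [L L0 LP] := linear_bounded QL.
have S0 : 0 <= \sum_i K i by apply: sumr_ge0.
exists (L * (\sum_i K i) + 1) => [|x xK Z]; first by rewrite ltr_wpDl// mulr_ge0// ltW.
rewrite /row_comb (le_trans (ler_norm_sum _ _ _))//.
rewrite (@le_trans _ _ (L * (\sum_i K i) * `|Z|))//; last by rewrite ler_wpM2r// lerDl.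
rewrite mulrAC mulr_sumr; apply: ler_sum => i _; rewrite normrZ ler_pM//.
by rewrite (le_trans (mx_coord_le _ _)).
Qed.

End RowCombination.

(** * From weight vectors to all vectors, and membership of the factors *)

Section Assembly.
Context {R : realType} {n : nat} {G : lieGroupType R n}.
Local Notation V := 'rV[R]_n.
Local Notation gexp := (@gexp R n G).

(** Expand a root vector on the basis of weight vectors and pick a nonzero coordinate [i]: comparing
    this coordinate on both sides of [ad X Y = beta X Y] gives [beta = b i]. In particular the roots
    are finite in number. *)
Lemma roots_of_basis (fa : {vspace V}) (Q : 'M[R]_n) (b : 'I_n -> 'Hom(subvs_of fa, R^o)) :
  Q \in unitmx -> (forall i, root_space G (b i) (row i Q)) ->
  forall beta, roots_of G beta -> exists i, beta = b i.
Proof.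
move=> Qu bQ beta [_ [Y Yn0 bY]]; pose d := Y *m invmx Q.
have YE : Y = \sum_i d 0 i *: row i Q by rewrite -mulmx_sum_row mulmxKV.
have [i di] : exists i, d 0 i != 0.
  apply: contrapT => nd; case/eqP: Yn0; rewrite YE big1// => i _.
  have [->|di] := eqVneq (d 0 i) 0; first by rewrite scale0r.
  by case: nd; exists i.
exists i; apply/lfunP => X; apply: (mulIf di).
pose F : {linear V -> V} := HB.pack (ad G (vsval X))
  (GRing.isLinear.Build _ _ _ _ _ (@ad_linear_r _ _ G (vsval X))).
have E1 : F Y = (beta X : R) *: Y := bY X.
have E2 : F Y = \sum_j (d 0 j * b j X) *: row j Q.
  rewrite [in LHS]YE linear_sum; apply: eq_bigr => j _.
  by rewrite linearZ/= -scalerA; congr (_ *: _); exact: bQ.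
have E3 : F Y *m invmx Q = \row_j (d 0 j * b j X).
  rewrite E2; have -> : \sum_j (d 0 j * b j X) *: row j Q = (\row_j (d 0 j * b j X)) *m Q.
    by rewrite mulmx_sum_row; apply: eq_bigr => j _; rewrite mxE.
  by rewrite mulmxK.
have : (F Y *m invmx Q) 0 i = beta X * d 0 i by rewrite E1 -scalemxAl mxE.
by rewrite E3 mxE mulrC => ->.
Qed.

Variables (sigma theta : G -> G) (fa : {vspace V}).
Hypothesis se : lie_endo sigma.
Hypothesis te : lie_endo theta.
Hypothesis sK : involutive sigma.
Hypothesis tK : involutive theta.
Hypothesis ts : forall g, theta (sigma g) = sigma (theta g).
Hypothesis tfa : forall X, X \in fa -> dif1 theta X = - X.
Hypothesis sfa : forall X, X \in fa -> dif1 sigma X = - X.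
Hypothesis afa : forall X Y, X \in fa -> Y \in fa -> ad G X Y = 0.
Hypothesis Bpos : forall X : V, X != 0 -> 0 < Bform theta X X.
Local Notation lf := 'Hom(subvs_of fa, R^o).

Lemma simultaneous_splitting (P I : set lf) (c : R) : 0 < c -> positive_roots G P ->
  exists2 C0 : R, 0 < C0 & forall a : G, chamber_part P I c a ->
    exists u w v : V -> V, [/\ linear u, linear w, linear v & forall Z,
      [/\ dif1 theta (u Z) = u Z,
        forall X, (forall alpha : lf, I alpha -> alpha X = 0) -> ad G (vsval X) (w Z) = 0,
        dif1 sigma (v Z) = v Z, Z = u Z + w Z + Ad a (v Z) &
        [/\ `|u Z| <= C0 * `|Z|, `|w Z| <= C0 * `|Z|, `|v Z| <= C0 * `|Z| &
            `|Ad a (v Z)| <= C0 * `|Z|]]].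
Proof.
move=> c0 Ppos; have [Q Qu /choice[b bQ]] := weight_basis te tK Bpos tfa afa.
have rb := roots_of_basis Qu bQ.
have /choice[K KP] : forall i, exists K, forall a : G, chamber_part P I c a ->
    splits sigma theta I a (row i Q) K.
  by move=> i; apply: weight_splits rb (bQ i).
have K0 i : 0 <= `|K i| by [].
have [C0 C00 CP] := row_comb_bounded Q K0.
exists C0 => // a aP.
have /choice[x xP] : forall i, exists x : V * V * V, [/\ dif1 theta x.1.1 = x.1.1,
    forall X, (forall alpha : lf, I alpha -> alpha X = 0) -> ad G (vsval X) x.1.2 = 0,
    dif1 sigma x.2 = x.2, row i Q = x.1.1 + x.1.2 + Ad a x.2 &
    [/\ `|x.1.1| <= `|K i|, `|x.1.2| <= `|K i|, `|x.2| <= `|K i| & `|Ad a x.2| <= `|K i|]].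
  move=> i; have [u [w [v [tu Xw sv E [ub wb vb Avb]]]]] := KP i a aP.
  exists (u, w, v); have Ki := ler_norm (K i).
  by split => //=; split; [exact: le_trans ub _|exact: le_trans wb _|
    exact: le_trans vb _|exact: le_trans Avb _].
exists (row_comb Q (fun i => (x i).1.1)), (row_comb Q (fun i => (x i).1.2)),
  (row_comb Q (fun i => (x i).2)).
split; [exact: row_comb_linear..|move=> Z].
have Av : Ad a (row_comb Q (fun i => (x i).2) Z) = row_comb Q (fun i => Ad a (x i).2) Z.
  exact: (row_comb_fun Q (fun i => (x i).2) Z (Ad_linear a)).
split.
- apply: etrans (row_comb_fun Q _ Z (dif1_linear te)) _.
  by apply: eq_bigr => i _; have [/= -> _ _ _ _] := xP i.
- move=> X XI; apply: etrans (row_comb_fun Q _ Z (@ad_linear_r _ _ G (vsval X))) _.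
  by rewrite /row_comb big1// => i _; have [_ /= -> // _ _ _] := xP i; rewrite scaler0.
- apply: etrans (row_comb_fun Q _ Z (dif1_linear se)) _.
  by apply: eq_bigr => i _; have [_ _ /= -> _ _] := xP i.
- rewrite Av -!row_combD -[LHS](row_comb_row Qu).
  by apply: eq_bigr => i _; have [_ _ _ -> _] := xP i.
- rewrite Av; split; apply: CP => i; have [_ _ _ _ [ub wb vb Avb]] := xP i;
    [exact: ub|exact: wb|exact: vb|exact: Avb].
Qed.

Lemma gexp_fixed (tau : G -> G) (X : V) : lie_endo tau -> dif1 tau X = X ->
  fixed_set tau (gexp X).
Proof. by move=> taue tX; rewrite /fixed_set/= (endo_gexp _ taue) tX. Qed.

Lemma gexp_connected_component (tau : G -> G) (X : V) : lie_endo tau -> dif1 tau X = X ->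
  connected_component (fixed_set tau) 1%g (gexp X).
Proof.
move=> taue tX; pose p (t : R) := gexp (t *: X).
have p0 : p 0 = 1%g by rewrite /p scale0r; exact: gexp0.
have p1 : p 1 = gexp X by rewrite /p scale1r.
exists (p @` `[0, 1]%classic); last first.
  by exists 1 => //=; rewrite in_itv/= ler01 lexx.
split.
- by exists 0 => //=; rewrite in_itv/= ler01 lexx.
- move=> _ [t _ <-]; apply: gexp_fixed => //.
  by apply: etrans (dif1Z t X taue) _; rewrite tX.
- apply: connected_continuous_connected; first exact: segment_connected.
  apply: continuous_subspaceT => t.
  by have [pc _ _] := @gexp_one_param _ _ G X; exact: pc.
Qed.

Lemma gexp_centralizer (I : set lf) (X : V) :
  (forall Z, (forall alpha : lf, I alpha -> alpha Z = 0) -> ad G (vsval Z) X = 0) ->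
  centralizer (@sub_torus R n G fa I) (gexp X).
Proof.
move=> XI _ [Z ZI <-]; rewrite lexpE.
exact: esym (ad0_commute (XI Z ZI)).
Qed.

(** The form is bounded by [K] times the squared norm, and [K <= (K + 1)^2] avoids a square root in
    the constant. *)
Lemma rdist_gexp_le : exists2 K : R, 0 < K & forall X : V,
  (rdist theta (gexp X) 1%g <= (K * `|X|)%:E)%E.
Proof.
have [K K0 KP] := bilinear_bounded (@Bform_linear R n G theta) (Bform_sym te tK).
exists (K + 1) => [|X]; first by rewrite ltr_wpDl// ltW.
rewrite (le_trans (rdist_gexp theta X))// lee_fin.
have K1 : 0 <= (K + 1) * `|X| by rewrite mulr_ge0// addr_ge0// ltW.
rewrite -[leRHS]ger0_norm// -sqrtr_sqr ler_sqrt ?sqr_ge0//.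
rewrite (le_trans (ler_norm _))// (le_trans (KP _ _))// normrN -expr2 exprMn ler_wpM2r ?sqr_ge0//.
by rewrite expr2 mulrDl mulrDr mulr1 mul1r; have := mulr_gt0 K0 K0; lra.
Qed.

End Assembly.

Theorem theorem2p1 (R : realType) (n : nat) (G : lieGroupType R n)
    (G_connected : connected [set: G]) (G_noncompact : ~ compact [set: G])
    (G_semisimple : semisimple G) (G_center : finite_set (lie_center G))
    (sigma : G -> G) (sigma_inv : lie_involution sigma)
    (H : set G) (H_subgroup : is_subgroup H) (H_closed : closed H)
    (H_sigma : connected_component H 1%g
               = connected_component (fixed_set sigma) 1%g)
    (theta : G -> G) (theta_cartan : cartan_involution theta)
    (theta_sigma : forall g, theta (sigma g) = sigma (theta g))
    (fa : {vspace 'rV[R]_n})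
    (fa_max : maximal_abelian_in_pq sigma theta fa)
    (P : set 'Hom(subvs_of fa, R^o)) (P_pos : positive_roots G P)
    (I : set 'Hom(subvs_of fa, R^o)) (I_simple : I `<=` simple_roots P)
    (c : R) (c_gt0 : 0 < c) :
  exists eps0 l : R, [/\ 0 < eps0, 1 < l &
    forall eps : R, 0 < eps -> eps < eps0 ->
    forall a : G, chamber_part P I c a ->
      setmulg (near1 theta [set: G] eps) [set a] `<=`
      setmulg
        (setmulg
          (setmulg (near1 theta (fixed_set theta) (l * eps))
                   (near1 theta (centralizer (sub_torus I)) (l * eps)))
          [set a])
        (near1 theta H (l * eps))].
Proof.
have [ss sM sK] := sigma_inv; have se := smooth_endo ss sM.
have [[tss tM tK] Bpos] := theta_cartan; have te := smooth_endo tss tM.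
have [[fpq afa] _] := fa_max.
have tfa (X : 'rV[R]_n) : X \in fa -> dif1 theta X = - X by move=> /fpq[].
have sfa (X : 'rV[R]_n) : X \in fa -> dif1 sigma X = - X by move=> /fpq[].
have [C0 C00 split_a] :=
  simultaneous_splitting se te sK tK theta_sigma tfa sfa afa Bpos I c_gt0 P_pos.
have [s s0 fact] := @product_surjective R n G C0 C00.
have [K0 K00 K0P] := norm_le_sqrt_form (@Bform_linear R n G theta)
  (Bform_sym te tK) Bpos.
have [r [r0 lower]] := rdist_coor_le K00 K0P.
have [Kb Kb0 upper] := rdist_gexp_le te tK.
(* The factors are met on the way from [eps]: the coordinates of [g] are at most [2 * K0 * eps], the
   solution [Z] at most twice as large, its components at most [C0] times larger, and [Kb] leads
   back to distances. Adding [2] ensures [1 < l] and a strict final inequality. *)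
pose l := Kb * (C0 * (2 * (2 * K0))) + 2.
have l0 : 0 < Kb * (C0 * (2 * (2 * K0))) by rewrite !mulr_gt0.
have K20 : 0 < 2 * K0 by rewrite mulr_gt0.
(* The first bound puts [g] within reach of the coordinate estimate, the second gives
   [2 * |coor g| < s]. *)
exists (Num.min (r / (2 * K0)) (s / (2 * (2 * K0)))), l; split.
- by rewrite lt_min !divr_gt0// mulr_gt0.
- by rewrite /l; lra.
move=> eps e0; rewrite lt_min => /andP[er es] a aP _ [g [_ gd] [_ -> <-]].
rewrite ltr_pdivlMr// mulrC in er.
have [Ug gle] := lower g eps gd er.
have gs : 2 * `|coor g| < s.
  rewrite ltr_pdivlMr ?mulr_gt0// in es.
  by rewrite mulrC -mulrA in es; rewrite (le_lt_trans _ es)// ler_wpM2l.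
have [u [w [v [uL wL vL uwv]]]] := split_a a aP.
have xL : linear (fun Z => Ad a (v Z)).
  by move=> b X Y; rewrite (vL b X Y); exact: Ad_linear.
have [|Z|Z Zle gE] := fact u w (fun Z => Ad a (v Z)) uL wL xL _ _ g Ug gs.
- by move=> Z; have [_ _ _ _ [? ? _ ?]] := uwv Z.
- by have [_ _ _ + _] := uwv Z.
have [tu Xw sv _ [ub wb vb _]] := uwv Z.
have small (X : 'rV[R]_n) : `|X| <= C0 * `|Z| -> (rdist theta (gexp X) 1%g < (l * eps)%:E)%E.
  move=> XZ; rewrite (le_lt_trans (upper X))// lte_fin.
  have : Kb * `|X| <= Kb * (C0 * (2 * (2 * K0 * eps))).
    rewrite ler_wpM2l ?(ltW Kb0)// (le_trans XZ)// ler_wpM2l ?(ltW C00)//.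
    by rewrite (le_trans Zle)// ler_wpM2l.
  move/le_lt_trans; apply.
  have -> : Kb * (C0 * (2 * (2 * K0 * eps))) = Kb * (C0 * (2 * (2 * K0))) * eps by ring.
  by rewrite ltr_pM2r// /l ltrDl.
exists (gexp (u Z) * gexp (w Z) * a)%g.
  exists (gexp (u Z) * gexp (w Z))%g; last by exists a.
  exists (gexp (u Z)); first by split; [exact: gexp_fixed tu|exact: small].
  by exists (gexp (w Z)) => //; split; [exact: gexp_centralizer|exact: small].
exists (gexp (v Z)).
  split; last exact: small.
  (* [gexp (v Z)] lies in the identity component of the fixed points of [sigma], which is that of
     [H]. *)
  apply: (@connected_component_sub _ H 1%g); rewrite H_sigma.
  exact: gexp_connected_component.
(* [gexp (Ad a (v Z))] is [a * gexp (v Z) * a^-1], whose last factor cancels against [a]. *)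
rewrite -gE -conj_gexp.
by move: (gexp _) (gexp _) (gexp _) => x y z; rewrite !mulgA mulgVK.
Qed.
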